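(* Let $2\le N<\infty$. The decoding map $\mathrm{Dec}_{F_N}$ provides a bijection between unitary equivalence classes of irreducible permutative representations of the Cuntz algebra $\mathcal{O}_N$ and $\mathrm{PGL}_2(\mathbb{Z})$-equivalence classes of real numbers; namely, the assignment sending the unitary equivalence class of $\pi_S^N|_{\mathcal{H}_{[(x_n)]}}$ (for $(x_n)\in\Omega_N$) to the $\mathrm{PGL}_2(\mathbb{Z})$-equivalence class of $\mathrm{Dec}_{F_N}((x_n))$ is a well-defined bijection. Moreover, an equivalence class of representations corresponds to an equivalence class of solutions to quadratic equations with integer coefficients (rational numbers included) if and only if it has finitely many atoms.
   Context: $\mathcal{O}_N$ ($2\le N<\infty$) is the universal $C^*$-algebra generated by $S_1,\dots,S_N$ with $S_i^*S_j=\delta_{ij}1$ and $\sum_{i=1}^N S_iS_i^*=1$. Representations are unital $*$-homomorphisms into $B(\mathcal{H})$; a representation is irreducible if $\{0\}$ and $\mathcal{H}$ are its only closed invariant subspaces. A representation $\pi$ of $\mathcal{O}_N$ on $\mathcal{H}$ is permutative if there is an orthonormal basis $\{e_k:k\in K\}$ of $\mathcal{H}$ such that $\pi(S_i)e_n\in\{e_k:k\in K\}$ for all $n\in K$ and $1\le i\le N$. Atoms: for a finite word $w=w_1\cdots w_k$ in $\{1,\dots,N\}$ put $S_w=S_{w_1}\cdots S_{w_k}$, and let $\mathcal{F}_N\subset\mathcal{O}_N$ be the $C^*$-subalgebra generated by all $S_wS_{w'}^*$ with $w,w'$ finite words of equal length. An atom of an irreducible permutative representation is an irreducible component of its restriction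 to $\mathcal{F}_N$. Shift representation: $\Omega_N=\{1,\dots,N\}^{\mathbb{N}}$ is the set of infinite sequences, and $\sigma_i((x_1,x_2,\dots))=(i,x_1,x_2,\dots)$. Let $\ell^2(\Omega_N)$ be the Hilbert space with orthonormal basis $\{e_\omega:\omega\in\Omega_N\}$, and let $\pi_S^N:\mathcal{O}_N\to B(\ell^2(\Omega_N))$ be defined by $\pi_S^N(S_i)e_\omega=e_{\sigma_i(\omega)}$. Write $(x_n)\sim(y_n)$ (tail equivalence) if there are $z\in\mathbb{Z}$, $m\in\mathbb{N}$ with $x_{n+z}=y_n$ for all $n\ge m$; $[(x_n)]$ denotes the class. $\mathcal{H}_{[(x_n)]}$ is the closed subspace of $\ell^2(\Omega_N)$ with orthonormal basis $\{e_{(y_n)}:(y_n)\in[(x_n)]\}$. Known fact (Bratteli–Jorgensen): each $\pi_S^N|_{\mathcal{H}_{[(x_n)]}}$ is an irreducible permutative representation, and every irreducible permutative representation of $\mathcal{O}_N$ is unitarily equivalent to exactly one of these. $\mathrm{PGL}_2(\mathbb{Z})$ is the group of $2\times2$ integer matrices of determinant $\pm1$ modulo $\pm$ identity, acting by fractional linear maps. Real numbers $x,y$ are $\mathrm{PGL}_2(\mathbb{Z})$-equivalent if $y=\frac{ax+b}{cx+d}$ for some $\begin{pmatrix}a&b\\c&d\end{pmatrix}\in\mathrm{PGL}_2(\mathbb{Z})$. The slow continued fraction algorithm $F_N$: it is given by the maps $h_1,\dots,h_N:[0,1]\to[0,1]$, where $h_1$ is the increasing fractional linear map in $\mathrm{PGL}_2(\mathbb{Z})$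 carrying $[0,1]$ onto $[0,\frac1N]$, and for $2\le i\le N$, $h_i$ is the decreasing fractional linear map in $\mathrm{PGL}_2(\mathbb{Z})$ carrying $[0,1]$ onto $[\frac{1}{N-i+2},\frac{1}{N-i+1}]$. Explicitly $h_1(x)=\frac{x}{(N-1)x+1}$ and $h_i(x)=\frac{1}{x+N-i+1}$ for $2\le i\le N$. Known fact (Panti): for every $(x_n)\in\Omega_N$ the intersection $\bigcap_{n\ge1}h_{x_1}\circ h_{x_2}\circ\cdots\circ h_{x_n}([0,1])$ is a single point; $\mathrm{Dec}_{F_N}((x_n))\in[0,1]$ denotes this point. *)

(* Defs.v *)
From HB Require Import structures.
From mathcomp Require Import all_boot all_order all_algebra.
From mathcomp Require Import complex.
From mathcomp Require Import all_classical all_reals all_analysis.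
Set Implicit Arguments.
Unset Strict Implicit.
Unset Printing Implicit Defensive.
Import Order.TTheory GRing.Theory Num.Theory.
Import numFieldNormedType.Exports.
Local Open Scope classical_set_scope.
Local Open Scope complex_scope.
Local Open Scope ring_scope.

(* The norm of a normed module over R[i] takes its (real, nonnegative) values
   in R[i]; the inner product is linear in its first argument. *)
HB.mixin Record CompleteNormedModule_isHilbert (R : realType) H
    of CompleteNormedModule R[i] H := {
  inner : H -> H -> R[i];
  inner_linear : forall (c : R[i]) (u v w : H),
    inner (c *: u + v) w = c * inner u w + inner v w;
  inner_conj : forall u v : H, inner v u = (inner u v)^*;
  inner_norm : forall u : H, inner u u = `|u| ^+ 2
}.

#[short(type="hilbertType")]
HB.structure Definition Hilbert (R : realType) :=
  {H of CompleteNormedModule R[i] H & CompleteNormedModule_isHilbert R H}.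

(* The product is a field of the mixin: Hierarchy Builder admits no structure
   other than number domains that joins rings and normed modules. *)
HB.mixin Record CompleteNormedModule_isCStar (R : realType) A
    of CompleteNormedModule R[i] A := {
  cone : A;
  cmul : A -> A -> A;
  star : A -> A;
  cmulA : associative cmul;
  cmul1x : left_id cone cmul;
  cmulx1 : right_id cone cmul;
  cmul_linearl : forall (c : R[i]) (a b d : A),
    cmul (c *: a + b) d = c *: cmul a d + cmul b d;
  cmul_linearr : forall (c : R[i]) (a b d : A),
    cmul d (c *: a + b) = c *: cmul d a + cmul d b;
  star_semilinear : forall (c : R[i]) (a b : A),
    star (c *: a + b) = c^* *: star a + star b;
  star_mul : forall a b : A, star (cmul a b) = cmul (star b) (star a);
  starK : involutive star;
  cmul_norm_le : forall a b : A, `|cmul a b| <= `|a| * `|b|;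
  cstar_norm : forall a : A, `|cmul (star a) a| = `|a| ^+ 2
}.

(* Unital C*-algebras. *)
#[short(type="cstarType")]
HB.structure Definition CStar (R : realType) :=
  {A of CompleteNormedModule R[i] A & CompleteNormedModule_isCStar R A}.

Arguments cone {R s}.

Definition cstar_subalgebra (R : realType) (A : cstarType R) (B : set A) :=
  [/\ (forall (c : R[i]) a b, B a -> B b -> B (c *: a + b)),
      (forall a b, B a -> B b -> B (cmul a b)),
      (forall a, B a -> B (star a)), B 0 & closed B].

Definition cstar_generated (R : realType) (A : cstarType R) (G : set A) : set A :=
  smallest (@cstar_subalgebra R A) G.

Definition unital_star_hom (R : realType) (A B : cstarType R)
    (phi : {linear A -> B}) :=
  [/\ phi cone = cone,
      (forall a b, phi (cmul a b) = cmul (phi a) (phi b))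
    & (forall a, phi (star a) = star (phi a))].

Definition cuntz_relations (R : realType) (N : nat) (A : cstarType R)
    (S : 'I_N -> A) :=
  (forall i j, cmul (star (S i)) (S j) = if i == j then cone else 0) /\
  \sum_(i < N) cmul (S i) (star (S i)) = cone.

(* (A, S) is the Cuntz algebra O_N with its canonical generators.  Since the
   S i generate A, the homomorphism phi is unique. *)
Definition is_cuntz_algebra (R : realType) (N : nat) (A : cstarType R)
    (S : 'I_N -> A) :=
  [/\ cuntz_relations S,
      cstar_generated (range S) = setT
    & forall (B : cstarType R) (T : 'I_N -> B), cuntz_relations T ->
      exists phi : {linear A -> B},
        unital_star_hom phi /\ forall i, phi (S i) = T i].

Definition word_op (R : realType) (N : nat) (A : cstarType R) (S : 'I_N -> A)
    (w : seq 'I_N) : A := foldr (fun i a => cmul (S i) a) cone w.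

(* The gauge-invariant UHF subalgebra F_N. *)
Definition cuntz_uhf (R : realType) (N : nat) (A : cstarType R)
    (S : 'I_N -> A) : set A :=
  cstar_generated [set a | exists w w' : seq 'I_N,
    size w = size w' /\ a = cmul (word_op S w) (star (word_op S w'))].

(* A unital *-homomorphism into B(H), with H = rep_space.  Its contractivity,
   which is automatic for *-homomorphisms of C*-algebras, is recorded by
   rep_le and contains the boundedness of each operator rep_map a. *)
Record representation (R : realType) (A : cstarType R) := Representation {
  rep_space : hilbertType R;
  rep_map :> A -> {linear rep_space -> rep_space};
  rep_linear : forall (c : R[i]) (a b : A) v,
    rep_map (c *: a + b) v = c *: rep_map a v + rep_map b v;
  rep_mul : forall (a b : A) v, rep_map (cmul a b) v = rep_map a (rep_map b v);
  rep_one : forall v, rep_map cone v = v;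
  rep_star : forall (a : A) u v,
    inner (rep_map a u) v = inner u (rep_map (star a) v);
  rep_le : forall (a : A) v, `|rep_map a v| <= `|a| * `|v|
}.

Definition closed_subspace (R : realType) (H : hilbertType R) (V : set H) :=
  [/\ V 0, (forall (c : R[i]) u v, V u -> V v -> V (c *: u + v)) & closed V].

Definition closed_span (R : realType) (H : hilbertType R) (E : set H) : set H :=
  smallest (@closed_subspace R H) E.

Definition orthonormal_basis (R : realType) (H : hilbertType R) (K : Type)
    (e : K -> H) :=
  [/\ (forall k, inner (e k) (e k) = 1),
      (forall k l, k <> l -> inner (e k) (e l) = 0)
    & closed_span (range e) = setT].

(* V is a closed subspace on which the operators pi b, b in B, act
   irreducibly; the zero subspace does not count as irreducible. *)
Definition irreducible_on (R : realType) (A : cstarType R)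
    (pi : representation A) (B : set A) (V : set (rep_space pi)) :=
  let invariant (W : set (rep_space pi)) :=
    forall b v, B b -> W v -> W (pi b v) in
  [/\ closed_subspace V, invariant V, V <> [set 0]
    & forall W, closed_subspace W -> invariant W -> W `<=` V ->
        W = [set 0] \/ W = V].

Definition irreducible (R : realType) (A : cstarType R)
    (pi : representation A) := irreducible_on (pi := pi) setT setT.

Definition permutative (R : realType) (N : nat) (A : cstarType R)
    (S : 'I_N -> A) (pi : representation A) :=
  exists (K : Type) (e : K -> rep_space pi),
    orthonormal_basis e /\ forall i n, exists k, pi (S i) (e n) = e k.

Definition atoms (R : realType) (N : nat) (A : cstarType R)
    (S : 'I_N -> A) (pi : representation A) : set (set (rep_space pi)) :=
  [set V | irreducible_on (cuntz_uhf S) V].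

Arguments atoms {R N A} S pi _.

(* rho is unitarily equivalent to the restriction of pi to V: U is a unitary
   from the space of rho onto V. *)
Definition equiv_restriction (R : realType) (A : cstarType R)
    (rho pi : representation A) (V : set (rep_space pi)) :=
  exists U : {linear rep_space rho -> rep_space pi},
    [/\ (forall u v, inner (U u) (U v) = inner u v),
        range U = V
      & forall a v, U (rho a v) = pi a (U v)].

(* Classes of representations.  The type of representations does not fit in
   the universe of the library's set, so a class is a bare predicate. *)
Definition rep_class (R : realType) (A : cstarType R) :=
  representation A -> Prop.

Definition restriction_class (R : realType) (A : cstarType R)
    (pi : representation A) (V : set (rep_space pi)) : rep_class A :=
  fun rho => equiv_restriction rho V.

Definition unitary_class (R : realType) (A : cstarType R)
    (pi : representation A) : rep_class A :=
  restriction_class (pi := pi) setT.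

Arguments unitary_class {R A} pi _.

Definition irr_permutative_class (R : realType) (N : nat) (A : cstarType R)
    (S : 'I_N -> A) (C : rep_class A) :=
  exists pi : representation A,
    [/\ irreducible pi, permutative S pi & C = unitary_class pi].

(* Sequences are indexed from 0 and the alphabet {1, ..., N} is encoded as
   'I_N = {0, ..., N - 1}. *)
Definition Omega (N : nat) := nat -> 'I_N.

Definition scons (N : nat) (i : 'I_N) (x : Omega N) : Omega N :=
  fun n => if n is m.+1 then x m else i.

Definition tail_equiv (N : nat) (x y : Omega N) :=
  exists (z : int) (m : nat), forall n : nat, (m <= n)%N ->
    0 <= n%:Z + z /\ x (absz (n%:Z + z)) = y n.

(* pi is the representation on l^2(Omega N), the Hilbert space with
   orthonormal basis e, given by S_i e_x = e_(i x). *)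
Definition is_shift_representation (R : realType) (N : nat) (A : cstarType R)
    (S : 'I_N -> A) (pi : representation A) (e : Omega N -> rep_space pi) :=
  orthonormal_basis e /\ forall i x, pi (S i) (e x) = e (scons i x).

Definition tail_subspace (R : realType) (N : nat) (H : hilbertType R)
    (e : Omega N -> H) (x : Omega N) : set H :=
  closed_span [set e y | y in tail_equiv x].

(* The letter i : 'I_N stands for i + 1, so that i = 0 gives h_1, and i > 0
   gives h_(i+1) (t) = 1 / (t + N - (i + 1) + 1). *)
Definition slow_map (R : realType) (N : nat) (i : 'I_N) (t : R) : R :=
  if i == 0%N :> nat then t / (N.-1%:R * t + 1) else 1 / (t + (N - i)%N%:R).

(* The default value 0 is irrelevant, as the intersection is a singleton. *)
Definition Dec (R : realType) (N : nat) (x : Omega N) : R :=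
  xget 0 (\bigcap_n
    ((fun t => foldr (@slow_map R N) t (mkseq x n.+1)) @` `[0, 1]%classic)).

Definition PGL2Z_equiv (R : realType) (x y : R) :=
  exists a b c d : int,
    [/\ a * d - b * c = 1 \/ a * d - b * c = -1,
        c%:~R * x + d%:~R != 0
      & y = (a%:~R * x + b%:~R) / (c%:~R * x + d%:~R)].

Definition PGL2Z_class (R : realType) (x : R) : set R :=
  [set y | PGL2Z_equiv x y].

Definition is_PGL2Z_class (R : realType) (D : set R) :=
  exists x : R, D = PGL2Z_class x.

Definition quadratic_or_rational (R : realType) (x : R) :=
  (exists q : rat, x = ratr q) \/
  exists a b c : int,
    a != 0 /\ a%:~R * x ^+ 2 + b%:~R * x + c%:~R = 0.

(* The library's set_bij, for predicates on types in arbitrary universes. *)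
Definition bijection_between (T U : Type) (A : T -> Prop) (B : U -> Prop)
    (F : T -> U) :=
  [/\ (forall x, A x -> B (F x)),
      (forall x y, A x -> A y -> F x = F y -> x = y)
    & (forall y, B y -> exists2 x, A x & F x = y)].

(* Main.v *)
(* The operators S_w S_w^* of longer and longer prefixes w of a sequence k converge
   strongly to the projection on e_k, so a nonzero invariant closed subspace of a
   permutative representation whose basis is separated by codings contains basis
   vectors.  Hence tail classes give irreducible representations, their atoms are the
   classes of the relation "equal from some index on", and the class of x splits
   into finitely many atoms iff x is eventually periodic.  Two basis vectors of
   one orbit with the same coding yield a sequence translated by a unitary that
   commutes with O_N; if it is finite, a constant vector on it, and if it is infinite,
   the Fourier transform of the indicator of half of the circle, generates a proper
   invariant subspace.

   On the arithmetic side, tail equivalence yields PGL_2(Z)-equivalence because each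
   h_i lies in PGL_2(Z).  The converse is Serret's theorem, checked on the
   generators t + 1, - t and 1 / t; rational numbers are all coded by
   sequences that end in the letter of h_1.  Eventual periodicity of the
   sequences of quadratic numbers is Lagrange's theorem. *)

Require Import Defs.
From HB Require Import structures.
From mathcomp Require Import all_boot all_order all_algebra.
From mathcomp Require Import complex ring lra zify.
From mathcomp Require Import all_classical all_reals all_analysis.
Import Order.TTheory GRing.Theory Num.Theory.
Import numFieldNormedType.Exports.
Local Open Scope classical_set_scope.
Local Open Scope ring_scope.
Set Implicit Arguments.
Unset Strict Implicit.
Unset Printing Implicit Defensive.

(** * Inner products and closed subspaces *)

(** The classification of irreducible permutative representations is itself derived, and its hard
    point is that the basis of an abstract permutative representation need not be separated by
    codings: irreducibility has to exclude this. Translation along an infinite orbit is a bilateral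
    shift and has no eigenvector, so a spectral projection must take the place of an eigenvector.
    Half of the circle is chosen because the coefficients of the square wave are the reciprocals of
    the odd numbers: partial fractions and telescoping sums then give every orthogonality relation,
    without integration and without a spectral theorem. The commutant is never formed; it suffices
    to find nonzero v and v' such that v' is orthogonal to S_s S_t^* v for all words s and t.

    On the arithmetic side the digits are not those of the regular continued fraction: h_1 removes
    only N - 1 from the integer part of 1 / t. Neighbouring intervals share endpoints, so a rational
    number can have several codings. Irrational numbers are therefore treated apart, and modulo the
    integers, so that the generators of PGL_2(Z) act on all of R. *)

Section InnerProduct.
Variables (R : realType) (H : hilbertType R).
Implicit Types (u v w : H) (c : R[i]).

Lemma innerDl u v w : inner (u + v) w = inner u w + inner v w.
Proof. by rewrite -[u]scale1r inner_linear mul1r scale1r. Qed.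
Lemma inner0l w : inner 0 w = 0 :> R[i].
Proof. by apply: (addrI (inner 0 w)); rewrite -innerDl !addr0. Qed.
Lemma innerZl c u w : inner (c *: u) w = c * inner u w.
Proof. by rewrite -[c *: u]addr0 inner_linear inner0l addr0. Qed.
Lemma innerNl u w : inner (- u) w = - inner u w.
Proof. by rewrite -scaleN1r innerZl mulN1r. Qed.
Lemma innerBl u v w : inner (u - v) w = inner u w - inner v w.
Proof. by rewrite innerDl innerNl. Qed.
Lemma innerC u v : inner u v = (inner v u)^*%C.
Proof. by rewrite inner_conj. Qed.
Lemma innerDr u v w : inner w (u + v) = inner w u + inner w v.
Proof. by rewrite innerC innerDl rmorphD /= -!innerC. Qed.
Lemma inner0r w : inner w 0 = 0 :> R[i].
Proof. by rewrite innerC inner0l rmorph0. Qed.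
Lemma innerZr c u w : inner w (c *: u) = c^*%C * inner w u.
Proof. by rewrite innerC innerZl rmorphM /= -innerC. Qed.
Lemma innerNr u w : inner w (- u) = - inner w u.
Proof. by rewrite innerC innerNl rmorphN /= -innerC. Qed.
Lemma innerBr u v w : inner w (u - v) = inner w u - inner w v.
Proof. by rewrite innerDr innerNr. Qed.

Lemma inner_suml (I : Type) (r : seq I) (F : I -> H) w :
  inner (\sum_(i <- r) F i) w = \sum_(i <- r) inner (F i) w.
Proof.
elim: r => [|i r IH]; first by rewrite !big_nil inner0l.
by rewrite !big_cons innerDl IH.
Qed.
Lemma inner_sumr (I : Type) (r : seq I) (F : I -> H) w :
  inner w (\sum_(i <- r) F i) = \sum_(i <- r) inner w (F i).
Proof.
elim: r => [|i r IH]; first by rewrite !big_nil inner0r.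
by rewrite !big_cons innerDr IH.
Qed.

Lemma inner_eq0 u : (inner u u == 0) = (u == 0).
Proof. by rewrite inner_norm expf_eq0 /= normr_eq0. Qed.

Lemma eq_norm_inner (H' : hilbertType R) u (u' : H') :
  inner u u = inner u' u' -> `|u| = `|u'|.
Proof. by rewrite !inner_norm => /eqP; rewrite eqrXn2// => /eqP. Qed.

Lemma Cauchy_Schwarz u v : `|inner u v| <= `|u| * `|v|.
Proof.
have [->|v0] := eqVneq v 0; first by rewrite inner0r !normr0 mulr0.
have nv : 0 < `|v| by rewrite normr_gt0.
have nv2 : `|v| ^+ 2 != 0 by rewrite expf_neq0 // gt_eqF.
rewrite -(@ler_pXn2r _ 2) ?nnegrE ?mulr_ge0//.
(* This vector is [|v|^2] times the component of [u] orthogonal to [v]; the scaling avoids a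
   division. *)
have : 0 <= `|(`|v| ^+ 2) *: u - inner u v *: v| ^+ 2 by rewrite exprn_ge0.
rewrite -inner_norm innerBl !innerBr !innerZl !innerZr !inner_norm.
have -> : ((`|v| ^+ 2)^*)%C = `|v| ^+ 2 :> R[i].
  by rewrite -inner_norm -innerC.
rewrite (innerC v u) => h.
have {h} : `|v| ^+ 2 * `|inner u v| ^+ 2 <= `|v| ^+ 2 * (`|u| * `|v|) ^+ 2.
  rewrite sqr_normc -subr_ge0; apply: le_trans h _.
  by rewrite le_eqVlt; apply/orP; left; apply/eqP; ring.
by rewrite ler_pM2l // exprn_gt0.
Qed.

End InnerProduct.

(** * Closedness and completeness by estimates *)

Section Metric.

(** Equalities of vectors and of scalars are proved below by estimates for every positive [e] rather
    than by passing to limits. *)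
Lemma norm_small (K : numFieldType) (V : normedZmodType K) (x : V) (C : K) :
  0 <= C -> (forall e, 0 < e -> `|x| <= e * C) -> x = 0.
Proof.
move=> C0 h; apply/normr0_eq0/eqP; rewrite eq_le normr_ge0 andbT.
have [//|x0] := boolP (`|x| <= 0).
have {x0} x0 : 0 < `|x| by rewrite lt_def normr_ge0 andbT; apply: contra x0 => /eqP->.
have C1 : 0 < C + 1 by rewrite ltr_wpDl.
(* The divisor is [C + 1] because [C] may vanish. *)
have := h (`|x| / 2 / (C + 1)) _.
rewrite !divr_gt0 // => /(_ isT) hle.
suff /(le_lt_trans hle) : `|x| / 2 / (C + 1) * C < `|x| by rewrite ltxx.
rewrite mulrAC ltr_pdivrMr // -subr_gt0.
have -> : `|x| * (C + 1) - `|x| / 2 * C = `|x| / 2 * C + `|x| by field.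
by rewrite ltr_wpDl // mulr_ge0 // divr_ge0 // ltW.
Qed.

(** Positivity in [R[i]] forces a zero imaginary part, so the Archimedean property of [R] applies to
    the real part. *)
Lemma invn_lt (R : realType) (eps : R[i]) : 0 < eps ->
  exists n0, forall n, (n0 <= n)%N -> n.+1%:R^-1 < eps.
Proof.
case: eps => x y; rewrite ltcE /= => /andP[/eqP -> x0].
exists (Num.truncn x^-1) => n hn.
have -> : (n.+1%:R^-1 : R[i]) = (n.+1%:R^-1 : R)%:C%C by rewrite fmorphV rmorph_nat.
rewrite ltcR invf_plt ?posrE //; apply: lt_le_trans (truncnS_gt _) _.
by rewrite ler_nat.
Qed.

Lemma closedP (K : numFieldType) (V : normedModType K) (A : set V) :
  closed A <-> forall u, (forall e, 0 < e -> exists2 v, A v & `|u - v| < e) -> A u.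
Proof.
split=> [cA u h|h u cu].
  apply: cA => B /nbhs_ballP [e /= e0 eB]; have [v Av uv] := h e e0.
  by exists v; split => //; apply: eB; rewrite -ball_normE.
apply: h => e e0; have [v [Av]] := cu _ (nbhsx_ballx u e e0).
by rewrite -ball_normE => uv; exists v.
Qed.

Lemma cauchy_seq_cvg (K : numFieldType) (V : completeNormedModType K) (u : nat -> V) :
  (forall e, 0 < e -> exists n0, forall n, (n0 <= n)%N -> `|u n - u n0| < e) ->
  exists l, forall e, 0 < e -> exists n0, forall n, (n0 <= n)%N -> `|u n - l| < e.
Proof.
move=> h.
have /cvg_ex [l /cvgrPdist_lt ul] : cvg (u @ \oo).
  apply: cauchy_cvg; apply/cauchyP => e e0; have [n0 hn] := h e e0.
  exists (u n0); exists n0 => // n /hn; rewrite distrC => un.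
  by rewrite /= -ball_normE.
exists l => e /ul [n0 _ hn]; exists n0 => n /hn.
by rewrite distrC.
Qed.

End Metric.

(** * Closed spans and isometries *)

Section ClosedSpan.
Variable (R : realType).
Implicit Types H : hilbertType R.

Lemma closed_span_subspace H (E : set H) : closed_subspace (closed_span E).
Proof.
split.
- by move=> V [[]].
- by move=> c u v hu hv V hV; have [[_ hl _] _] := hV; apply: hl; [exact: hu|exact: hv].
- apply/closedP => u h V hV; have [[_ _ /closedP cV] _] := hV.
  by apply: cV => e /h [v hv uv]; exists v => //; exact: hv.
Qed.

Lemma closed_span_sub H (E V : set H) :
  closed_subspace V -> E `<=` V -> closed_span E `<=` V.
Proof. by move=> hV EV u; apply. Qed.

Lemma mem_closed_span H (E : set H) : E `<=` closed_span E.
Proof. by move=> u Eu V [_]; exact. Qed.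

Lemma closed_subspaceD H (V : set H) u v : closed_subspace V -> V u -> V v -> V (u + v).
Proof. by move=> [_ hl _] hu hv; rewrite -[u]scale1r; exact: hl. Qed.

Lemma closed_subspaceZ H (V : set H) c u : closed_subspace V -> V u -> V (c *: u).
Proof. by move=> [h0 hl _] hu; rewrite -[_ *: _]addr0; exact: hl. Qed.

Lemma closed_subspace_sum H (V : set H) (I : Type) (r : seq I) (F : I -> H) :
  closed_subspace V -> (forall i, V (F i)) -> V (\sum_(i <- r) F i).
Proof.
move=> hV hF; elim: r => [|i r IH]; first by rewrite big_nil; case: hV.
by rewrite big_cons; exact: closed_subspaceD.
Qed.

Lemma closed_subspace_setT H : closed_subspace [set: H].
Proof. by split=> //; exact: closedT. Qed.

Lemma closed_subspaceI (I : Type) H (V : I -> set H) :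
  (forall i, closed_subspace (V i)) -> closed_subspace [set u | forall i, V i u].
Proof.
move=> hV; split.
- by move=> i; case: (hV i).
- by move=> c u v hu hv i; have [_ hl _] := hV i; apply: hl.
- apply/closedP => u h i; have [_ _ /closedP cV] := hV i.
  by apply: cV => e /h [v hv uv]; exists v => //; exact: hv.
Qed.

Lemma closed_subspace_preimage H H' (T : {linear H -> H'}) (C : R[i]) (V : set H') :
  0 < C -> (forall v, `|T v| <= C * `|v|) -> closed_subspace V ->
  closed_subspace [set u | V (T u)].
Proof.
move=> C0 hT [V0 Vl /closedP cV]; split.
- by rewrite /= linear0.
- by move=> c u v /= hu hv; rewrite linearP; exact: Vl.
- apply/closedP => u h; apply: cV => e e0.
  have [v hv uv] := h (e / C) (divr_gt0 e0 C0); exists (T v) => //.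
  rewrite -linearB; apply: le_lt_trans (hT _) _.
  by rewrite mulrC -ltr_pdivlMr.
Qed.

Lemma closed_subspace_orth H (w : H) : closed_subspace [set u | inner u w = 0].
Proof.
split=> [|c u v /= hu hv|].
- exact: inner0l.
- by rewrite inner_linear hu hv mulr0 addr0.
- apply/closedP => u h; apply: (@norm_small _ _ _ `|w|) => // e e0.
  have [v /= hv uv] := h e e0.
  rewrite -[inner u w]subr0 -hv -innerBl; apply: le_trans (Cauchy_Schwarz _ _) _.
  by rewrite ler_wpM2r // ltW.
Qed.

Lemma closed_span_orth H (E : set H) w :
  (forall u, E u -> inner u w = 0) -> forall u, closed_span E u -> inner u w = 0.
Proof. by move=> h; apply: closed_span_sub => //; exact: closed_subspace_orth. Qed.

Definition lincomb (K : Type) H (e : K -> H) (s : seq (R[i] * K)) : H :=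
  \sum_(p <- s) p.1 *: e p.2.

(** One list [r] serves all families [e] at once; [isometry_ext] uses this to keep the same
    coefficients in the source and in the target. *)
Lemma lincomb_linear (K : Type) (c : R[i]) (s t : seq (R[i] * K)) :
  exists r, forall H (e : K -> H), lincomb e r = c *: lincomb e s + lincomb e t.
Proof.
exists ([seq (c * p.1, p.2) | p <- s] ++ t) => H e.
rewrite /lincomb big_cat big_map scaler_sumr; congr (_ + _).
by apply: eq_bigr => p _; rewrite scalerA.
Qed.

Lemma closed_span_approx (K : Type) H (e : K -> H) v : closed_span (range e) v ->
  forall eps, 0 < eps -> exists s, `|v - lincomb e s| < eps.
Proof.
set P := [set v | forall eps, 0 < eps -> exists s, `|v - lincomb e s| < eps].
suff hP : closed_subspace P.
  move=> hv; apply: (closed_span_sub hP) hv => _ [k _ <-] eps e0.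
  by exists [:: (1, k)]; rewrite /lincomb big_seq1 scale1r subrr normr0.
split.
- by move=> eps e0; exists [::]; rewrite /lincomb big_nil subrr normr0.
- move=> c u {}v hu hv eps e0.
  have c1 : 0 < `|c| + 1 by rewrite ltr_wpDl.
  have [s hs] := hu (eps / 2 / (`|c| + 1)) (divr_gt0 (divr_gt0 e0 (ltr0n _ 2)) c1).
  have [t ht] := hv (eps / 2) (divr_gt0 e0 (ltr0n _ 2)).
  have [r hr] := lincomb_linear c s t; exists r; rewrite hr.
  rewrite opprD addrACA -scalerBr; apply: le_lt_trans (ler_normD _ _) _.
  rewrite [eps]splitr; apply: ler_ltD ht; rewrite normrZ.
  apply: le_trans (_ : (`|c| + 1) * `|u - lincomb e s| <= _).
    by rewrite ler_wpM2r // lerDl.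
  by rewrite mulrC -ler_pdivlMr // ltW.
- apply/closedP => u h eps e0.
  have e20 : 0 < eps / 2 by rewrite divr_gt0.
  have [{}v /(_ _ e20) [s hs] uv] := h _ e20; exists s.
  rewrite -(subrKA v) [eps]splitr; apply: le_lt_trans (ler_normD _ _) _.
  exact: ltrD.
Qed.

Lemma norm_lincomb (K : Type) H H' (e : K -> H) (g : K -> H') s :
  (forall k l, inner (e k) (e l) = inner (g k) (g l)) ->
  `|lincomb e s| = `|lincomb g s|.
Proof.
move=> eg; apply: eq_norm_inner; rewrite /lincomb !inner_suml.
apply: eq_bigr => p _; rewrite !inner_sumr; apply: eq_bigr => q _.
by rewrite !innerZl !innerZr eg.
Qed.

(** The vector [u + v] gives the real part of the inner product, [u + 'i *: v] the imaginary
    part. *)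
Lemma polarization H H' (U : {linear H -> H'}) :
  (forall u, `|U u| = `|u|) -> forall u v, inner (U u) (U v) = inner u v.
Proof.
move=> nU u v.
have hU w : inner (U w) (U w) = inner w w by rewrite !inner_norm nU.
have h1 := hU (u + v); have h2 := hU (u + 'i%C *: v).
move: h1 h2; rewrite !linearD !linearZ.
rewrite !innerDl !innerDr !innerZl !innerZr !hU.
rewrite (innerC v u) (innerC (U v) (U u)).
have -> : ('i^*)%C = - 'i%C :> R[i] by apply/eqP; rewrite eq_complex /= oppr0 !eqxx.
set a := inner (U u) (U v); set b := inner u v => h1 h2.
have i0 : ('i%C : R[i]) != 0 by rewrite eq_complex /= oner_eq0 andbF.
move: h1 h2 => /eqP; rewrite -subr_eq0 => /eqP h1 /eqP; rewrite -subr_eq0 => /eqP h2.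
apply/eqP; rewrite -subr_eq0 -(mulrI_eq0 _ (mulfI (_ : 2 * 'i%C != 0 :> R[i])))
  ?mulf_neq0 //.
(* ['i] times the first identity minus the second reads [2 * 'i * (a - b) = 0]. *)
apply/eqP; rewrite -[RHS](subrr ('i%C * (0 : R[i]))) -{1}h1 mulr0 -h2.
ring.
Qed.

(** Completeness of [H] is what counts: preimages of vectors that approximate a limit form a Cauchy
    sequence, because [U] preserves norms. *)
Lemma closed_subspace_image H H' (U : {linear H -> H'}) (W : set H) :
  (forall v, `|U v| = `|v|) -> closed_subspace W -> closed_subspace (U @` W).
Proof.
move=> Un [W0 Wl /closedP cW].
have inv0 n : 0 < (n.+1%:R^-1 : R[i]) by rewrite invr_gt0.
split; first by exists 0 => //; rewrite linear0.
  by move=> c _ _ [u Wu <-] [v Wv <-]; exists (c *: u + v); [exact: Wl|rewrite linearP].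
apply/closedP => w hw.
have /choice [v hv] n : exists v, W v /\ `|w - U v| < n.+1%:R^-1.
  by have [_ [v Wv <-] hv] := hw _ (inv0 n); exists v.
have [l hl] : exists l, forall eps, 0 < eps -> exists n0, forall n, (n0 <= n)%N ->
    `|v n - l| < eps.
  apply: cauchy_seq_cvg => eps e0.
  have e20 : 0 < eps / 2 by rewrite divr_gt0.
  have [n0 hn0] := invn_lt e20; exists n0 => n hn; rewrite -Un linearB.
  rewrite -(subrKA w) [eps]splitr; apply: le_lt_trans (ler_normD _ _) _.
  apply: ltrD; first by rewrite distrC (lt_trans (hv n).2) ?hn0.
  by rewrite (lt_trans (hv n0).2) ?hn0.
exists l.
  apply: cW => eps e0; have [n1 /(_ _ (leqnn _)) hn1] := hl _ e0.
  by exists (v n1); [exact: (hv n1).1|rewrite distrC].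
apply/eqP; rewrite -subr_eq0; apply/eqP.
apply: (@norm_small _ _ _ 2) => // eps e0.
have [n0 hn0] := invn_lt e0; have [n1 hn1] := hl _ e0.
rewrite -(subrKA (U (v (maxn n0 n1)))) mulr_natr mulr2n.
apply: le_trans (ler_normD _ _) _; apply: lerD.
  by rewrite -linearB Un distrC ltW // hn1 // leq_maxr.
by rewrite distrC ltW // (lt_trans (hv _).2) // hn0 // leq_maxl.
Qed.

Lemma closed_subspace_eq H H' (T1 T2 : {linear H -> H'}) (C1 C2 : R[i]) :
  0 < C1 -> 0 < C2 ->
  (forall v, `|T1 v| <= C1 * `|v|) -> (forall v, `|T2 v| <= C2 * `|v|) ->
  closed_subspace [set v | T1 v = T2 v].
Proof.
move=> C10 C20 h1 h2; split.
- by rewrite /mkset !linear0.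
- by move=> c u v; rewrite /mkset !linearP => -> ->.
- apply/closedP => u h; apply/eqP; rewrite -subr_eq0; apply/eqP.
  apply: (@norm_small _ _ _ (C1 + C2)); first by rewrite addr_ge0 // ltW.
  move=> eps e0; have [v hv /ltW uv] := h _ e0.
  rewrite -(subrKA (T1 v)) {2}hv -!linearB.
  apply: le_trans (ler_normD _ _) _; rewrite mulrDr; apply: lerD.
    by apply: le_trans (h1 _) _; rewrite mulrC ler_wpM2r // ltW.
  by apply: le_trans (h2 _) _; rewrite mulrC distrC ler_wpM2r // ltW.
Qed.

Lemma isometry_ext (K : Type) H H' (e : K -> H) (g : K -> H') :
  (forall k l, inner (e k) (e l) = inner (g k) (g l)) ->
  closed_span (range e) = setT ->
  exists U : {linear H -> H'}, [/\ forall k, U (e k) = g k,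
    forall u v, inner (U u) (U v) = inner u v & range U = closed_span (range g)].
Proof.
move=> eg eT.
(* [G] is the graph of the isometry: the same finite combinations approximate [v] through [e] and
   [w] through [g]. It is single-valued because it preserves norms, and everywhere defined because
   the target is complete. *)
pose G v w := forall eps, 0 < eps -> exists s, `|v - lincomb e s| < eps /\
  `|w - lincomb g s| < eps.
have Gnorm v w : G v w -> `|v| = `|w|.
  move=> h; apply/eqP; rewrite -subr_eq0; apply/eqP/(@norm_small _ _ _ 2) => // eps e0.
  have [s [hv hw]] := h eps e0.
  rewrite -[`|v|](subrK `|lincomb e s|) {2}(norm_lincomb s eg) -addrA.
  apply: le_trans (ler_normD _ _) _; rewrite mulr_natr mulr2n; apply: lerD.
    by apply: le_trans (ler_dist_dist _ _) _; exact: ltW.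
  by rewrite distrC; apply: le_trans (ler_dist_dist _ _) _; exact: ltW.
have Glin c v v' w w' : G v w -> G v' w' -> G (c *: v + v') (c *: w + w').
  move=> h h' eps e0.
  have c1 : 0 < `|c| + 1 by rewrite ltr_wpDl.
  have [s [hv hw]] := h (eps / 2 / (`|c| + 1)) (divr_gt0 (divr_gt0 e0 (ltr0n _ 2)) c1).
  have [t [hv' hw']] := h' (eps / 2) (divr_gt0 e0 (ltr0n _ 2)).
  have [r hr] := lincomb_linear c s t; exists r; rewrite !hr.
  have aux (X : hilbertType R) (x y x' y' : X) : `|x - y| < eps / 2 / (`|c| + 1) ->
      `|x' - y'| < eps / 2 -> `|c *: x + x' - (c *: y + y')| < eps.
    move=> hx hx'; rewrite opprD addrACA -scalerBr; apply: le_lt_trans (ler_normD _ _) _.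
    rewrite [eps]splitr; apply: ler_ltD hx'; rewrite normrZ.
    apply: le_trans (_ : (`|c| + 1) * `|x - y| <= _).
      by rewrite ler_wpM2r // lerDl.
    by rewrite mulrC -ler_pdivlMr // ltW.
  by split; exact: aux.
have Gfun v w w' : G v w -> G v w' -> w = w'.
  move=> h h'; have := Glin (-1) _ _ _ _ h h'.
  rewrite !scaleN1r addNr => /Gnorm /esym; rewrite normr0 => /normr0_eq0 /eqP.
  by rewrite addrC subr_eq0 => /eqP.
have Ge k : G (e k) (g k).
  by move=> eps e0; exists [:: (1, k)];
    rewrite /lincomb !big_seq1 !scale1r !subrr !normr0.
have inv0 n : 0 < (n.+1%:R^-1 : R[i]) by rewrite invr_gt0.
have ex v : exists w, G v w.
  have ev : closed_span (range e) v by rewrite eT.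
  have /choice [s hs] n := closed_span_approx ev (inv0 n).
  have sg n m : `|lincomb g (s n) - lincomb g (s m)| =
                `|lincomb e (s n) - lincomb e (s m)|.
    have [r hr] := lincomb_linear (-1) (s m) (s n).
    have := norm_lincomb r eg; rewrite !hr !scaleN1r.
    by rewrite [_ + lincomb e _]addrC [_ + lincomb g _]addrC.
  have [w hw] : exists w, forall eps, 0 < eps -> exists n0, forall n, (n0 <= n)%N ->
      `|lincomb g (s n) - w| < eps.
    apply: cauchy_seq_cvg => eps e0.
    have e20 : 0 < eps / 2 by rewrite divr_gt0.
    have [n0 hn0] := invn_lt e20; exists n0 => n hn; rewrite sg.
    rewrite -(subrKA v) [eps]splitr; apply: le_lt_trans (ler_normD _ _) _.
    apply: ltrD; first by rewrite distrC (lt_trans (hs n)) ?hn0.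
    by rewrite (lt_trans (hs n0)) ?hn0.
  exists w => eps e0; have [n0 hn0] := invn_lt e0; have [n1 hn1] := hw _ e0.
  exists (s (maxn n0 n1)); split.
    by apply: lt_trans (hs _) _; rewrite hn0 // leq_maxl.
  by rewrite distrC hn1 // leq_maxr.
have [U hU] := choice ex.
have Ulin : linear U by move=> c u v; apply: Gfun (hU _) _; exact: Glin.
pose UL := HB.pack_for {linear H -> H'} U (GRing.isLinear.Build _ _ _ _ U Ulin).
have UE v : UL v = U v by [].
have Un v : `|UL v| = `|v| by rewrite UE -(Gnorm _ _ (hU v)).
have Ue k : UL (e k) = g k by apply: Gfun (hU _) (Ge k).
exists UL; split; [exact: Ue | exact: polarization|].
have cR : closed_subspace (range UL) by apply: closed_subspace_image => //;
  exact: closed_subspace_setT.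
apply/seteqP; split; last first.
  by apply: closed_span_sub => // _ [k _ <-]; exists (e k).
move=> _ [v _ <-].
have : closed_span (range e) v by rewrite eT.
apply: (@closed_span_sub _ _ [set u | closed_span (range g) (UL u)]) => [|_ [k _ <-]].
  apply: (@closed_subspace_preimage _ _ UL 1) => // [u|]; first by rewrite mul1r Un.
  exact: closed_span_subspace.
by rewrite /mkset Ue; apply: mem_closed_span; exists k.
Qed.

End ClosedSpan.

(** * Restricted representations *)

Section SubHilbert.
Variables (R : realType) (H : hilbertType R).

(** Set and proof are bundled so that the Hilbert structure of the subtype is inferred from [V]
    alone. *)
Record closed_sub := ClosedSubspace { sub_set : set H;
  closed_sub_subspace : closed_subspace sub_set }.

Definition sub_pred (V : closed_sub) : pred H := fun v => `[< sub_set V v >].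

Lemma sub_pred_closed (V : closed_sub) : subsemimod_closed (sub_pred V).
Proof.
have [V0 Vl _] := closed_sub_subspace V.
have E u : (u \in sub_pred V) = `[< sub_set V u >] by [].
split; first split.
- by rewrite E; apply/asboolP.
- move=> u v; rewrite !E => /asboolP uV /asboolP vV; apply/asboolP.
  by have := Vl 1 u v uV vV; rewrite scale1r.
- move=> c u; rewrite !E => /asboolP uV; apply/asboolP.
  by have := Vl c u 0 uV V0; rewrite addr0.
Qed.

Record sub_hilbert (V : closed_sub) := SubHilbertElt { sub_val : H;
  _ : sub_pred V sub_val }.

End SubHilbert.

Section SubHilbertInst.
Variables (R : realType) (H : hilbertType R) (V : closed_sub H).
HB.instance Definition _ := [isSub for @sub_val R H V].
HB.instance Definition _ := [Choice of sub_hilbert V by <:].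
HB.instance Definition _ :=
  GRing.SubChoice_isSubLmodule.Build _ _ _ (sub_hilbert V) (sub_pred_closed V).

Let nrm (u : sub_hilbert V) : R[i] := `|val u|.
Let nrmD u v : nrm (u + v) <= nrm u + nrm v.
Proof. exact: ler_normD. Qed.
Let nrmZ c u : nrm (c *: u) = `|c| * nrm u.
Proof. exact: normrZ. Qed.
Let nrm0 u : nrm u = 0 -> u = 0.
Proof. by move=> /normr0_eq0 u0; exact: val_inj. Qed.

HB.instance Definition _ := Lmodule_isNormed.Build _ (sub_hilbert V) nrmD nrmZ nrm0.

Let sub_complete (F : set_system (sub_hilbert V)) : ProperFilter F -> cauchy F -> cvg F.
Proof.
move=> FF /cauchyP Fc.
have ballE (u v : sub_hilbert V) r : ball u r v = (`|val u - val v| < r).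
  by rewrite /= -ball_normE.
have Gc : cvg (val @ F).
  apply: cauchy_cvg.
  apply/cauchyP => r r0; have [u Fu] := Fc _ r0; exists (val u).
  apply: (@filterS _ F _ (ball u r)) Fu => v; rewrite ballE => uv.
  by rewrite /= -ball_normE.
set l := lim (val @ F) in Gc.
have Vl : sub_set V l.
  have [_ _ clV] := closed_sub_subspace V.
  apply: (@closed_cvg _ _ F _ val (sub_set V) clV _ l Gc).
  by apply: nearW => u /=; apply/asboolP; exact: (valP u).
have Pl : sub_pred V l by apply/asboolP.
apply/cvg_ex; exists (Sub l Pl : sub_hilbert V).
apply/cvg_ballP => r r0.
have /cvgrPdist_lt/(_ _ r0) := Gc.
by apply: filterS => u; rewrite /= ballE.
Qed.
HB.instance Definition _ := Uniform_isComplete.Build (sub_hilbert V) sub_complete.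

Let innerl c (u v w : sub_hilbert V) : inner (val (c *: u + v)) (val w) = c * inner (val
  u) (val w) + inner (val v) (val w).
Proof. exact: inner_linear. Qed.
HB.instance Definition _ :=
  CompleteNormedModule_isHilbert.Build R (sub_hilbert V) innerl (fun u v =>
  inner_conj (val u) (val v)) (fun u => inner_norm (val u)).


End SubHilbertInst.

Section Restriction.
Variables (R : realType) (A : cstarType R) (pi : representation A).
Variables (V : closed_sub (rep_space pi)).
Hypothesis piV : forall a v, sub_set V v -> sub_set V (pi a v).

Definition restr_fun (a : A) (u : sub_hilbert V) : sub_hilbert V :=
  Sub (pi a (val u)) (asboolT (piV a (asboolW (valP u)))).

Lemma restr_linear a : linear (restr_fun a).
Proof. by move=> c u v; apply: val_inj; rewrite /= linearP. Qed.

Definition restr_map a : {linear sub_hilbert V -> sub_hilbert V} :=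
  HB.pack_for {linear sub_hilbert V -> sub_hilbert V} (restr_fun a)
    (GRing.isLinear.Build _ _ _ _ (restr_fun a) (restr_linear a)).

(** Kept transparent, since its space has to compute to [sub_hilbert V]. *)
Definition restr_rep : representation A.
Proof.
apply: (@Representation R A (sub_hilbert V) restr_map).
- by move=> c a b v; apply: val_inj; rewrite /= rep_linear.
- by move=> a b v; apply: val_inj; rewrite /= rep_mul.
- by move=> v; apply: val_inj; rewrite /= rep_one.
- by move=> a u v; exact: rep_star.
- by move=> a v; exact: rep_le.
Defined.

Lemma restr_rep_equiv : @equiv_restriction R A restr_rep pi (sub_set V).
Proof.
pose f (u : sub_hilbert V) : rep_space pi := val u.
have fl : linear f by [].
exists (HB.pack_for {linear sub_hilbert V -> rep_space pi} f
    (GRing.isLinear.Build _ _ _ _ f fl)); split => //.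
apply/seteqP; split; first by move=> _ [u _ <-]; exact: (asboolW (valP u)).
by move=> v Vv; exists (Sub v (asboolT Vv) : sub_hilbert V).
Qed.

End Restriction.

(** * Unitary equivalence *)

Section Equivalence.
Variables (R : realType) (A : cstarType R).
Implicit Types (rho pi : representation A).

Lemma isometry_inj (H H' : hilbertType R) (U : {linear H -> H'}) :
  (forall u v, inner (U u) (U v) = inner u v) -> injective U.
Proof.
move=> hU u v uv; apply/eqP; rewrite -subr_eq0 -inner_eq0 -hU linearB uv.
by rewrite subrr inner0l.
Qed.

Lemma isometry_factor (H1 H2 H : hilbertType R) (U1 : {linear H1 -> H})
    (U2 : {linear H2 -> H}) :
  (forall u v, inner (U1 u) (U1 v) = inner u v) ->
  (forall u v, inner (U2 u) (U2 v) = inner u v) ->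
  range U1 = range U2 ->
  exists T : {linear H1 -> H2}, [/\ forall u, U2 (T u) = U1 u,
    forall u v, inner (T u) (T v) = inner u v & range T = setT].
Proof.
move=> h1 h2 r12.
have /choice [T hT] u : exists w, U2 w = U1 u.
  have : range U2 (U1 u) by rewrite -r12; exists u.
  by move=> [w _ <-]; exists w.
have Tl : linear T.
  by move=> c u v; apply: (isometry_inj h2); rewrite linearP !hT linearP.
exists (HB.pack_for {linear H1 -> H2} T (GRing.isLinear.Build _ _ _ _ T Tl)).
split=> [u|u v|]; first exact: hT.
  by rewrite -h2 !hT h1.
apply/seteqP; split=> // w _; have : range U1 (U2 w) by rewrite r12; exists w.
by move=> [u _ uw]; exists u => //; apply: (isometry_inj h2); rewrite hT.
Qed.

(** Composition with [U], or with its inverse on [V], turns one equivalence into the other. Classes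
    are predicates, so their equality is extensional. *)
Lemma equiv_restriction_class rho pi (V : set (rep_space pi)) :
  equiv_restriction rho V -> restriction_class V = unitary_class rho.
Proof.
move=> [U [hU rU iU]].
have E (rho' : representation A) : restriction_class V rho' = unitary_class rho rho'.
  apply: propext; split.
    move=> [U' [hU' rU' iU']].
    have [T [hT Ti Tr]] := isometry_factor hU' hU (etrans rU' (esym rU)).
    exists T; split => // a v; apply: (isometry_inj hU).
    by rewrite hT iU' iU hT.
  move=> [T [hT Tr iT]].
  pose f u := U (T u).
  have fl : linear f by move=> c u v; rewrite /f !linearP.
  exists (HB.pack_for {linear rep_space rho' -> rep_space pi} f
    (GRing.isLinear.Build _ _ _ _ f fl)); split => [u v||a v] /=.
  - by rewrite /f hU hT.
  - rewrite -rU; apply/seteqP; split; first by move=> _ [u _ <-]; exists (T u).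
    move=> _ [u _ <-]; have : range T u by rewrite Tr.
    by move=> [w _ <-]; exists w.
  - by rewrite /f iT iU.
exact: funext E.
Qed.

Lemma unitary_class_refl pi : unitary_class pi pi.
Proof.
exists (idfun : {linear rep_space pi -> rep_space pi}).
split => //; by apply/seteqP; split => // v _; exists v.
Qed.

Lemma unitary_class_eq rho pi (V : set (rep_space pi)) :
  restriction_class V = unitary_class rho -> equiv_restriction rho V.
Proof. by move=> E; rewrite -[equiv_restriction _ _]/(restriction_class V rho) E;
  exact: unitary_class_refl. Qed.

End Equivalence.

(** * From generators to the generated C*-subalgebra *)

Section Generated.
Variables (R : realType) (A : cstarType R).
Implicit Types (pi rho : representation A) (a b : A).

Lemma star0 : star (0 : A) = 0.
Proof.
have := star_semilinear (1 : R[i]) (0 : A) 0.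
rewrite scaler0 addr0 rmorph1 scale1r => /esym/eqP.
by rewrite -subr_eq0 addrK => /eqP.
Qed.

Lemma starB a b : star (a - b) = star a - star b.
Proof.
rewrite addrC -scaleN1r star_semilinear rmorphN rmorph1.
by rewrite scaleN1r addrC.
Qed.

Lemma star_norm a : `|star a| = `|a|.
Proof.
have le (b : A) : `|b| <= `|star b|.
  have [->|b0] := eqVneq b 0; first by rewrite normr0.
  have nb : 0 < `|b| by rewrite normr_gt0.
  rewrite -(ler_pM2r nb) -expr2 -cstar_norm; exact: cmul_norm_le.
by apply/eqP; rewrite eq_le le andbT; have := le (star a); rewrite starK.
Qed.

Lemma repB pi a b v : pi (a - b) v = pi a v - pi b v.
Proof.
have -> : a - b = (-1) *: b + a by rewrite scaleN1r addrC.
by rewrite rep_linear scaleN1r addrC.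
Qed.

Lemma repD pi a b v : pi (a + b) v = pi a v + pi b v.
Proof. by rewrite -[a]scale1r rep_linear !scale1r. Qed.

Lemma rep0 pi v : pi 0 v = 0.
Proof. by rewrite -(subrr (0 : A)) repB subrr. Qed.

Lemma rep_le1 pi a v : `|pi a v| <= (`|a| + 1) * `|v|.
Proof. by apply: le_trans (rep_le a v) _; rewrite ler_wpM2r // lerDl. Qed.

Lemma norm1_gt0 a : 0 < `|a| + 1.
Proof. by rewrite ltr_wpDl. Qed.

Lemma closed_subspace_rep pi a (V : set (rep_space pi)) :
  closed_subspace V -> closed_subspace [set u | V (pi a u)].
Proof. by move=> hV; apply: closed_subspace_preimage hV => [|v];
  [exact: norm1_gt0 a|exact: rep_le1]. Qed.

(** Invariance under [a] does not pass to [star a]. Imposed on both, it defines a C*-subalgebra,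
    which is closed because representations and [star] do not increase norms. *)
Lemma generated_invariant pi (G : set A) (V : set (rep_space pi)) :
  closed_subspace V ->
  (forall a, G a -> forall v, V v -> V (pi a v) /\ V (pi (star a) v)) ->
  forall a, cstar_generated G a -> forall v, V v -> V (pi a v).
Proof.
move=> cV hG.
suff hB : cstar_subalgebra [set a | forall v, V v -> V (pi a v) /\ V (pi (star a) v)].
  by move=> a ha v Vv; have [] := ha _ (conj hB hG) v Vv.
have [V0 Vl /closedP Vc] := cV.
split.
- move=> c a b ha hb v Vv; have [a1 a2] := ha v Vv; have [b1 b2] := hb v Vv.
  by rewrite star_semilinear !rep_linear; split; exact: Vl.
- move=> a b ha hb v Vv; have [a1 a2] := ha v Vv; have [b1 b2] := hb v Vv.
  rewrite star_mul !rep_mul; split; first by case: (ha _ b1).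
  by case: (hb _ a2).
- by move=> a ha v Vv; rewrite starK; have [] := ha v Vv.
- by move=> v Vv; rewrite star0 rep0.
- apply/closedP => a h v Vv.
  have [->|v0] := eqVneq v 0; first by rewrite !linear0.
  have nv : 0 < `|v| by rewrite normr_gt0.
  split; apply: Vc => e e0; have [b hb ab] := h _ (divr_gt0 e0 nv).
    exists (pi b v); first by case: (hb _ Vv).
    rewrite -repB; apply: le_lt_trans (rep_le _ _) _.
    by rewrite -ltr_pdivlMr.
  exists (pi (star b) v); first by case: (hb _ Vv).
  rewrite -repB -starB; apply: le_lt_trans (rep_le _ _) _.
  by rewrite star_norm -ltr_pdivlMr.
Qed.

Lemma generated_intertwine rho pi (G : set A) (U : {linear rep_space rho ->
  rep_space pi}) :
  (forall v, `|U v| = `|v|) ->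
  (forall a, G a -> forall v, U (rho a v) = pi a (U v) /\
                              U (rho (star a) v) = pi (star a) (U v)) ->
  forall a, cstar_generated G a -> forall v, U (rho a v) = pi a (U v).
Proof.
move=> nU hG.
suff hB : cstar_subalgebra [set a | forall v, U (rho a v) = pi a (U v) /\
                              U (rho (star a) v) = pi (star a) (U v)].
  by move=> a ha v; have [] := ha _ (conj hB hG) v.
split.
- move=> c a b ha hb v; have [a1 a2] := ha v; have [b1 b2] := hb v.
  by rewrite star_semilinear !rep_linear !linearP a1 a2 b1 b2.
- move=> a b ha hb v.
  rewrite star_mul !rep_mul; split.
    by rewrite (ha _).1 (hb _).1.
  by rewrite (hb _).2 (ha _).2.
- by move=> a ha v; rewrite starK; have [] := ha v.
- by move=> v; rewrite star0 !rep0 linear0.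
- have aux a v : (forall e, 0 < e ->
    exists2 b, U (rho b v) = pi b (U v) & `|a - b| < e) ->
      U (rho a v) = pi a (U v).
    move=> h; apply/eqP; rewrite -subr_eq0; apply/eqP.
    apply: (@norm_small _ _ _ (`|v| + `|v|)); first by rewrite addr_ge0.
    move=> e e0; have [b hb /ltW ab] := h e e0.
    rewrite -(subrKA (U (rho b v))) {2}hb -linearB -!repB.
    apply: le_trans (ler_normD _ _) _; rewrite mulrDr nU; apply: lerD.
      by apply: le_trans (rep_le _ _) _; rewrite ler_wpM2r.
    apply: le_trans (rep_le _ _) _; rewrite nU ler_wpM2r //.
    by rewrite distrC.
  apply/closedP => a h v; split; apply: aux => e /h [b hb ab].
    by exists b => //; case: (hb v).
  by exists (star b); [case: (hb v) | rewrite -starB star_norm].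
Qed.

End Generated.

(** * Shift systems and permutative bases *)

(** A bijection of the points with the pairs of a letter and a point, [ins] being the inverse. The
    sequence space and the index set of any permutative basis are both of this kind, so orbits and
    codings are studied once for both. *)
Record shift_system (N : nat) := ShiftSystem {
  pt :> Type;
  ins : 'I_N -> pt -> pt;
  hd : pt -> 'I_N;
  sh : pt -> pt;
  ins_hd_sh : forall k, ins (hd k) (sh k) = k;
  hd_ins : forall i k, hd (ins i k) = i;
  sh_ins : forall i k, sh (ins i k) = k
}.

Section ShiftSystem.
Variables (N : nat) (X : shift_system N).
Implicit Types (k l : X) (w : seq 'I_N).

Definition coding k : Omega N := fun n => hd (iter n (@sh N X) k).
Definition ins_word w k : X := foldr (@ins N X) k w.
Definition coding_prefix k n : seq 'I_N := mkseq (coding k) n.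

Lemma coding_sh k n : coding (sh k) n = coding k n.+1.
Proof. by rewrite /coding iterSr. Qed.

Lemma coding_iter_sh k m n : coding (iter m (@sh N X) k) n = coding k (m + n)%N.
Proof. by rewrite /coding addnC iterD. Qed.

Lemma coding_ins i k : coding (ins i k) = scons i (coding k).
Proof.
apply: funext => -[|n]; first by rewrite /coding /= hd_ins.
by rewrite -coding_sh sh_ins.
Qed.

Lemma coding_prefixS k n : coding_prefix k n.+1 = hd k :: coding_prefix (sh k) n.
Proof.
rewrite /coding_prefix /mkseq /= -[1%N]addn0 iotaDl -map_comp; congr (_ :: _).
by apply: eq_map => m; rewrite /= coding_sh add1n.
Qed.

Lemma size_coding_prefix k n : size (coding_prefix k n) = n.
Proof. exact: size_mkseq. Qed.

Lemma ins_word_prefix k n : ins_word (coding_prefix k n) (iter n (@sh N X) k) = k.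
Proof.
elim: n k => [|n IH] k //.
by rewrite coding_prefixS iterSr /= IH ins_hd_sh.
Qed.

Lemma iter_sh_ins_word w k : iter (size w) (@sh N X) (ins_word w k) = k.
Proof. by elim: w k => [|i w IH] k //=; rewrite -iterS iterSr sh_ins. Qed.

Lemma coding_prefix_ins_word w k : coding_prefix (ins_word w k) (size w) = w.
Proof. by elim: w => [|i w IH] //; rewrite coding_prefixS /= hd_ins sh_ins IH. Qed.

(** A point is rebuilt from a prefix of its coding and the corresponding iterate of the shift. Hence
    distinct points with the same coding never merge at equal times. *)
Lemma coding_iter_inj k l n :
  coding k = coding l -> iter n (@sh N X) k = iter n (@sh N X) l -> k = l.
Proof.
move=> kl E; rewrite -(ins_word_prefix k n) -(ins_word_prefix l n) E.
by rewrite /coding_prefix kl.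
Qed.

(* The classes of tail_rel and of sync_rel span the irreducible subspaces of
   O_N and of its UHF subalgebra, respectively. *)
Definition tail_rel k l := exists m n, iter m (@sh N X) k = iter n (@sh N X) l.
Definition sync_rel k l := exists n, iter n (@sh N X) k = iter n (@sh N X) l.

Lemma tail_rel_refl k : tail_rel k k.
Proof. by exists 0%N, 0%N. Qed.
Lemma tail_rel_sym k l : tail_rel k l -> tail_rel l k.
Proof. by move=> [m [n E]]; exists n, m. Qed.
Lemma tail_rel_trans l k j : tail_rel k l -> tail_rel l j -> tail_rel k j.
Proof.
move=> [m [n E]] [p [q E']]; exists (p + m)%N, (n + q)%N.
by rewrite !iterD E -E' -!iterD addnC.
Qed.
Lemma sync_rel_refl k : sync_rel k k.
Proof. by exists 0%N. Qed.
Lemma sync_rel_sym k l : sync_rel k l -> sync_rel l k.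
Proof. by move=> [n E]; exists n. Qed.
Lemma sync_rel_trans l k j : sync_rel k l -> sync_rel l j -> sync_rel k j.
Proof.
move=> [n E] [p E']; exists (p + n)%N.
by rewrite iterD E -iterD addnC iterD E' -iterD addnC.
Qed.
Lemma tail_rel_ins i k : tail_rel k (ins i k).
Proof. by exists 0%N, 1%N; rewrite /= sh_ins. Qed.
Lemma tail_rel_sh k : tail_rel k (sh k).
Proof. by exists 1%N, 0%N. Qed.

Lemma tail_rel_word k l : tail_rel k l ->
  exists w w', [/\ coding_prefix k (size w') = w' &
    ins_word w (iter (size w') (@sh N X) k) = l].
Proof.
move=> [m [n E]]; exists (coding_prefix l n), (coding_prefix k m).
by rewrite !size_coding_prefix E ins_word_prefix.
Qed.

Lemma sync_rel_word k l : sync_rel k l ->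
  exists w w', [/\ size w = size w', coding_prefix k (size w') = w'
    & ins_word w (iter (size w') (@sh N X) k) = l].
Proof.
move=> [n E]; exists (coding_prefix l n), (coding_prefix k n).
by rewrite !size_coding_prefix E ins_word_prefix.
Qed.

End ShiftSystem.

Program Definition Omega_system (N : nat) : shift_system N :=
  @ShiftSystem N (Omega N) (@scons N) (fun x => x 0%N) (fun x n => x n.+1) _ _ _.
Next Obligation. by move=> N x; apply: funext => -[|n]. Qed.
Next Obligation. by []. Qed.
Next Obligation. by []. Qed.

Lemma iter_sh_Omega N (x : Omega_system N) m n : iter m (@sh N _) x n = (x : Omega N) (m
  + n)%N.
Proof. by elim: m n => [|m IH] n //=; rewrite IH addnS. Qed.

Lemma coding_Omega N (x : Omega_system N) : coding x = x.
Proof. by apply: funext => n; rewrite /coding /= iter_sh_Omega addn0. Qed.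

Lemma tail_equivP N (x y : Omega N) :
  tail_equiv x y <-> exists m n, forall i, x (m + i)%N = y (n + i)%N.
Proof.
split.
  move=> [z [m h]]; have [z0 _] := h _ (leqnn m).
  exists (absz (m%:Z + z)), m => i; have [_ <-] := h _ (leq_addr i m).
  congr x; apply/eqP; rewrite -eqz_nat PoszD gez0_abs // PoszD.
  rewrite gez0_abs; first by apply/eqP; ring.
  by have [] := h _ (leq_addr i m).
move=> [m [n h]]; exists (m%:Z - n%:Z), n => i ni.
have -> : i%:Z + (m%:Z - n%:Z) = (m + (i - n))%N%:Z.
  by rewrite PoszD -subzn //; ring.
by split => //; rewrite absz_nat h subnKC.
Qed.

Lemma tail_equiv_coding N (X : shift_system N) (k l : X) :
  tail_rel k l -> tail_equiv (coding k) (coding l).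
Proof.
by move=> [m [n E]]; apply/tail_equivP; exists m, n => i; rewrite -!coding_iter_sh E.
Qed.

Lemma tail_equiv_rel N (x y : Omega_system N) :
  tail_equiv x y <-> tail_rel x y.
Proof.
split; last by move/tail_equiv_coding; rewrite !coding_Omega.
move=> /tail_equivP [m [n h]]; exists m, n; apply: funext => i.
by rewrite !iter_sh_Omega.
Qed.

(** This makes the isometry of [irr_permutative_tail_subspace] onto the whole tail subspace. The
    point [l] receives the first [n] letters of [y] in front of a late shift of [k]. *)
Lemma coding_tail_surj N (X : shift_system N) (k : X) (y : Omega N) :
  tail_equiv (coding k) y -> exists2 l : X, tail_rel k l & coding l = y.
Proof.
move=> /tail_equivP [m [n h]].
set l := ins_word (mkseq y n) (iter m (@sh N X) k).
have E : iter n (@sh N X) l = iter m (@sh N X) k.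
  have := iter_sh_ins_word (mkseq y n) (iter m (@sh N X) k).
  by rewrite size_mkseq.
exists l; first by exists m, n.
apply: funext => i; have [ni|ni] := leqP n i.
  by rewrite -(subnKC ni) -h -coding_iter_sh E coding_iter_sh.
have := coding_prefix_ins_word (mkseq y n) (iter m (@sh N X) k).
rewrite size_mkseq => /(congr1 (fun s => nth (y 0%N) s i)).
by rewrite !nth_mkseq.
Qed.

(** * Orthonormal and permutative bases *)

Section OrthonormalBasis.
Variables (R : realType) (H : hilbertType R) (K : Type) (e : K -> H).
Hypothesis onb : orthonormal_basis e.

Lemma basis_inner k l : inner (e k) (e l) = `[< k = l >]%:R.
Proof.
have [e1 e0 _] := onb; case: asboolP => [->|kl]; first exact: e1.
exact: e0.
Qed.

Lemma basis_neq0 k : e k != 0.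
Proof. by rewrite -inner_eq0 basis_inner asboolT // oner_neq0. Qed.

Lemma basis_norm k : `|e k| = 1.
Proof.
apply/eqP; rewrite -(@eqrXn2 _ 2) // ?ler01 //.
by rewrite -inner_norm basis_inner asboolT // expr1n.
Qed.

Lemma basis_inj : injective e.
Proof.
move=> k l kl; have := basis_inner k l; rewrite kl basis_inner asboolT //.
by case: asboolP => // _ /eqP; rewrite oner_eq0.
Qed.

Lemma basis_orthl_eq0 v : (forall k, inner (e k) v = 0) -> v = 0.
Proof.
move=> h; have [_ _ eT] := onb; apply/eqP; rewrite -inner_eq0; apply/eqP.
apply: (@closed_span_orth _ _ (range e)) => [_ [k _ <-]|]; first exact: h.
by rewrite eT.
Qed.

Lemma basis_orthr_eq0 v : (forall k, inner v (e k) = 0) -> v = 0.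
Proof. by move=> h; apply: basis_orthl_eq0 => k; rewrite innerC h conjc0. Qed.

End OrthonormalBasis.

Section PermutativeBasis.
Variables (R : realType) (N : nat) (A : cstarType R) (S : 'I_N -> A).
Hypothesis Srel : cuntz_relations S.
Implicit Types (pi : representation A).

Definition permutative_basis pi (X : shift_system N) (e : X -> rep_space pi) :=
  orthonormal_basis e /\ forall i k, pi (S i) (e k) = e (ins i k).

Lemma rep_star_gen pi i j v : pi (star (S i)) (pi (S j) v) = if i == j then v else 0.
Proof.
rewrite -rep_mul Srel.1; case: eqP => _; [exact: rep_one | exact: rep0].
Qed.

Lemma rep_sum pi (I : Type) (r : seq I) (F : I -> A) v :
  pi (\sum_(i <- r) F i) v = \sum_(i <- r) pi (F i) v.
Proof.
elim: r => [|i r IH]; first by rewrite !big_nil rep0.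
by rewrite !big_cons repD IH.
Qed.

Lemma permutative_shift_system pi : permutative S pi ->
  exists (X : shift_system N) (e : X -> rep_space pi), permutative_basis e.
Proof.
move=> [K [e [onb he]]].
have /choice [f' hf'] (p : 'I_N * K) : exists k, pi (S p.1) (e p.2) = e k by exact: he.
pose f i k := f' (i, k); have hf i k : pi (S i) (e k) = e (f i k) := hf' (i, k).
have star_f i j k : pi (star (S i)) (e (f j k)) = if i == j then e k else 0.
  by rewrite -hf rep_star_gen.
(* If no letter reached [k], each adjoint generator would kill [e k], although the sum of the
   [S_i S_i^*] is 1. *)
have /choice [g hg] k : exists p, f p.1 p.2 = k.
  apply: contrapT => h.
  have : e k = 0.
    rewrite -[LHS]rep_one -Srel.2 rep_sum big1 // => i _.
    rewrite rep_mul (_ : pi (star (S i)) (e k) = 0) ?linear0 //.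
    apply: (basis_orthr_eq0 onb) => l.
    rewrite rep_star starK hf (basis_inner onb); case: asboolP => // kl.
    by case: h; exists (i, l).
  by apply/eqP; exact: (basis_neq0 onb).
(* [S_i^* S_j = 0] makes the images of distinct letters disjoint, and [S_i^* S_i = 1] makes each
   letter act injectively. *)
have gf i k : g (f i k) = (i, k).
  have := hg (f i k); case: (g (f i k)) => j l /= E.
  have := star_f i i k; rewrite eqxx -E star_f.
  case: eqP => [-> /(basis_inj onb) -> //|_ /esym/eqP].
  by rewrite (negPf (basis_neq0 onb k)).
unshelve eexists (@ShiftSystem N K f (fun k => (g k).1) (fun k => (g k).2) _ _ _).
- by move=> k; rewrite /= hg.
- by move=> i k; rewrite /= gf.
- by move=> i k; rewrite /= gf.
by exists e; split.
Qed.

Section Fixed.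
Variables (pi : representation A) (X : shift_system N) (e : X -> rep_space pi).
Hypothesis pb : permutative_basis e.
Let onb := pb.1.

Lemma rep_word w k : pi (word_op S w) (e k) = e (ins_word w k).
Proof.
by elim: w => [|i w IH] /=; rewrite ?rep_one // rep_mul IH pb.2.
Qed.

Lemma rep_star_letter i k :
  pi (star (S i)) (e k) = if hd k == i then e (sh k) else 0.
Proof.
by rewrite -{1}(ins_hd_sh k) -pb.2 rep_star_gen eq_sym.
Qed.

Lemma star_one : star (cone : A) = cone.
Proof. by rewrite -[LHS]cmul1x -{1}[cone]starK -star_mul cmul1x starK. Qed.

Lemma rep_star_word w k : pi (star (word_op S w)) (e k) =
  if coding_prefix k (size w) == w then e (iter (size w) (@sh N X) k) else 0.
Proof.
elim: w k => [|i w IH] k; first by rewrite /= star_one rep_one.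
rewrite /= star_mul rep_mul rep_star_letter coding_prefixS eqseq_cons.
case: eqP => _ /=; last by rewrite linear0.
by rewrite IH -iterSr.
Qed.

Lemma rep_word_star_word w w' k : pi (cmul (word_op S w) (star (word_op S w'))) (e k) =
  if coding_prefix k (size w') == w' then e (ins_word w (iter (size w') (@sh N X) k))
    else 0.
Proof.
rewrite rep_mul rep_star_word; case: ifP => _; first exact: rep_word.
exact: linear0.
Qed.

Lemma word_op_star w : cmul (star (word_op S w)) (word_op S w) = cone.
Proof.
elim: w => [|i w IH]; first by rewrite /= star_one cmul1x.
by rewrite /= star_mul -cmulA [cmul (star (S i)) _]cmulA Srel.1 eqxx cmul1x.
Qed.

Definition word_proj w := cmul (word_op S w) (star (word_op S w)).

(** For a self-adjoint idempotent the C*-identity reads [|p| = |p|^2]. *)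
Lemma norm_word_proj w : `|word_proj w| <= 1.
Proof.
have starP : star (word_proj w) = word_proj w by rewrite star_mul starK.
have idem : cmul (word_proj w) (word_proj w) = word_proj w.
  by rewrite /word_proj -cmulA [cmul (star _) _]cmulA word_op_star cmul1x.
have := cstar_norm (word_proj w); rewrite starP idem => E.
have [->|] := eqVneq `|word_proj w| 0; first exact: ler01.
move=> n0; suff -> : `|word_proj w| = 1 by [].
by apply: (mulfI n0); rewrite mulr1 -expr2 -E.
Qed.

Hypothesis coding_inj : injective (@coding N X).

(* Injectivity of the coding makes the cylinders around k shrink to k alone. *)
Lemma word_proj_cvg v k : forall eps, 0 < eps -> exists n0, forall n, (n0 <= n)%N ->
  `|pi (word_proj (coding_prefix k n)) v - inner v (e k) *: e k| < eps.
Proof.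
set P := [set v | forall eps, 0 < eps -> exists n0, forall n, (n0 <= n)%N ->
  `|pi (word_proj (coding_prefix k n)) v - inner v (e k) *: e k| < eps].
suff hP : closed_subspace P /\ range e `<=` P.
  have [_ _ eT] := onb; have : closed_span (range e) v by rewrite eT.
  exact: (closed_span_sub hP.1 hP.2).
have nP n u : `|pi (word_proj (coding_prefix k n)) u| <= `|u|.
  apply: le_trans (rep_le _ _) _; rewrite ler_piMl //; exact: norm_word_proj.
split; last first.
  move=> _ [l _ <-] eps e0.
  have [-> | kl] := pselect (l = k).
    exists 0%N => n _; rewrite rep_word_star_word size_coding_prefix eqxx ins_word_prefix.
    by rewrite (basis_inner onb) asboolT // scale1r subrr normr0.
  have [n0 hn0] : exists n0, coding k n0 <> coding l n0.
    apply: contrapT => h; apply: kl; apply: coding_inj; apply: funext => n.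
    by apply: contrapT => hn; apply: h; exists n; exact: nesym.
  exists n0.+1 => n hn; rewrite rep_word_star_word size_coding_prefix.
  rewrite (basis_inner onb) asboolF // scale0r subr0.
  case: eqP => [|_]; last by rewrite normr0.
  move=> /(congr1 (fun s => nth (hd k) s n0)); rewrite !nth_mkseq // => E.
  by case: hn0.
split.
- by move=> eps e0; exists 0%N => n _; rewrite linear0 inner0l scale0r subrr normr0.
- move=> c u w hu hw eps e0.
  have c1 : 0 < `|c| + 1 by rewrite ltr_wpDl.
  have [n0 h0] := hu _ (divr_gt0 (divr_gt0 e0 (ltr0n _ 2)) c1).
  have [n1 h1] := hw _ (divr_gt0 e0 (ltr0n _ 2)).
  exists (maxn n0 n1) => n; rewrite geq_max => /andP[/h0 {}h0 /h1 {}h1].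
  rewrite linearP inner_linear scalerDl opprD addrACA -scalerA -scalerBr.
  apply: le_lt_trans (ler_normD _ _) _; rewrite [eps]splitr; apply: ler_ltD h1.
  rewrite normrZ; set d := `|_ - _| in h0 *.
  have d0 : 0 <= d by exact: normr_ge0.
  apply: le_trans (_ : (`|c| + 1) * d <= _).
    by rewrite ler_wpM2r // lerDl.
  by rewrite mulrC -ler_pdivlMr // ltW.
- apply/closedP => u h eps e0.
  have e30 : 0 < eps / 3 by rewrite divr_gt0.
  have [w /(_ _ e30) [n0 hn0] uw] := h _ e30.
  exists n0 => n /hn0 {}hn0.
  set p := word_proj _ in hn0 *.
  have -> : pi p u - inner u (e k) *: e k = pi p (u - w) +
    ((pi p w - inner w (e k) *: e k) - inner (u - w) (e k) *: e k).
    by rewrite innerBl scalerBl linearB opprB !subrKA.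
  have -> : eps = eps / 3 + (eps / 3 + eps / 3) by field.
  apply: le_lt_trans (ler_normD _ _) _; apply: ltrD; first exact: le_lt_trans (nP _ _) uw.
  apply: le_lt_trans (ler_normB _ _) _; apply: ltrD => //.
  rewrite normrZ (basis_norm onb) mulr1; apply: le_lt_trans (Cauchy_Schwarz _ _) _.
  by rewrite (basis_norm onb) mulr1.
Qed.

End Fixed.
End PermutativeBasis.

Lemma finite_pigeonhole (T : Type) (C : set T) (g : nat -> T) :
  finite_set C -> (forall n, C (g n)) ->
  exists m n, (m < n)%N /\ g m = g n.
Proof.
move=> finC gC; apply: contrapT => hn; apply: infinite_nat.
have gi : injective g.
  move=> m n mn; apply: contrapT => /eqP; rewrite neq_ltn => /orP[] h; apply: hn.
    by exists m, n.
  by exists n, m.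
have := finite_preimage (f := g) (B := C) (fun m n _ _ => gi m n) finC.
by congr finite_set; apply/seteqP; split => // n _; exact: gC.
Qed.

(** * Invariant subspaces and atoms *)

Section InvariantSubspaces.
Variables (R : realType) (N : nat) (A : cstarType R) (S : 'I_N -> A).
Hypothesis cuntzS : is_cuntz_algebra S.
Variables (pi : representation A) (X : shift_system N) (e : X -> rep_space pi).
Hypothesis pb : permutative_basis S e.
Let Srel : cuntz_relations S := let: And3 h _ _ := cuntzS in h.
Let onb := pb.1.
Implicit Types (k l : X) (W : set (rep_space pi)).

Lemma uhf_words w w' : size w = size w' ->
  cuntz_uhf S (cmul (word_op S w) (star (word_op S w'))).
Proof. by move=> ww' B [_]; apply; exists w, w'. Qed.

Definition tail_span k := closed_span [set e l | l in tail_rel k].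
Definition sync_span k := closed_span [set e l | l in sync_rel k].

Lemma span_rep (P : set X) a W : closed_subspace W ->
  (forall l, P l -> W (pi a (e l))) ->
  forall v, closed_span [set e l | l in P] v -> W (pi a v).
Proof.
move=> cW h; apply: closed_span_sub; first exact: closed_subspace_rep.
by move=> _ [l Pl <-]; exact: h.
Qed.

Lemma tail_span_invariant k a v : tail_span k v -> tail_span k (pi a v).
Proof.
have [_ gen _] := cuntzS;
  have cV : closed_subspace (tail_span k) by exact: closed_span_subspace.
apply: (generated_invariant (G := range S)) => //; last by rewrite gen.
move=> _ [i _ <-] u hu; split; apply: (span_rep cV) hu => l kl.
  rewrite pb.2; apply: mem_closed_span; exists (ins i l) => //.
  by apply: tail_rel_trans kl _; exact: tail_rel_ins.
rewrite (rep_star_letter Srel pb); case: ifP => _; last by case: cV.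
apply: mem_closed_span; exists (sh l) => //.
by apply: tail_rel_trans kl _; exact: tail_rel_sh.
Qed.

Lemma sync_span_invariant k a v : cuntz_uhf S a -> sync_span k v -> sync_span k (pi a v).
Proof.
have cV : closed_subspace (sync_span k) by exact: closed_span_subspace.
have aux w w' u : size w = size w' -> sync_span k u ->
    sync_span k (pi (cmul (word_op S w) (star (word_op S w'))) u).
  move=> ww' hu; apply: (span_rep cV) hu => l kl.
  rewrite (rep_word_star_word Srel pb); case: eqP => _; last by case: cV.
  apply: mem_closed_span; eexists => //.
  by apply: sync_rel_trans kl _; exists (size w); rewrite iter_sh_ins_word ww'.
move=> ha; apply: generated_invariant cV _ _ ha _ => _ [w [w' [ww' ->]]] u hu.
by rewrite star_mul starK; split; exact: aux.
Qed.

Lemma basis_in_span (P : set X) k : closed_span [set e l | l in P] (e k) -> P k.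
Proof.
move=> hk; apply: contrapT => nP; have := basis_neq0 onb k.
rewrite -inner_eq0 (closed_span_orth _ hk) ?eqxx // => _ [l Pl <-].
by rewrite (basis_inner onb) asboolF // => lk; apply: nP; rewrite -lk.
Qed.

(** The tail span is invariant and nonzero, hence everything, yet it contains no basis vector
    outside the class. [irreducible_coding_inj] uses this to make the orbits of two points with
    equal coding merge. *)
Lemma tail_span_total k : irreducible pi -> forall l, tail_rel k l.
Proof.
move=> [_ _ _ irr] l; have cV := closed_span_subspace [set e l | l in tail_rel k].
have [|E|E] := irr _ cV _ (@subsetT _ _).
- by move=> b v _; exact: tail_span_invariant.
- have : [set 0] (e k) by rewrite -E; apply: mem_closed_span; exists k => //;
    exact: tail_rel_refl.
  by move=> /= /eqP; rewrite (negPf (basis_neq0 onb k)).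
- by apply: basis_in_span; rewrite E.
Qed.

Hypothesis coding_inj : injective (@coding N X).

(** The projections of [word_proj_cvg] move [v] inside [W] towards a nonzero multiple of [e k]. Only
    words of equal length occur, so the argument holds for the UHF subalgebra as well. *)
Lemma invariant_basis W v k : closed_subspace W ->
  (forall w w', size w = size w' -> forall u, W u ->
     W (pi (cmul (word_op S w) (star (word_op S w'))) u)) ->
  W v -> inner v (e k) != 0 -> W (e k).
Proof.
move=> cW hW Wv n0; suff h : W (inner v (e k) *: e k).
  by have := closed_subspaceZ (inner v (e k))^-1 cW h; rewrite scalerA mulVf // scale1r.
have [_ _ /closedP] := cW; apply => eps e0.
have [n0' /(_ _ (leqnn _)) h] := word_proj_cvg Srel pb coding_inj v k e0.
by exists (pi (word_proj S (coding_prefix k n0')) v); [exact: hW | rewrite distrC].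
Qed.

(** The common core for [tail_rel] with the whole algebra and [sync_rel] with the UHF subalgebra. A
    nonzero invariant subspace contains one basis vector of the class, and [B] carries it to all the
    others. *)
Lemma irreducible_span (B : set A) (r : X -> X -> Prop) k :
  r k k ->
  (forall w w', size w = size w' -> B (cmul (word_op S w) (star (word_op S w')))) ->
  (forall l l', r k l -> r k l' -> exists2 b, B b & pi b (e l) = e l') ->
  (forall b v, B b -> closed_span [set e l | l in r k] v ->
     closed_span [set e l | l in r k] (pi b v)) ->
  irreducible_on B (closed_span [set e l | l in r k]).
Proof.
move=> rkk hB hr inv; split => //; first exact: closed_span_subspace.
  move=> E; have : [set 0] (e k) by rewrite -E; apply: mem_closed_span; exists k.
  by move=> /= /eqP; rewrite (negPf (basis_neq0 onb k)).
move=> W cW invW WV.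
have [h|/existsNP [v /not_implyP [Wv v0]]] := pselect (forall v, W v -> v = 0).
  left; apply/seteqP; split => // v ->; by case: cW.
right; apply/seteqP; split => //.
have [l vl] : exists l, inner v (e l) != 0.
  apply: contrapT => h; apply: v0; apply: (basis_orthr_eq0 onb) => l.
  by apply/eqP/negPn/negP => n0; apply: h; exists l.
have kl : r k l.
  apply: contrapT => nkl; move/eqP: vl; apply;
    apply: closed_span_orth (WV _ Wv) => _ [j kj <-].
  by rewrite (basis_inner onb) asboolF // => jl; apply: nkl; rewrite -jl.
have Wl : W (e l).
  by apply: invariant_basis Wv vl => // w w' ww' u Wu; apply: invW => //; exact: hB.
apply: closed_span_sub => // _ [j kj <-].
by have [b Bb <-] := hr _ _ kl kj; exact: invW.
Qed.

Lemma tail_span_irreducible k : irreducible_on setT (tail_span k).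
Proof.
apply: irreducible_span => // [|l l' kl kl'|b v _]; first exact: tail_rel_refl.
  have [w [w' [hw' <-]]] := tail_rel_word (tail_rel_trans (tail_rel_sym kl) kl').
  exists (cmul (word_op S w) (star (word_op S w'))) => //.
  by rewrite (rep_word_star_word Srel pb) hw' eqxx.
exact: tail_span_invariant.
Qed.

Lemma sync_span_irreducible k : irreducible_on (cuntz_uhf S) (sync_span k).
Proof.
apply: irreducible_span => [|w w'|l l' kl kl'|b v]; first exact: sync_rel_refl.
- exact: uhf_words.
- have [w [w' [ww' hw' <-]]] := sync_rel_word (sync_rel_trans (sync_rel_sym kl) kl').
  eexists; first exact: uhf_words ww'.
  by rewrite (rep_word_star_word Srel pb) hw' eqxx.
- exact: sync_span_invariant.
Qed.

(** An atom contains some [e l] and therefore [sync_span l], which is invariant and nonzero;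
    minimality of the atom gives equality. *)
Lemma atomsE : atoms S pi = range sync_span.
Proof.
apply/seteqP; split => [V [cV invV V0 irrV]|_ [k _ <-]];
  last exact: sync_span_irreducible.
have [v Vv v0] : exists2 v, V v & v <> 0.
  apply: contrapT => h; apply: V0; apply/seteqP; split=> [v Vv|_ ->]; last by case: cV.
  by apply: contrapT => v0; apply: h; exists v.
have [l vl] : exists l, inner v (e l) != 0.
  apply: contrapT => h; apply: v0; apply: (basis_orthr_eq0 onb) => l.
  by apply/eqP/negPn/negP => n0; apply: h; exists l.
have Vl : V (e l).
  by apply: invariant_basis Vv vl => // w w' ww' u Vu; apply: invV => //;
    exact: uhf_words.
exists l => //; have [] := irrV (sync_span l) => [|b u Bb hu||E|//].
- exact: closed_span_subspace.
- exact: sync_span_invariant.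
- apply: closed_span_sub => // _ [j kj <-].
  have [w [w' [ww' hw' <-]]] := sync_rel_word kj.
  suff <- : pi (cmul (word_op S w) (star (word_op S w'))) (e l) =
      e (ins_word w (iter (size w') (@sh N X) l)) by apply: invV => //; exact: uhf_words.
  by rewrite (rep_word_star_word Srel pb) hw' eqxx.
- have : [set 0] (e l) by rewrite -E; apply: mem_closed_span; exists l => //;
    exact: sync_rel_refl.
  by move=> /= /eqP; rewrite (negPf (basis_neq0 onb l)).
Qed.

Lemma sync_span_eq k l : sync_span k = sync_span l <-> sync_rel k l.
Proof.
split=> [E|kl].
  apply: basis_in_span; rewrite -/(sync_span k) E.
  by apply: mem_closed_span; exists l => //; exact: sync_rel_refl.
congr closed_span; apply/seteqP; split=> _ [j hj <-]; exists j => //.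
  by apply: sync_rel_trans hj; exact: sync_rel_sym.
exact: sync_rel_trans hj.
Qed.

(** If there are finitely many atoms, two shifts of [k] share one and then agree after further
    shifts. Conversely, once a period [p] is reached, every point is synchronous with one of [p]
    shifts. *)
Lemma finite_atoms k : (forall l, tail_rel k l) ->
  finite_set (atoms S pi) <->
  exists m n, (m < n)%N /\ forall i, coding k (m + i)%N = coding k (n + i)%N.
Proof.
move=> total; rewrite atomsE; split=> [fin|[m [n [mn h]]]].
  have [m [n [mn E]]] := finite_pigeonhole fin (fun n =>
    imageT sync_span (iter n (@sh N X) k)).
  have [a Ea] := (sync_span_eq _ _).1 E; exists (a + m)%N, (a + n)%N.
  split=> [|i]; first by rewrite ltn_add2l.
  by rewrite -!coding_iter_sh !iterD Ea.
have E : iter m (@sh N X) k = iter n (@sh N X) k.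
  by apply: coding_inj; apply: funext => i; rewrite !coding_iter_sh.
set k1 := iter m (@sh N X) k in E; set p := (n - m)%N.
have p0 : (0 < p)%N by rewrite subn_gt0.
have per q : iter (q * p) (@sh N X) k1 = k1.
  elim: q => [|q IH] //; rewrite mulSn iterD IH.
  by rewrite /k1 -iterD subnK // ltnW.
apply: (@sub_finite_set _ _ ((fun j => sync_span (iter j (@sh N X) k1)) @` `I_p)).
  move=> _ [l _ <-]; have [a [b ab]] :=
    tail_rel_trans (tail_rel_sym (total l)) (total k1).
  (* A nonnegative representative of [b - a] modulo [p], since [a + (b + a * p.-1) = b + a * p]. *)
  exists ((b + a * p.-1) %% p)%N; first by rewrite /= ltn_mod.
  apply/sync_span_eq; exists a; rewrite ab.
  set c := (b + _)%N.
  have acE : (a + c = b + a * p)%N by rewrite /c addnCA -mulnS prednK.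
  have -> : iter (c %% p) (@sh N X) k1 = iter c (@sh N X) k1.
    by rewrite [in RHS](divn_eq c p) addnC iterD per.
  by rewrite -iterD acE iterD per.
exact: finite_image (finite_II p).
Qed.

End InvariantSubspaces.

(** * Representations with a non-injective coding *)

Section PeriodicCoding.
Variables (N : nat) (X : shift_system N).
Implicit Types (k l j : X).

Lemma coding_ins_word (w : seq 'I_N) k l :
  coding k = coding l -> coding (ins_word w k) = coding (ins_word w l).
Proof. by move=> kl; elim: w => [|i w IH] //=; rewrite !coding_ins IH. Qed.

(** Forwards the orbit iterates the [p]-fold shift, backwards it inserts the periodic prefix. As
    [Negz n] is [- (n + 1)], it takes [n.+1] periods. Equality of all the codings makes the two
    halves fit together. *)
Lemma periodic_orbit j p : coding (iter p (@sh N X) j) = coding j ->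
  exists g : int -> X, [/\ g 0 = j, forall n, coding (g n) = coding j
    & forall n, iter p (@sh N X) (g n) = g (n + 1)].
Proof.
move=> per.
have per1 i : coding j (p + i)%N = coding j i by rewrite -coding_iter_sh per.
have perm m i : coding j (m * p + i)%N = coding j i.
  by elim: m => [|m IH] //; rewrite mulSn -addnA per1.
have perj m : coding (iter (m * p) (@sh N X) j) = coding j.
  by apply: funext => i; rewrite coding_iter_sh perm.
have ins_sh m : iter (m * p) (@sh N X) (ins_word (coding_prefix j (m * p)) j) = j.
  have := iter_sh_ins_word (coding_prefix j (m * p)) j.
  by rewrite size_coding_prefix.
have ins_cod m : coding (ins_word (coding_prefix j (m * p)) j) = coding j.
  by rewrite -[RHS](congr1 _ (ins_word_prefix j (m * p))); exact: coding_ins_word.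
exists (fun n => match n with
  | Posz n => iter (n * p) (@sh N X) j
  | Negz n => ins_word (coding_prefix j (n.+1 * p)) j end).
split=> // [[n|n]|[n|n]] //.
- by rewrite -iterD -mulSn -PoszD addn1.
- case: n => [|n]; first by have := ins_sh 1%N; rewrite mul1n.
  have -> : Negz n.+1 + 1 = Negz n by rewrite !NegzE; lia.
  apply: (@coding_iter_inj _ _ _ _ (n.+1 * p)).
    by apply: funext => i; rewrite coding_iter_sh !ins_cod per1.
  by rewrite ins_sh -iterD addnC -mulSn ins_sh.
Qed.

Variables (j : X) (p : nat) (g : int -> X).
Hypothesis g_coding : forall n, coding (g n) = coding j.
Hypothesis g_sh : forall n, iter p (@sh N X) (g n) = g (n + 1).

Lemma orbit_sh q n : iter (q * p) (@sh N X) (g n) = g (n + q%:Z).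
Proof.
elim: q => [|q IH]; first by rewrite addr0.
by rewrite mulSn iterD IH g_sh; congr g; lia.
Qed.

(** Here [F] is the action of some [S_s S_t^*] on indices. The points [F (g n)] and
    [g (n + (b - a))] have equal codings and merge at equal times, so they coincide: one hit of the
    orbit determines a translation of all of it. *)
Lemma orbit_transport (s t : nat) (F : X -> X) a b n :
  (forall k l, coding k = coding l -> coding (F k) = coding (F l)) ->
  (forall k, iter s (@sh N X) (F k) = iter t (@sh N X) k) ->
  F (g a) = g b -> F (g n) = g (n + (b - a)).
Proof.
(* [Q] is chosen with [n + Q >= a], so that the point of index [n + Q] is reached from [g a] by [Q']
   forward steps. *)
move=> Fc Ft Fab; pose Q := absz (n - a); pose Q' := absz (n - a + Q%:Z).
have Q'E : Q'%:Z = n - a + Q%:Z by rewrite /Q' /Q; lia.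
apply: (@coding_iter_inj _ _ _ _ (s + Q * p)).
  rewrite g_coding -(g_coding b) -Fab; apply: Fc.
  by rewrite !g_coding.
rewrite [in RHS]iterD orbit_sh addnC iterD Ft -iterD addnC iterD orbit_sh.
have -> : n + Q%:Z = a + Q'%:Z by lia.
have -> : n + (b - a) + Q%:Z = b + Q'%:Z by lia.
by rewrite -!orbit_sh -!iterD addnC iterD -Ft -iterD addnC iterD Fab -!iterD addnC.
Qed.

Lemma orbit_eq_shift a b n : g a = g b -> g (a + n) = g (b + n).
Proof.
move=> ab; rewrite (@orbit_transport 0 0 id a b (a + n)) //.
by congr g; lia.
Qed.

End PeriodicCoding.

(** * Reducibility criteria from orbits with constant coding *)

Section WordOperators.
Variables (R : realType) (N : nat) (A : cstarType R) (S : 'I_N -> A).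
Hypothesis cuntzS : is_cuntz_algebra S.
Let Srel : cuntz_relations S := let: And3 h _ _ := cuntzS in h.
Variable (pi : representation A).
Implicit Types (s t : seq 'I_N).

Definition word2 s t := cmul (word_op S s) (star (word_op S t)).

Lemma word_op_rcons s i : word_op S (rcons s i) = cmul (word_op S s) (S i).
Proof.
by elim: s => [|j s IH] /=; rewrite ?cmul1x ?cmulx1 // IH cmulA.
Qed.

(** The vectors whose images under all [S_s S_t^*] are orthogonal to [v'] form a closed subspace
    that contains [v] but not [v']. It is invariant, since multiplying [S_s S_t^*] on the right by a
    generator or its adjoint gives zero or an operator of the same form. *)
Lemma reducible_of_orth v v' :
  v != 0 -> v' != 0 -> (forall s t, inner (pi (word2 s t) v) v' = 0) -> ~ irreducible pi.
Proof.
move=> v0 v'0 vv' [_ _ _ irr].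
pose W := [set u | forall st : seq 'I_N * seq 'I_N,
  inner (pi (word2 st.1 st.2) u) v' = 0].
have cW : closed_subspace W.
  apply: closed_subspaceI => st.
  exact: (closed_subspace_rep (word2 st.1 st.2) (closed_subspace_orth v')).
have [_ gen _] := cuntzS.
have invW a u : W u -> W (pi a u).
  move: u; apply: (generated_invariant (G := range S)) => //; last by rewrite gen.
  move=> _ [i _ <-] u hu; split=> -[s t] /=.
    rewrite rep_mul; case: t => [|j t].
      rewrite /= star_one rep_one -rep_mul -word_op_rcons.
      by have := hu (rcons s i, [::]); rewrite /word2 /= star_one cmulx1.
    rewrite /= star_mul rep_mul rep_star_gen //; case: eqP => _.
      by have := hu (s, t); rewrite /word2 /= rep_mul.
    by rewrite !linear0 inner0l.
  rewrite rep_mul -[pi (star (word_op S t)) _]rep_mul -star_mul.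
  by have := hu (s, i :: t); rewrite /word2 /= -rep_mul.
have [||E|E] := irr W cW => //.
- by move=> b u _; exact: invW.
- have : W v by move=> [s t]; exact: vv'.
  by rewrite E => /= /eqP; rewrite (negPf v0).
- have : W v' by rewrite E.
  move=> /(_ ([::], [::])); rewrite /word2 /= star_one cmulx1 rep_one => /eqP.
  by rewrite inner_eq0 (negPf v'0).
Qed.

Variables (X : shift_system N) (e : X -> rep_space pi).
Hypothesis pb : permutative_basis S e.
Let onb := pb.1.
Variables (j : X) (p : nat) (g : int -> X).
Hypothesis g_coding : forall n, coding (g n) = coding j.
Hypothesis g_sh : forall n, iter p (@sh N X) (g n) = g (n + 1).

(* Translation along the orbit g commutes with all the operators, so S_s S_t^*
   either translates the whole orbit or maps it to its orthogonal complement. *)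
Lemma word2_orbit s t :
  (exists m, forall n, pi (word2 s t) (e (g n)) = e (g (n + m))) \/
  (forall n m, inner (pi (word2 s t) (e (g n))) (e (g m)) = 0).
Proof.
have E n : pi (word2 s t) (e (g n)) = if coding_prefix j (size t) == t
    then e (ins_word s (iter (size t) (@sh N X) (g n))) else 0.
  by rewrite (rep_word_star_word Srel pb) /coding_prefix g_coding.
case: eqP E => [_|_] E; last by right => n m; rewrite E inner0l.
have [[a [b ab]]|h] := pselect (exists a b,
  ins_word s (iter (size t) (@sh N X) (g a)) = g b).
  left; exists (b - a) => n; rewrite E; congr e.
  apply: (orbit_transport (s := size s) (t := size t)
    (F := fun k => ins_word s (iter (size t) (@sh N X) k)) g_coding g_sh) ab => //.
    move=> k l kl; apply: coding_ins_word; apply: funext => i.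
    by rewrite !coding_iter_sh kl.
  by move=> k; exact: iter_sh_ins_word.
right=> n m; rewrite E (basis_inner onb) asboolF // => nm.
by apply: h; exists n, m.
Qed.

Lemma word2_orth s t v v' :
  (forall n m, inner (pi (word2 s t) (e (g n))) (e (g m)) = 0) ->
  closed_span (range (e \o g)) v -> closed_span (range (e \o g)) v' ->
  inner (pi (word2 s t) v) v' = 0.
Proof.
move=> h hv hv'; rewrite rep_star.
apply: closed_span_orth hv => _ [n _ <-]; rewrite -rep_star innerC.
apply/eqP; rewrite conjc_eq0; apply/eqP.
apply: closed_span_orth hv' => _ [m _ <-].
by rewrite innerC h conjc0.
Qed.

(** On a finite orbit the sum over a period is invariant under translation, hence orthogonal to the
    difference of two consecutive vectors. *)
Lemma reducible_of_cycle a b : a <> b -> g a = g b -> g 0 <> g 1 -> ~ irreducible pi.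
Proof.
move=> ab gab g01.
have [q q0 gq] : exists2 q : nat, (0 < q)%N & forall n, g (n + q%:Z) = g n.
  have gs := orbit_eq_shift g_coding g_sh.
  exists (absz (b - a)); first by lia.
  move=> n; case: (leP a b) => h.
    have -> : n + (absz (b - a))%:Z = b + (n - a) by lia.
    by rewrite -(gs _ _ _ gab); congr g; lia.
  have -> : n + (absz (b - a))%:Z = a + (n - b) by lia.
  by rewrite (gs _ _ _ gab); congr g; lia.
pose Sum m := \sum_(0 <= r < q) e (g (r%:Z + m)).
have Sum1 m : Sum (m + 1) = Sum m.
  apply/eqP; rewrite -subr_eq0 -sumrB.
  have E (r : nat) : r%:Z + (m + 1) = r.+1%:Z + m by lia.
  under eq_bigr do rewrite E.
  rewrite (telescope_sumr (fun r : nat => e (g (r%:Z + m)))) //.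
  by rewrite [q%:Z + m]addrC gq add0r subrr.
have SumE m : Sum m = Sum 0.
  elim/int_rect: m => // n IH.
    by rewrite -IH -[RHS]Sum1; congr Sum; lia.
  by rewrite -IH -[LHS]Sum1; congr Sum; lia.
have cG := closed_span_subspace (range (e \o g)).
have memG n : closed_span (range (e \o g)) (e (g n)).
  by apply: mem_closed_span; exists n.
have Sum_span : closed_span (range (e \o g)) (Sum 0).
  by apply: (closed_subspace_sum _ cG) => r; exact: memG.
have d_span : closed_span (range (e \o g)) (e (g 0) - e (g 1)).
  rewrite -scaleN1r; apply: (closed_subspaceD cG (memG 0)).
  exact: (closed_subspaceZ _ cG (memG 1)).
apply: (@reducible_of_orth (Sum 0) (e (g 0) - e (g 1))).
(* [q] need not be the least period, so vectors may repeat in [Sum 0]; still its inner product with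
   [e (g 0)] is a positive integer, because of the term [r = 0]. *)
- apply/eqP => S0; have := inner0l (e (g 0)); rewrite -S0 inner_suml.
  under eq_bigr => r _ do rewrite (basis_inner onb).
  rewrite big_ltn // addr0 asboolT // -natr_sum -natrD => /eqP.
  by rewrite pnatr_eq0.
- apply/eqP => /eqP; rewrite subr_eq0 => /eqP /(basis_inj onb); exact: g01.
- move=> s t; have [[m hm]|h] := word2_orbit s t; last exact: word2_orth.
  have -> : pi (word2 s t) (Sum 0) = Sum m.
    by rewrite linear_sum; apply: eq_bigr => r _; rewrite hm addr0.
  rewrite SumE innerBr -{2}(Sum1 0) !inner_suml -sumrB big1 // => r _.
  rewrite !(basis_inner onb).
  suff -> : (g (r%:Z + (0 + 1)) = g 1) = (g (r%:Z + 0) = g 0) by rewrite subrr.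
  have gs := orbit_eq_shift g_coding g_sh.
  apply: propext; split => h.
    by have := gs _ _ (-1) h; rewrite subrr add0r addrK addr0.
  by have := gs _ _ 1 h; rewrite !add0r addr0.
Qed.

End WordOperators.

(** * Sums of reciprocals of odd numbers *)

Section OddReciprocals.
Variable F : numFieldType.

(** The integer [n] stands for the odd frequency [2 * n + 1]; the reflection [-1 - n] changes the
    sign of that frequency. *)
Definition odd_inv (n : int) : F := ((2 * n + 1)%:~R)^-1.

Lemma odd_neq0 (n : int) : (2 * n + 1)%:~R != 0 :> F.
Proof. by rewrite intr_eq0; lia. Qed.

Lemma odd_invN n : odd_inv (-1 - n) = - odd_inv n.
Proof.
rewrite /odd_inv (_ : 2 * (-1 - n) + 1 = - (2 * n + 1)); last by lia.
by rewrite mulrNz invrN.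
Qed.

(** For [M = 0] the window of [2 * r] terms is symmetric and cancels by [odd_invN]; increasing [M]
    by one slides the window by one step, which accounts for the new summand. *)
Lemma odd_inv_window (r M : nat) :
  \sum_(0 <= i < M) (odd_inv (i%:Z - r%:Z) - odd_inv (i%:Z + r%:Z)) =
  - \sum_(0 <= k < 2 * r) odd_inv (M%:Z - r%:Z + k%:Z).
Proof.
elim: M => [|M IH].
  rewrite big_nil; apply/esym/eqP; rewrite oppr_eq0.
  set T := \sum_(0 <= k < 2 * r) _.
  suff : T = - T by move/eqP; rewrite -addr_eq0 -mulr2n mulrn_eq0.
  rewrite {1}/T big_nat_rev -sumrN; apply: eq_big_nat => k /andP[_ kr].
  by rewrite -odd_invN; congr odd_inv; lia.
rewrite big_nat_recr //= IH; apply/eqP; rewrite -subr_eq0; apply/eqP.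
set T := \sum_(_ <= k < _) _; set T' := \sum_(_ <= k < _) _.
suff : T' - T = odd_inv (M%:Z + r%:Z) - odd_inv (M%:Z - r%:Z).
  by move/eqP; rewrite -subr_eq0 => /eqP <-; ring.
rewrite /T /T' -sumrB.
have E (k : nat) : M.+1%:Z - r%:Z + k%:Z = M%:Z - r%:Z + k.+1%:Z by lia.
under eq_bigr do rewrite E.
rewrite (telescope_sumr (fun k : nat => odd_inv (M%:Z - r%:Z + k%:Z))) //.
by congr (odd_inv _ - odd_inv _); lia.
Qed.

(** Partial fractions: with [x = 2 * i + 1] both sides are [2 / (x^2 - 4 * r^2)]. *)
Lemma odd_inv_corr (r : int) (i : int) : r != 0 ->
  odd_inv i * (odd_inv (i - r) + odd_inv (i + r)) =
  (odd_inv (i - r) - odd_inv (i + r)) / (2 * r)%:~R.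
Proof.
move=> r0.
have r0' : r%:~R != 0 :> F by rewrite intr_eq0.
have := odd_neq0 i; have := odd_neq0 (i - r); have := odd_neq0 (i + r).
rewrite /odd_inv !rmorphD !rmorphM !rmorphD /= !rmorphN /= => h1 h2 h3.
by field; rewrite ?r0' ?h1 ?h2 ?h3.
Qed.

Lemma odd_inv_ge0 (n : nat) : 0 <= odd_inv n.
Proof. have h : (0 : int) <= 2 * n%:Z + 1 by lia.
by rewrite /odd_inv invr_ge0 ler0z. Qed.

Lemma odd_inv_le (n m : nat) : (m <= n)%N -> odd_inv n <= (m.+1%:R)^-1.
Proof.
move=> mn; have h : (0 : int) < 2 * n%:Z + 1 by lia.
rewrite /odd_inv lef_pV2 ?posrE ?ltr0z //.
by rewrite -[m.+1%:R]/(m.+1%:Z%:~R) ler_int; lia.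
Qed.

(** By the two preceding identities the sum is, up to sign, the mean of the [2 * |r|] terms of a
    window, each of which satisfies the bound. *)
Lemma odd_inv_corr_le (r : int) (M : nat) : r != 0 -> (`|r| <= M)%N ->
  `|\sum_(0 <= i < M) odd_inv i * (odd_inv (i%:Z - r) + odd_inv (i%:Z + r))|
  <= ((M - `|r|).+1%:R)^-1.
Proof.
move=> r0 rM; set q := absz r in rM *.
have q0 : (0 < q)%N by rewrite /q; lia.
have E (i : nat) : odd_inv i * (odd_inv (i%:Z - r) + odd_inv (i%:Z + r)) =
    (odd_inv (i%:Z - q%:Z) - odd_inv (i%:Z + q%:Z)) / (2 * q%:Z)%:~R.
  rewrite -odd_inv_corr //; last by lia.
  congr (_ * _); rewrite /q; case: r {r0 q rM q0} => n.
    by [].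
  by rewrite NegzE abszN absz_nat opprK addrC.
under eq_bigr do rewrite E.
rewrite -mulr_suml odd_inv_window normrM normrN normfV.
have p2q : 0 < (2 * q%:Z)%:~R :> F
  by rewrite ltr0z -[2 * q%:Z]/((2 * q)%N%:Z) ltz_nat muln_gt0.
rewrite (gtr0_norm p2q) ler_pdivrMr //.
apply: le_trans (ler_norm_sum _ _ _) _.
apply: le_trans (_ : \sum_(0 <= k < 2 * q) ((M - q).+1%:R)^-1 <= _).
  apply: ler_sum => k _.
  have -> : M%:Z - q%:Z + k%:Z = (M - q + k)%N by lia.
  rewrite ger0_norm ?odd_inv_ge0 //; apply: odd_inv_le; exact: leq_addr.
rewrite sumr_const_nat subn0.
have -> : (2 * q%:Z)%:~R = (2 * q)%N%:R :> F by rewrite intrM natrM.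
by rewrite mulr_natr.
Qed.

(** The left side is the squared norm of [sgn_term], in which the frequencies [2 * n + 1] and
    [- (2 * n + 1)] contribute equally; the right side telescopes. *)
Lemma odd_inv_sqr_le (n : nat) : (0 < n)%N ->
  odd_inv n ^+ 2 *+ 2 <= n%:R^-1 - n.+1%:R^-1.
Proof.
move=> n0.
have h : (2 * n%:Z + 1)%:~R = 2 * n%:R + 1 :> F by rewrite rmorphD rmorphM.
rewrite /odd_inv h -[n.+1]addn1 natrD -subr_ge0.
have np : 0 < n%:R :> F by rewrite ltr0n.
have np1 : 0 < n%:R + 1 :> F by rewrite ltr_wpDl // ltW.
have np2 : 0 < 2 * n%:R + 1 :> F by rewrite ltr_wpDl // mulr_ge0 // ltW.
have -> : n%:R^-1 - (n%:R + 1)^-1 - (2 * n%:R + 1)^-1 ^+ 2 *+ 2 =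
    ((2 * n%:R + 1) ^+ 2 - 2 * n%:R * (n%:R + 1)) / (n%:R * (n%:R + 1) * (2 * n%:R + 1)
      ^+ 2) :> F.
  by rewrite -mulr_natr; field; rewrite !gt_eqF.
apply: divr_ge0; last by rewrite !mulr_ge0 ?exprn_ge0 // ltW.
have -> : (2 * n%:R + 1) ^+ 2 - 2 * n%:R * (n%:R + 1) = 2 * n%:R ^+ 2 + 2 * n%:R + 1 :> F
  by ring.
by rewrite !addr_ge0 ?mulr_ge0 ?exprn_ge0 // ltW.
Qed.

End OddReciprocals.

(** * The square wave in a Hilbert space *)

Section HilbertTransform.
Variables (R : realType) (H : hilbertType R) (b : int -> H).
Hypothesis b_inner : forall m n, inner (b m) (b n) = (m == n)%:R.
Let G := closed_span (range b).
Notation I := ('i%C : R[i]).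

Let conjI : (I^*)%C = - I.
Proof. by apply/eqP; rewrite eq_complex /= oppr0 !eqxx. Qed.

Let sqrI : I ^+ 2 = -1.
Proof. exact: sqr_i. Qed.

Let conjIM (k : int) : ((I * (k%:~R)^-1)^*)%C = - (I * (k%:~R)^-1).
Proof.
have hM (x y : R[i]) : ((x * y)^*)%C = (x^*)%C * (y^*)%C by exact: rmorphM.
have hV (x : R[i]) : ((x^-1)^*)%C = ((x^*)%C)^-1 by exact: fmorphV.
have hk : ((k%:~R : R[i])^*)%C = k%:~R by exact: rmorph_int.
by rewrite hM hV hk conjI mulNr.
Qed.

(* Up to a constant factor, the Fourier coefficients of the square wave, i.e.
   of the function equal to 1 on one half of the circle and to -1 on the other
   half. *)
Definition sgn_coef (k : int) : R[i] := if odd `|k| then I * (k%:~R)^-1 else 0.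

Lemma sgn_coefN k : sgn_coef (- k) = ((sgn_coef k)^*)%C.
Proof.
rewrite /sgn_coef abszN; case: ifP => _; last by rewrite conjc0.
by rewrite conjIM mulrNz invrN mulrN.
Qed.

Lemma sgn_coef_odd n : sgn_coef (2 * n + 1) = I * odd_inv _ n.
Proof. by rewrite /sgn_coef ifT //; lia. Qed.

Lemma sgn_coef_even n : sgn_coef (2 * n) = 0.
Proof. by rewrite /sgn_coef ifF //; lia. Qed.

Definition sgn_term (i : nat) : H :=
  (I * odd_inv _ i) *: (b (2 * i%:Z + 1) - b (- (2 * i%:Z + 1))).

Definition sgn_psum M : H := \sum_(0 <= i < M) sgn_term i.

Lemma sgn_psum_coef M k :
  inner (sgn_psum M) (b k) = if (`|k| < 2 * M)%N then sgn_coef k else 0.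
Proof.
elim: M => [|M IH]; first by rewrite /sgn_psum big_nil inner0l muln0.
rewrite /sgn_psum big_nat_recr //= innerDl IH innerZl innerBl !b_inner.
have [kM|kM] := ltnP `|k| (2 * M).
  rewrite ifT; last by lia.
  have -> : (2 * M%:Z + 1 == k) = false by lia.
  have -> : (- (2 * M%:Z + 1) == k) = false by lia.
  by rewrite subrr mulr0 addr0.
rewrite add0r.
have [->|k1] := eqVneq k (2 * M%:Z + 1).
  rewrite ?eqxx ifT; last by lia.
  have -> : (- (2 * M%:Z + 1) == 2 * M%:Z + 1) = false by lia.
  by rewrite subr0 mulr1 sgn_coef_odd.
have [->|k2] := eqVneq k (- (2 * M%:Z + 1)).
  rewrite ifT; last by lia.
  rewrite sub0r mulrN1.
  by rewrite /sgn_coef ifT; [rewrite mulrNz invrN mulrN|lia].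
rewrite subrr mulr0; case: ifP => // kM1.
by rewrite /sgn_coef ifF //; lia.
Qed.

Lemma sgn_psum_step M d : (0 < M)%N ->
  inner (sgn_psum (M + d) - sgn_psum M) (sgn_psum (M + d) - sgn_psum M)
  <= M%:R^-1 - (M + d)%N%:R^-1.
Proof.
move=> M0; elim: d => [|d IH]; first by rewrite addn0 !subrr inner0l.
rewrite addnS; set n := (M + d)%N in IH *.
have -> : sgn_psum n.+1 - sgn_psum M = (sgn_psum n - sgn_psum M) + sgn_term n.
  by rewrite /sgn_psum big_nat_recr //= addrAC.
have Mn : (M <= n)%N by rewrite leq_addr.
have o1 : inner (sgn_psum n - sgn_psum M) (sgn_term n) = 0.
  rewrite innerBl !innerZr !innerBr !sgn_psum_coef.
  by rewrite !ifF ?subrr ?mulr0 ?subrr //; lia.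
have o2 : inner (sgn_term n) (sgn_psum n - sgn_psum M) = 0.
  by rewrite innerC o1 conjc0.
have o3 : inner (sgn_term n) (sgn_term n) = odd_inv _ n ^+ 2 *+ 2.
  rewrite innerZl innerZr !innerBr !innerBl !b_inner !eqxx.
  have -> : (- (2 * n%:Z + 1) == 2 * n%:Z + 1) = false by lia.
  have -> : (2 * n%:Z + 1 == - (2 * n%:Z + 1)) = false by lia.
  rewrite conjIM -/(odd_inv _ n) subr0 sub0r opprK.
  have -> : forall x : R[i], I * x * (- (I * x) * (1 + 1)) = - I ^+ 2 * (x ^+ 2 *+ 2).
    by move=> x; rewrite -mulr_natr; ring.
  by rewrite sqrI opprK mul1r.
rewrite innerDl innerDr [inner (sgn_term n) (_ + _)]innerDr o1 o2 o3 addr0 add0r.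
have n0 : (0 < n)%N by lia.
have := lerD IH (odd_inv_sqr_le R[i] n0).
by rewrite subrKA.
Qed.

Lemma sgn_psum_cvg : exists z, forall eps, 0 < eps -> exists n0, forall n, (n0 <= n)%N ->
  `|sgn_psum n - z| < eps.
Proof.
apply: cauchy_seq_cvg => eps e0.
have [n0 hn0] := invn_lt (exprn_gt0 2 e0); exists n0.+1 => n hn.
rewrite -(@ltr_pXn2r _ 2) ?nnegrE ?(ltW e0) //.
rewrite -inner_norm -(subnKC hn); apply: le_lt_trans (sgn_psum_step _ _) _ => //.
apply: le_lt_trans (hn0 n0 (leqnn _)).
by rewrite gerBl invr_ge0.
Qed.

Lemma sgn_vector : exists z, [/\ G z, forall k, inner z (b k) = sgn_coef k
  & forall eps, 0 < eps -> exists n0, forall n, (n0 <= n)%N -> `|sgn_psum n - z| < eps].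
Proof.
have [z hz] := sgn_psum_cvg; exists z; split => //.
  have cG : closed_subspace G := closed_span_subspace _.
  have [_ _ /closedP] := cG; apply => eps /hz [n0 /(_ _ (leqnn _)) h].
  exists (sgn_psum n0); last by rewrite distrC.
  apply: (closed_subspace_sum _ cG) => i; apply: (closed_subspaceZ _ cG).
  have memG n : G (b n) by apply: mem_closed_span; exists n.
  rewrite -scaleN1r; apply: (closed_subspaceD cG (memG _)).
  exact: (closed_subspaceZ _ cG (memG _)).
move=> k; apply/eqP; rewrite -subr_eq0; apply/eqP.
apply: (@norm_small _ _ _ `|b k|) => // eps /hz [n0 h].
have := h (maxn n0 `|k|.+1) (leq_maxl _ _) => /ltW {}h.
have <- : inner (sgn_psum (maxn n0 `|k|.+1)) (b k) = sgn_coef k.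
  by rewrite sgn_psum_coef ifT //; lia.
rewrite -innerBl; apply: le_trans (Cauchy_Schwarz _ _) _.
by rewrite ler_wpM2r // distrC.
Qed.

(* The square wave has constant square, so its autocorrelation vanishes off 0. *)
Lemma sgn_autocorr z (T : H -> H) (m : int) :
  m != 0 ->
  (forall k, inner z (b k) = sgn_coef k) ->
  (forall eps, 0 < eps -> exists n0, forall n, (n0 <= n)%N -> `|sgn_psum n - z| < eps) ->
  (forall k, inner (T z) (b k) = inner z (b (k - m))) ->
  inner (T z) z = 0.
Proof.
move=> m0 zb hz hT.
have psumE M : inner (T z) (sgn_psum M) = \sum_(0 <= i < M) - (I * odd_inv _ i) *
    (sgn_coef (2 * i%:Z + 1 - m) - sgn_coef (- (2 * i%:Z + 1) - m)).
  rewrite inner_sumr; apply: eq_bigr => i _.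
  by rewrite innerZr innerBr !hT !zb conjIM.
have small : forall eps, 0 < eps -> exists n0, forall n, (n0 <= n)%N ->
    `|inner (T z) (sgn_psum n)| < eps.
  (* All the coefficients sit at odd frequencies: an odd translation makes the supports disjoint,
     and a translation by [2 * r] moves the index of [odd_inv] by [r]. *)
  have [[r mr]|modd] := pselect (exists r, m = 2 * r); last first.
    move=> eps e0; exists 0%N => n _; rewrite psumE big1 ?normr0 // => i _.
    have [r mr] : exists r, m = 2 * r + 1.
      exists (m %/ 2)%Z; have := divz_eq m 2.
      have : (m %% 2)%Z = 0 \/ (m %% 2)%Z = 1 by lia.
      by case=> -> E; [case: modd; exists (m %/ 2)%Z; lia|lia].
    have -> : 2 * i%:Z + 1 - m = 2 * (i%:Z - r) by lia.
    have -> : - (2 * i%:Z + 1) - m = 2 * (- i%:Z - r - 1) by lia.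
    by rewrite !sgn_coef_even subrr mulr0.
  have r0 : r != 0 by apply: contra m0 => /eqP r0; rewrite mr r0.
  move=> eps /invn_lt [n0 h]; exists (n0 + `|r|)%N => n hn.
  apply: le_lt_trans (h (n - `|r|)%N _); last by lia.
  rewrite psumE; apply: le_trans (odd_inv_corr_le R[i] r0 (M := n) _); last by lia.
  rewrite le_eqVlt; apply/orP; left; apply/eqP; congr `|_|; apply: eq_bigr => i _.
  have -> : 2 * i%:Z + 1 - m = 2 * (i%:Z - r) + 1 by lia.
  have -> : - (2 * i%:Z + 1) - m = - (2 * (i%:Z + r) + 1) by lia.
  rewrite sgn_coefN !sgn_coef_odd conjIM -/(odd_inv _ (i%:Z + r)).
  have -> : forall x y w : R[i],
    - (I * x) * (I * y - - (I * w)) = - I ^+ 2 * (x * (y + w)).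
    by move=> x y w; ring.
  by rewrite sqrI opprK mul1r.
apply: (@norm_small _ _ _ (1 + `|T z|)); first by rewrite addr_ge0 ?ler01.
move=> eps e0; have [n0 h0] := small _ e0; have [n1 h1] := hz _ e0.
set n := maxn n0 n1.
have {}h0 := ltW (h0 n (leq_maxl _ _)); have {}h1 := ltW (h1 n (leq_maxr _ _)).
have -> : inner (T z) z = inner (T z) (sgn_psum n) - inner (T z) (sgn_psum n - z).
  by rewrite innerBr subKr.
apply: le_trans (ler_normB _ _) _; rewrite mulrDr mulr1; apply: lerD => //.
apply: le_trans (Cauchy_Schwarz _ _) _; rewrite mulrC ler_wpM2r //.
Qed.

(* v and v' are multiples of the indicator functions of complementary halves of
   the circle, so v is orthogonal to all translates of v'. *)
Lemma sgn_vectors : exists v v' : H, [/\ v != 0, v' != 0, G v, G v' &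
  forall T : {linear H -> H}, forall Ts : H ->
    H, (forall u w, inner (T u) w = inner u (Ts w)) ->
    (exists m, forall n, T (b n) = b (n + m)) -> inner (T v) v' = 0].
Proof.
have [z [Gz zb hz]] := sgn_vector.
have z0 : z != 0.
  apply/eqP => z0; have := zb 1; rewrite z0 inner0l /sgn_coef /= invr1 mulr1.
  by move/esym/eqP; rewrite eq_complex /= oner_eq0 andbF.
(* The function behind [z] takes two opposite values of modulus [|z|], so [c *: b 0 + z] and
   [c *: b 0 - z] vanish on complementary halves of the circle. *)
pose c := `|z|; have c0 : c != 0 by rewrite normr_eq0.
have cJ : (c^*)%C = c.
  have : 0 <= c by rewrite normr_ge0.
  by move: (c) => [x y]; rewrite lecE /= => /andP[/eqP -> _]; rewrite oppr0.
have cG : closed_subspace G := closed_span_subspace _.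
have Gb : G (b 0) by apply: mem_closed_span; exists 0.
have zb0 : inner z (b 0) = 0 by rewrite zb.
exists (c *: b 0 + z), (c *: b 0 - z); split.
- apply/eqP => v0; have := inner0l (b 0); rewrite -v0 innerDl innerZl b_inner eqxx zb0.
  by rewrite mulr1 addr0 => /eqP; rewrite (negPf c0).
- apply/eqP => v0; have := inner0l (b 0); rewrite -v0 innerBl innerZl b_inner eqxx zb0.
  by rewrite mulr1 subr0 => /eqP; rewrite (negPf c0).
- by apply: (closed_subspaceD cG) => //; exact: (closed_subspaceZ _ cG).
- apply: (closed_subspaceD cG); first exact: (closed_subspaceZ _ cG).
  by rewrite -scaleN1r; exact: (closed_subspaceZ _ cG).
move=> T Ts adj [m hm].
have Tb u k : G u -> inner (T u) (b k) = inner u (b (k - m)).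
  move=> Gu; rewrite adj; apply/eqP; rewrite -subr_eq0 -innerBr; apply/eqP.
  apply: closed_span_orth Gu => _ [n _ <-].
  rewrite innerBr -adj hm !b_inner; apply/eqP; rewrite subr_eq0; apply/eqP.
  by congr (nat_of_bool _)%:R; apply/eqP/eqP; lia.
have Tz k : inner (T z) (b k) = inner z (b (k - m)) by exact: Tb.
have Tz0 : inner (T z) (b 0) = sgn_coef (- m) by rewrite Tz sub0r zb.
have bz : inner (b m) z = sgn_coef (- m) by rewrite innerC zb -sgn_coefN.
have Tzz : inner (T z) z = if m == 0 then c ^+ 2 else 0.
  case: eqVneq => [m0|m0]; last exact: sgn_autocorr m0 zb hz Tz.
  rewrite -inner_norm; apply/eqP; rewrite -subr_eq0 -innerBl; apply/eqP.
  rewrite innerC; apply/eqP; rewrite conjc_eq0; apply/eqP.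
  apply: closed_span_orth Gz => _ [k _ <-].
  by rewrite innerC innerBl Tz m0 subr0 subrr conjc0.
(* The two mixed terms are [c * sgn_coef (- m)] with opposite signs; the two outer terms cancel as
   well, being both [c^2] in absolute value for [m = 0] and both 0 otherwise. *)
rewrite linearD linearZ /= hm add0r innerDl !innerBr !innerZl !innerZr cJ b_inner Tz0 bz
  Tzz.
by case: eqVneq => _ /=; ring.
Qed.

End HilbertTransform.

(** * Irreducibility makes the coding injective *)

Section IrreducibleCoding.
Variables (R : realType) (N : nat) (A : cstarType R) (S : 'I_N -> A).
Hypothesis cuntzS : is_cuntz_algebra S.
Variables (pi : representation A) (X : shift_system N) (e : X -> rep_space pi).
Hypothesis pb : permutative_basis S e.
Let onb := pb.1.

Lemma reducible_of_aperiodic (j : X) (p : nat) (g : int -> X) :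
  (forall n, coding (g n) = coding j) -> (forall n, iter p (@sh N X) (g n) = g (n + 1)) ->
  injective g -> ~ irreducible pi.
Proof.
move=> gc gs gi.
have b_inner m n : inner ((e \o g) m) ((e \o g) n) = (m == n)%:R.
  rewrite (basis_inner onb); congr (nat_of_bool _)%:R.
  by apply/asboolP/eqP => [/gi|->].
have [v [v' [v0 v'0 Gv Gv' h]]] := sgn_vectors b_inner.
apply: (reducible_of_orth cuntzS v0 v'0) => s t.
have [[m hm]|o] := word2_orbit cuntzS pb gc gs s t.
  by apply: (h (pi (word2 S s t)) (pi (star (word2 S s t)))); [exact: rep_star|exists m].
exact: word2_orth o Gv Gv'.
Qed.

(** Points with equal coding have merging orbits by [tail_span_total]. If they merge at equal times,
    they are equal. At different times they produce a point whose coding has a period that the point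
    itself lacks, hence a nonconstant orbit [g], and one of the two reducibility results applies. *)
Lemma irreducible_coding_inj : irreducible pi -> injective (@coding N X).
Proof.
move=> irr.
have aux k k' a b : coding k = coding k' -> k <> k' -> (a < b)%N ->
    iter a (@sh N X) k = iter b (@sh N X) k' -> False.
  move=> kk' nk ab E; pose j := iter a (@sh N X) k; pose p := (b - a)%N.
  have jE : j = iter b (@sh N X) k' by [].
  have pj : iter p (@sh N X) j = iter b (@sh N X) k by rewrite /j /p -iterD subnK // ltnW.
  have cj : coding (iter p (@sh N X) j) = coding j.
    by rewrite pj jE; apply: funext => i; rewrite !coding_iter_sh kk'.
  have nj : iter p (@sh N X) j <> j.
    by rewrite pj jE => h; apply: nk; exact: coding_iter_inj h.
  have [g [g0 gc gs]] := periodic_orbit cj.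
  have [gi|] := pselect (injective g); first exact: (reducible_of_aperiodic gc gs gi irr).
  move=> /existsNP [m] /existsNP [n] /not_implyP [gmn mn].
  apply: (reducible_of_cycle cuntzS pb gc gs mn gmn) irr.
  by rewrite -[1]add0r -gs g0 => /esym.
move=> k k' kk'; apply: contrapT => nk.
have [a [b E]] := tail_span_total cuntzS pb k irr k'.
have [ab|ab|ab] := ltngtP a b.
- exact: aux kk' nk ab E.
- exact: aux (esym kk') (nesym nk) ab (esym E).
- by apply: nk; apply: (coding_iter_inj (n := b) kk'); rewrite -E ab.
Qed.

End IrreducibleCoding.

(** * The shift representation *)

Lemma isometry_norm (R : realType) (H H' : hilbertType R) (U : {linear H -> H'}) :
  (forall u v, inner (U u) (U v) = inner u v) -> forall v, `|U v| = `|v|.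
Proof. by move=> h v; apply: eq_norm_inner. Qed.

Lemma irreducible_equiv (R : realType) (A : cstarType R) (rho pi : representation A)
    (V : set (rep_space pi)) :
  equiv_restriction rho V -> irreducible_on setT V -> irreducible rho.
Proof.
move=> [U [hU rU iU]] [_ _ V0 irrV]; split; [exact: closed_subspace_setT | by [] | |].
  move=> E; apply: V0; rewrite -rU E; apply/seteqP; split=> [_ [u -> <-]|_ ->].
    by rewrite linear0.
  by exists 0 => //; rewrite linear0.
move=> W cW invW _.
have [|||E|E] := irrV (U @` W).
- exact: (closed_subspace_image (isometry_norm hU) cW).
- by move=> a _ _ [w Ww <-]; exists (rho a w); [exact: invW|exact: iU].
- by rewrite -rU => _ [w _ <-]; exists w.
- left; apply/seteqP; split => [w Ww|_ ->]; last by case: cW.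
  apply: (isometry_inj hU); rewrite linear0.
  have : (U @` W) (U w) by exists w.
  by rewrite E.
- right; apply/seteqP; split => // w _.
  have : (U @` W) (U w) by rewrite E -rU; exists w.
  by move=> [w' Ww' /(isometry_inj hU) <-].
Qed.

Section ShiftRepresentation.
Variables (R : realType) (N : nat) (A : cstarType R) (S : 'I_N -> A).
Hypothesis cuntzS : is_cuntz_algebra S.
Let Srel : cuntz_relations S := let: And3 h _ _ := cuntzS in h.
Variables (piS : representation A) (e : Omega N -> rep_space piS).
Hypothesis piSP : is_shift_representation S e.

Let pbS : permutative_basis (X := Omega_system N) S e := piSP.
Let coding_inj : injective (@coding N (Omega_system N)).
Proof. by move=> x y; rewrite !coding_Omega. Qed.

Lemma tail_subspaceE x : tail_subspace e x = tail_span (X := Omega_system N) e x.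
Proof.
by congr closed_span; apply/seteqP; split=> _ [y /tail_equiv_rel xy <-]; exists y.
Qed.

Lemma tail_subspace_rep x : exists rho : representation A,
  [/\ irreducible rho, permutative S rho & equiv_restriction rho (tail_subspace e x)].
Proof.
rewrite tail_subspaceE; set V0 := tail_span _ _.
have cV : closed_subspace V0 := closed_span_subspace _.
pose V := ClosedSubspace cV.
have inv a v : sub_set V v -> sub_set V (piS a v).
  exact: (tail_span_invariant cuntzS pbS (k := x)).
have eqV : equiv_restriction (restr_rep inv) V0 := restr_rep_equiv inv.
exists (restr_rep inv); split => //.
  exact: irreducible_equiv eqV (tail_span_irreducible cuntzS pbS coding_inj x).
have [U [hU rU iU]] := eqV.
pose K := {y : Omega N | @tail_rel N (Omega_system N) x y}.
have memV (y : K) : range U (e (sval y)).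
  by rewrite rU; apply: mem_closed_span; exists (sval y) => //; exact: (svalP y).
have /choice [b hb] (y : K) : exists u, U u = e (sval y).
  by have [u _ <-] := memV y; exists u.
have onb := piSP.1.
exists K, b; split; first split.
- by move=> y; rewrite -hU !hb (basis_inner onb) asboolT.
- move=> y z yz; rewrite -hU !hb (basis_inner onb) asboolF // => E; apply: yz.
  move: y z E => [y hy] [z hz] /= E; subst z; congr exist; exact: Prop_irrelevance.
- apply/seteqP; split => // u _.
  have cZ : closed_subspace (closed_span (range b)) := closed_span_subspace _.
  have cUZ := closed_subspace_image (isometry_norm hU) cZ.
  have : V0 `<=` U @` (closed_span (range b)).
    apply: closed_span_sub => // _ [y xy <-].
    pose yK : K := exist _ y xy; exists (b yK); last exact: hb.
    by apply: mem_closed_span; exists yK.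
  have : V0 (U u) by rewrite -rU; exists u.
  by move=> hu /(_ _ hu) [w hw /(isometry_inj hU) <-].
- move=> i [y xy].
  have xiy : @tail_rel N (Omega_system N) x (scons i y).
    by apply: tail_rel_trans xy _; exact: (@tail_rel_ins N (Omega_system N) i y).
  exists (exist _ (scons i y) xiy); apply: (isometry_inj hU).
  by rewrite iU !hb /= piSP.2.
Qed.

Lemma tail_subspace_class x :
  irr_permutative_class S (restriction_class (tail_subspace e x)).
Proof.
have [rho [irr perm eqV]] := tail_subspace_rep x.
by exists rho; split => //; exact: equiv_restriction_class.
Qed.

Lemma tail_subspace_eq x y : tail_equiv x y -> tail_subspace e x = tail_subspace e y.
Proof.
rewrite !tail_subspaceE => /tail_equiv_rel xy.
congr closed_span; apply/seteqP; split=> _ [z hz <-]; exists z => //.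
  by apply: tail_rel_trans hz; exact: tail_rel_sym.
exact: tail_rel_trans hz.
Qed.

(** The vector [u] that corresponds to [e x] is fixed by the projections for all prefixes of [x]. So
    is its image in the subspace of [y], and by [word_proj_cvg] only multiples of [e x] are; hence
    [e x] lies in that subspace. *)
Lemma tail_subspace_class_inj x y :
  restriction_class (tail_subspace e x) = restriction_class (tail_subspace e y) ->
  tail_equiv x y.
Proof.
move=> E; have [rho [_ _ eqx]] := tail_subspace_rep x.
have eqy : equiv_restriction rho (tail_subspace e y).
  by apply: unitary_class_eq; rewrite -E; exact: equiv_restriction_class.
move: eqx eqy => [U1 [h1 r1 i1]] [U2 [h2 r2 i2]].
have [u _ u1] : range U1 (e x).
  by rewrite r1 tail_subspaceE; apply: mem_closed_span; exists x => //;
    exact: tail_rel_refl.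
pose P n := word_proj S (coding_prefix (X := Omega_system N) x n).
have fixu n : rho (P n) u = u.
  apply: (isometry_inj h1); rewrite i1 u1 /P (rep_word_star_word Srel pbS).
  by rewrite size_coding_prefix eqxx ins_word_prefix.
have fixw n : piS (P n) (U2 u) = U2 u by rewrite -i2 fixu.
have wE : U2 u = inner (U2 u) (e x) *: e x.
  apply/eqP; rewrite -subr_eq0; apply/eqP; apply: (@norm_small _ _ _ 1) => // eps e0.
  have [n0 /(_ _ (leqnn _)) h] := word_proj_cvg Srel pbS coding_inj (U2 u) x e0.
  by rewrite mulr1 -[X in X - _](fixw n0) ltW.
have w0 : inner (U2 u) (e x) != 0.
  apply/eqP => w0; move: wE; rewrite w0 scale0r => wE.
  have u0 : u = 0 by apply: (isometry_inj h2); rewrite wE linear0.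
  by have := basis_neq0 piSP.1 x; rewrite -u1 u0 linear0 eqxx.
have : tail_subspace e y (e x).
  have cV : closed_subspace (tail_subspace e y) := closed_span_subspace _.
  have : tail_subspace e y (U2 u) by rewrite -r2; exists u.
  rewrite wE => /(closed_subspaceZ (inner (U2 u) (e x))^-1 cV).
  by rewrite scalerA mulVf // scale1r.
rewrite tail_subspaceE => /(basis_in_span pbS) xy.
exact/tail_equiv_rel/tail_rel_sym.
Qed.

(** Both claims concern one and the same [x], the coding of a basis point. The isometry that sends
    the basis vector of [k] to that of its coding intertwines the generators and their adjoints,
    hence the whole algebra. *)
Lemma irr_permutative_tail_subspace (pi : representation A) :
  irreducible pi -> permutative S pi -> exists x,
  unitary_class pi = restriction_class (tail_subspace e x) /\
  (finite_set (atoms S pi) <->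
   exists m n, (m < n)%N /\ forall i, x (m + i)%N = x (n + i)%N).
Proof.
move=> irr perm; have [X [b pb]] := permutative_shift_system Srel perm.
have cinj := irreducible_coding_inj cuntzS pb irr.
have onb := pb.1.
have [k] : exists k : X, True.
  apply: contrapT => h; have [_ _ T0 _] := irr; apply: T0.
  apply/seteqP; split => // v _; apply: (basis_orthl_eq0 onb) => k.
  by case: h; exists k.
move=> _; have total := tail_span_total cuntzS pb k irr.
exists (coding k); split; last exact: (finite_atoms cuntzS pb cinj total).
have bg k1 k2 : inner (b k1) (b k2) = inner ((e \o @coding N X) k1) ((e \o @coding N X)
  k2).
  rewrite (basis_inner onb) (basis_inner piSP.1); congr (nat_of_bool _)%:R.
  by apply/asboolP/asboolP => [->|/cinj].
have [U [Ub hU rU]] := isometry_ext bg (let: And3 _ _ h := onb in h).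
apply/esym/equiv_restriction_class; exists U; split => //.
  rewrite rU; congr closed_span; apply/seteqP; split.
    by move=> _ [l _ <-]; exists (coding l) => //; apply: tail_equiv_coding; exact: total.
  by move=> _ [y /coding_tail_surj [l _ <-] <-]; exists l.
have nU := isometry_norm hU.
have [_ gen _] := cuntzS.
move=> a; apply: (generated_intertwine (G := range S) nU); last by rewrite gen.
have ext c : (forall l, U (pi c (b l)) = piS c (U (b l))) ->
  forall v, U (pi c v) = piS c (U v).
  move=> h v.
  have bT : closed_span (range b) v by case: onb => _ _ ->.
  have c1 := norm1_gt0 c.
  have h1 w : `|U (pi c w)| <= (`|c| + 1) * `|w| by rewrite nU; exact: rep_le1.
  have h2 w : `|piS c (U w)| <= (`|c| + 1) * `|w| by rewrite -nU; exact: rep_le1.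
  have cE := @closed_subspace_eq R _ _ (U \o pi c : {linear _ ->
    _}) (piS c \o U : {linear _ -> _}) _ _ c1 c1 h1 h2.
  by apply: (closed_span_sub cE) bT => _ [l _ <-]; exact: h.
move=> _ [i _ <-] v; split; apply: ext => l.
  by rewrite pb.2 !Ub /= piSP.2 coding_ins.
rewrite (rep_star_letter Srel pb) Ub /= (rep_star_letter Srel pbS).
have -> : hd (s := Omega_system N) (coding l) = hd l by [].
case: ifP => _; last exact: linear0.
by rewrite Ub /=; congr e; apply: funext => n; rewrite coding_sh.
Qed.

End ShiftRepresentation.

(** * The slow continued fraction algorithm *)

Section SlowMaps.
Variables (R : realType) (N : nat).
Hypothesis N2 : (2 <= N)%N.
Implicit Types (x y u v w : Omega N) (i j : 'I_N) (t s r : R).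

Notation slow := (@slow_map R N).

Definition unit_itv t := 0 <= t <= 1.

Lemma letter_cases i :
  (i = 0%N :> nat /\ forall t, slow i t = t / ((N.-1)%:R * t + 1)) \/
  (exists k, [/\ (0 < k)%N, (k < N)%N, i = (N - k)%N :> nat
    & forall t, slow i t = 1 / (t + k%:R)]).
Proof.
have [i0|i0] := eqVneq (nat_of_ord i) 0%N.
  by left; split => // t; rewrite /slow_map i0.
right; exists (N - i)%N; have := ltn_ord i; split; try lia.
by move=> t; rewrite /slow_map (negPf i0).
Qed.

Let m1 : 1 <= (N.-1)%:R :> R.
Proof. by rewrite ler1n; lia. Qed.

Let knat k : (0 < k)%N -> 1 <= k%:R :> R.
Proof. by move=> k0; rewrite ler1n. Qed.

Definition word_map (w : seq 'I_N) t := foldr slow t w.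

(** The bound on [c + d] is the source of contraction, and positivity of [a + b] and [a + c] carries
    the induction. That [c] is positive for nonempty words serves [periodic_quadratic], where [c] is
    a leading coefficient. *)
Lemma word_map_mobius (w : seq 'I_N) : exists a b c d : nat,
  [/\ [/\ (0 < d)%N, (0 < a + b)%N, (0 < a + c)%N, (size w < c + d)%N & (0 < size w)%N ->
    (0 < c)%N],
    (a * d)%:Z - (b * c)%:Z = 1 \/ (a * d)%:Z - (b * c)%:Z = -1
  & forall t, 0 <= t -> word_map w t = (a%:R * t + b%:R) / (c%:R * t + d%:R)].
Proof.
elim: w => [|i w [a [b [c [d [[d0 ab ac cd cw] det h]]]]]].
  exists 1%N, 0%N, 0%N, 1%N; split => //; first by left.
  by move=> t t0; rewrite /= mul0r add0r mul1r addr0 divr1.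
have pos (p q : nat) t : 0 <= t -> (0 < q)%N -> p%:R * t + q%:R != 0.
  move=> t0 q0; rewrite gt_eqF // ltr_wpDl ?mulr_ge0 // ltr0n //.
have [[_ hi]|[k [k0 kN _ hi]]] := letter_cases i.
  exists a, b, (N.-1 * a + c)%N, (N.-1 * b + d)%N; split.
  - split => //=; nia.
  - by move: det; rewrite !PoszM !PoszD !PoszM => -[] E; [left|right]; rewrite -E; ring.
  - move=> t t0; rewrite /= hi h //.
    have e1 := pos c d t t0 d0;
      have e2 := pos (N.-1 * a + c)%N (N.-1 * b + d)%N t t0 (ltn_addl _ d0).
    move: e2; rewrite !natrD !natrM => e2; field; rewrite e1 /= andbT.
    exact: e2.
exists c, d, (a + k * c)%N, (b + k * d)%N; split.
- split => //=; nia.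
- by move: det; rewrite !PoszM !PoszD !PoszM => -[] E; [right|left];
    rewrite -[RHS](congr1 -%R E) ?opprK; lia.
- move=> t t0; rewrite /= hi h //.
  have q0 : (0 < b + k * d)%N by nia.
  have e1 := pos c d t t0 d0; have e2 := pos (a + k * c)%N (b + k * d)%N t t0 q0.
  move: e2; rewrite !natrD !natrM => e2; field; rewrite e1 /= andbT.
  by move: e2; apply: contra => /eqP E; apply/eqP; rewrite -E; ring.
Qed.

Lemma slow_itv i t : unit_itv t -> unit_itv (slow i t).
Proof.
move=> /andP[t0 t1]; have [[_ hi]|[k [k0 kN _ hi]]] := letter_cases i; rewrite hi.
  have p : 0 < (N.-1)%:R * t + 1 by rewrite ltr_wpDl // mulr_ge0.
  rewrite /unit_itv divr_ge0 ?(ltW p) //= ler_pdivrMr // mul1r.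
  have := m1; nra.
have k1 := knat k0; have p : 0 < t + k%:R by lra.
by rewrite /unit_itv divr_ge0 ?(ltW p) //= ler_pdivrMr //; lra.
Qed.

Lemma word_map_itv (w : seq 'I_N) t : unit_itv t -> unit_itv (word_map w t).
Proof. by move=> ht; elim: w => [|i w IH] //=; exact: slow_itv. Qed.

(** Derivatives do not help directly, since [h_1] has derivative 1 at 0. The difference is [|s - t|]
    divided by [(c s + d) (c t + d)], and this product is at least [|s - t| (c + d)], because
    [|s - t|] is bounded both by [1] and by [s + t]. *)
Lemma word_map_contract (w : seq 'I_N) s t : unit_itv s -> unit_itv t ->
  `|word_map w s - word_map w t| <= (size w).+1%:R^-1.
Proof.
move=> /andP[s0 s1] /andP[t0 t1].
have [a [b [c [d [[d0 _ _ cd _] det h]]]]] := word_map_mobius w.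
rewrite !h //.
have d1 : 1 <= d%:R :> R := knat d0.
have c0 : 0 <= c%:R :> R by [].
have cd' : (size w).+1%:R <= c%:R + d%:R :> R by rewrite -natrD ler_nat.
have ps : 0 < c%:R * s + d%:R by nra.
have pt : 0 < c%:R * t + d%:R by nra.
have -> : (a%:R * s + b%:R) / (c%:R * s + d%:R) - (a%:R * t + b%:R) / (c%:R * t + d%:R)
    = (a%:R * d%:R - b%:R * c%:R) * ((s - t) / ((c%:R * s + d%:R) * (c%:R * t + d%:R))).
  by field; rewrite !gt_eqF.
have -> : forall z : R, `|(a%:R * d%:R - b%:R * c%:R) * z| = `|z|.
  move=> z; rewrite normrM.
  suff -> : `|a%:R * d%:R - b%:R * c%:R| = 1 :> R by rewrite mul1r.
  have := congr1 (fun z : int => z%:~R : R); rewrite -!natrM.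
  by case: det => E /(_ _ _ E); rewrite rmorphB /= => ->; rewrite ?mulrN1z ?normrN normr1.
have pp := mulr_gt0 ps pt.
rewrite normrM normfV (gtr0_norm pp) ler_pdivrMr //.
have n0 : 0 < (size w).+1%:R :> R by rewrite ltr0n.
rewrite mulrC ler_pdivlMr //.
apply: le_trans (_ : `|s - t| * (c%:R + d%:R) <= _); first by rewrite ler_wpM2l.
have : `|s - t| <= 1 by rewrite ler_norml; apply/andP; split; lra.
have : `|s - t| <= s + t by rewrite ler_norml; apply/andP; split; lra.
set z := `|s - t| => z1 z2.
have h1 : z * c%:R <= (s + t) * c%:R by rewrite ler_wpM2r.
have h2 : (s + t) * c%:R <= (s + t) * c%:R * d%:R
  by rewrite ler_peMr // mulr_ge0 ?addr_ge0.
have h3 : z * d%:R <= d%:R by rewrite ler_piMl // ltW // ltr0n.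
have h4 : d%:R <= d%:R * d%:R :> R by rewrite ler_peMr.
have h5 : 0 <= c%:R * s * (c%:R * t) by rewrite !mulr_ge0.
lra.
Qed.

(** The endpoints are the values at 0 and 1, ordered by the sign of the determinant. In this form
    the images can be treated as nested closed intervals. *)
Lemma word_map_range (w : seq 'I_N) : exists lo hi, forall r,
  lo <= r <= hi <-> exists2 t, unit_itv t & word_map w t = r.
Proof.
have [a [b [c [d [[d0 _ _ cd _] det h]]]]] := word_map_mobius w.
have d1 : 1 <= d%:R :> R := knat d0.
have c0 : 0 <= c%:R :> R by [].
have p1 : 0 < c%:R + d%:R :> R by lra.
have p0 : 0 < d%:R :> R by lra.
have dr : (a%:R * d%:R - b%:R * c%:R = 1 :> R) \/ (a%:R * d%:R - b%:R * c%:R = -1 :> R).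
  have hc := congr1 (fun z : int => z%:~R : R); rewrite -!natrM.
  by case: det => /hc; rewrite rmorphB /= => E; [left|right]; rewrite E ?mulrN1z.
have back t r : 0 <= t -> (a%:R - c%:R * r != 0) ->
  t = (d%:R * r - b%:R) / (a%:R - c%:R * r) ->
    word_map w t = r.
  move=> t0 ar E; rewrite h //.
  have pt : c%:R * t + d%:R != 0 by rewrite gt_eqF //; nra.
  have E' : t * (a%:R - c%:R * r) = d%:R * r - b%:R by rewrite E divfK.
  by apply: (mulIf pt); rewrite divfK //; lra.
case: dr => det'.
  exists (b%:R / d%:R), ((a%:R + b%:R) / (c%:R + d%:R)) => r; split.
    move=> /andP[]; rewrite ler_pdivrMr // ler_pdivlMr // => h1 h2.
    have ar : 0 < a%:R - c%:R * r.
      rewrite -(pmulr_lgt0 _ p1); nra.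
    exists ((d%:R * r - b%:R) / (a%:R - c%:R * r)).
      by rewrite /unit_itv divr_ge0 ?(ltW ar) ?ler_pdivrMr //=; lra.
    by apply: back; rewrite ?gt_eqF // divr_ge0 ?(ltW ar) //; lra.
  move=> [t /andP[t0 t1] <-]; rewrite h //.
  have pt : 0 < c%:R * t + d%:R by nra.
  rewrite ler_pdivrMr // mulrAC ler_pdivlMr // ler_pdivrMr // mulrAC ler_pdivlMr //.
  apply/andP; split; nra.
exists ((a%:R + b%:R) / (c%:R + d%:R)), (b%:R / d%:R) => r; split.
  move=> /andP[]; rewrite ler_pdivrMr // ler_pdivlMr // => h1 h2.
  have ar : a%:R - c%:R * r < 0.
    rewrite -(pmulr_llt0 _ p1); nra.
  exists ((d%:R * r - b%:R) / (a%:R - c%:R * r)).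
    rewrite -mulrNN -invrN /unit_itv divr_ge0 ?ler_pdivrMr //=; lra.
  apply: back; rewrite ?lt_eqF //.
  rewrite -mulrNN -invrN divr_ge0 //; lra.
move=> [t /andP[t0 t1] <-]; rewrite h //.
have pt : 0 < c%:R * t + d%:R by nra.
rewrite ler_pdivrMr // mulrAC ler_pdivlMr // ler_pdivrMr // mulrAC ler_pdivlMr //.
apply/andP; split; nra.
Qed.

End SlowMaps.

Definition shift_seq (N : nat) (n : nat) (x : Omega N) : Omega N := fun i => x (n + i)%N.

(** * Cylinders and the decoding map *)

Section Decoding.
Variables (R : realType) (N : nat).
Hypothesis N2 : (2 <= N)%N.
Implicit Types (x y u v w : Omega N) (i j : 'I_N) (t s r : R).

Notation slow := (@slow_map R N).
Notation word := (@word_map R N).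

Lemma word_map_cat (w1 w2 : seq 'I_N) t : word (w1 ++ w2) t = word w1 (word w2 t).
Proof. by rewrite /word_map foldr_cat. Qed.

Lemma mkseq_add x m n : mkseq x (m + n) = mkseq x m ++ mkseq (shift_seq m x) n.
Proof.
rewrite /mkseq iotaD map_cat add0n -[in iota m n](addn0 m) iotaDl -map_comp.
by congr (_ ++ _).
Qed.

Definition cylinder x n : set R := [set r | exists2 t, unit_itv t &
  word (mkseq x n) t = r].

Lemma cylinder_anti x m n : (m <= n)%N -> cylinder x n `<=` cylinder x m.
Proof.
move=> mn r [t ht <-]; rewrite -(subnKC mn) mkseq_add word_map_cat.
by eexists => //; exact: word_map_itv.
Qed.

Lemma cylinder_unique x r s :
  (forall n, cylinder x n r) -> (forall n, cylinder x n s) -> r = s.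
Proof.
move=> hr hs; apply/eqP; rewrite -subr_eq0; apply/eqP.
apply: (@norm_small _ _ _ 1) => // e e0; rewrite mulr1.
pose n := Num.truncn e^-1.
have [t ht <-] := hr n; have [t' ht' <-] := hs n.
apply: le_trans (word_map_contract N2 _ ht ht') _; rewrite size_mkseq.
by rewrite invf_ple ?posrE // ltW // truncnS_gt.
Qed.

Lemma cylinder_exists x : exists r, forall n, cylinder x n r.
Proof.
have /choice [lo /choice [hi H]] n := word_map_range R N2 (mkseq x n).
have itv0 : @unit_itv R 0 by rewrite /unit_itv lexx ler01.
have lohi m n : lo m <= hi n.
  pose p := word (mkseq x (maxn m n)) 0.
  have hp : cylinder x (maxn m n) p by exists 0.
  have /H /andP[h1 _] := cylinder_anti (leq_maxl m n) hp.
  have /H /andP[_ h2] := cylinder_anti (leq_maxr m n) hp.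
  exact: le_trans h1 h2.
exists (sup (range lo)) => n; apply/H; apply/andP; split.
  apply: sup_upper_bound; last by exists n.
  by split; [exists (lo 0%N), 0%N|exists (hi 0%N) => _ [k _ <-]].
by apply: ge_sup; [exists (lo 0%N), 0%N|move=> _ [k _ <-]].
Qed.

Lemma Dec_cylinder x n : cylinder x n (Dec R x).
Proof.
have [r hr] := cylinder_exists x.
suff h : (\bigcap_n ((fun t => foldr slow t (mkseq x n.+1)) @` `[0,
  1]%classic)) (Dec R x).
  (* [Dec] intersects over nonempty prefixes only; monotonicity recovers the empty one. *)
  apply: (cylinder_anti (leqnSn n)); have [t ht <-] := h n I; exists t => //.
apply: (xgetPex 0); exists r => k _; have [t ht <-] := hr k.+1.
by exists t => //=; rewrite in_itv.
Qed.

Lemma Dec_itv x : unit_itv (Dec R x).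
Proof. by have [t ht <-] := Dec_cylinder x 0. Qed.

(** It suffices to exhibit an orbit in the unit interval with itinerary [x]. Such orbits arise in
    [Dec_surj] by choosing preimages, and in [quadratic_periodic] from the conjugate root. *)
Lemma Dec_unique x (T : nat -> R) : (forall n, unit_itv (T n)) ->
  (forall n, T n = slow (x n) (T n.+1)) -> T 0%N = Dec R x.
Proof.
move=> hT hx; apply: (cylinder_unique (x := x)); last exact: Dec_cylinder.
move=> n; exists (T n) => //; elim: n => [|n IH] //.
by rewrite -addn1 mkseq_add word_map_cat /= -IH /shift_seq addn0 addn1 -hx.
Qed.

Lemma Dec_step x : Dec R x = slow (x 0%N) (Dec R (shift_seq 1 x)).
Proof.
apply: (cylinder_unique (x := x)); first exact: Dec_cylinder.
move=> n; apply: (cylinder_anti (leqnSn n)).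
have [t ht E] := Dec_cylinder (shift_seq 1 x) n; exists t => //.
by rewrite -add1n mkseq_add word_map_cat E.
Qed.

Lemma shift_seqD m n x : shift_seq m (shift_seq n x) = shift_seq (n + m) x.
Proof. by apply: funext => i; rewrite /shift_seq addnA. Qed.

Lemma shift_seq0 x : shift_seq 0 x = x.
Proof. by []. Qed.

Lemma Dec_stepn x n : Dec R (shift_seq n x) = slow (x n) (Dec R (shift_seq n.+1 x)).
Proof. by rewrite Dec_step shift_seqD addn1 /shift_seq addn0. Qed.

Lemma Dec_word x n : Dec R x = word (mkseq x n) (Dec R (shift_seq n x)).
Proof.
elim: n x => [|n IH] x //; rewrite -add1n mkseq_add word_map_cat /= -shift_seqD -IH.
exact: Dec_step.
Qed.

Lemma slow_map_surj t : unit_itv t -> exists i t', unit_itv t' /\ t = slow i t'.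
Proof.
move=> /andP[t0 t1].
have N0 : 0 < N%:R :> R by rewrite ltr0n; lia.
have NE : N%:R = (N.-1)%:R + 1 :> R by rewrite natr1 prednK //; lia.
have [h|h] := leP (N%:R * t) 1.
  have i0 : (0 < N)%N by lia.
  exists (Ordinal i0), (t / (1 - (N.-1)%:R * t)).
  have m1 : 1 <= (N.-1)%:R :> R by rewrite ler1n; lia.
  have p : 0 < 1 - (N.-1)%:R * t.
    have : N%:R * (1 - (N.-1)%:R * t) > 0 by rewrite NE in h *; nra.
    by rewrite pmulr_rgt0.
  split; first by rewrite /unit_itv divr_ge0 ?(ltW p) //= ler_pdivrMr //;
    rewrite NE in h; lra.
  rewrite /slow_map /=; field; rewrite gt_eqF //=.
  have -> : (N.-1)%:R * t + (1 - (N.-1)%:R * t) = 1 :> R by ring.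
  by rewrite oner_eq0.
have tp : 0 < t by rewrite -(pmulr_rgt0 _ N0); lra.
(* The integer part of [1 / t] is less than [N] because [N * t > 1], so it selects the letter
   [N - k]. *)
pose k := Num.truncn t^-1.
have k1 : (0 < k)%N by rewrite /k truncn_gt0 invf_ge1.
have kle : k%:R <= t^-1 by rewrite /k truncn_le invr_ge0.
have klt : t^-1 < k.+1%:R by rewrite /k truncnS_gt.
have kN : (k < N)%N.
  rewrite -(ltr_nat R); apply: le_lt_trans kle _.
  by rewrite invf_plt ?posrE // -(ltr_pM2l N0) divff ?gt_eqF.
have iN : (N - k < N)%N by lia.
exists (Ordinal iN), (t^-1 - k%:R); split.
  by rewrite /unit_itv -[k.+1]addn1 natrD in klt *; apply/andP; split; lra.
rewrite /slow_map /= ifF; last by lia.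
have -> : (N - (N - k))%N = k by lia.
by rewrite subrK div1r invrK.
Qed.

Lemma Dec_surj t : unit_itv t -> exists x, Dec R x = t.
Proof.
move=> ht.
have /choice [F hF] (r : R) : exists p : 'I_N * R, unit_itv r -> unit_itv p.2 /\
  r = slow p.1 p.2.
  have [h|h] := boolP (unit_itv r); last first.
    have i0 : (0 < N)%N by lia.
    by exists (Ordinal i0, 0).
  by have [i [t' [h1 h2]]] := slow_map_surj h; exists (i, t').
pose T n := iter n (fun r => (F r).2) t.
have hT n : unit_itv (T n) by elim: n => [|n IH] //=; case: (hF _ IH).
exists (fun n => (F (T n)).1); apply/esym/(Dec_unique (T := T)) => // n.
by case: (hF _ (hT n)).
Qed.

End Decoding.

(** * Rational numbers and PGL_2(Z)-equivalence *)

Section Rationality.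
Variable R : realType.
Implicit Types r s t : R.

Definition is_rat r := exists q : rat, r = ratr q.

Lemma is_ratD r s : is_rat r -> is_rat s -> is_rat (r + s).
Proof. by move=> [p ->] [q ->]; exists (p + q); rewrite rmorphD. Qed.
Lemma is_ratN r : is_rat r -> is_rat (- r).
Proof. by move=> [p ->]; exists (- p); rewrite rmorphN. Qed.
Lemma is_ratM r s : is_rat r -> is_rat s -> is_rat (r * s).
Proof. by move=> [p ->] [q ->]; exists (p * q); rewrite rmorphM. Qed.
Lemma is_ratV r : is_rat r -> is_rat r^-1.
Proof. by move=> [p ->]; exists p^-1; rewrite fmorphV. Qed.
Lemma is_rat_int (z : int) : is_rat z%:~R.
Proof. by exists z%:~R; rewrite ratr_int. Qed.
Lemma is_rat_nat (n : nat) : is_rat n%:R.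
Proof. by exists n%:R; rewrite ratr_nat. Qed.
Lemma is_rat1 : is_rat 1. Proof. exact: (is_rat_nat 1). Qed.
Lemma is_rat0 : is_rat 0. Proof. exact: (is_rat_nat 0). Qed.

Lemma is_ratB r s : is_rat r -> is_rat s -> is_rat (r - s).
Proof. by move=> hr hs; apply: is_ratD => //; exact: is_ratN. Qed.

Lemma irrational_neq r s : ~ is_rat r -> is_rat s -> r != s.
Proof. by move=> hr hs; apply/eqP => rs; apply: hr; rewrite rs. Qed.

Lemma irrational_neq0 r : ~ is_rat r -> r != 0.
Proof. by move=> hr; apply: irrational_neq hr is_rat0. Qed.

Lemma irrationalV r : ~ is_rat r -> ~ is_rat r^-1.
Proof. by move=> hr /is_ratV; rewrite invrK. Qed.
Lemma irrationalN r : ~ is_rat r -> ~ is_rat (- r).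
Proof. by move=> hr /is_ratN; rewrite opprK. Qed.
Lemma irrationalDr r s : ~ is_rat r -> is_rat s -> ~ is_rat (r + s).
Proof. by move=> hr hs /is_ratB /(_ hs); rewrite addrK. Qed.

Lemma PGL2Z_refl r : PGL2Z_equiv r r.
Proof.
by exists 1, 0, 0, 1; split; [left;
  ring|rewrite mul0r add0r oner_eq0|rewrite mul0r mul1r addr0 add0r divr1].
Qed.

Lemma PGL2Z_sym r s : PGL2Z_equiv r s -> PGL2Z_equiv s r.
Proof.
move=> [a [b [c [d [det n0 ->]]]]].
have detR : (a%:~R * d%:~R - b%:~R * c%:~R) != 0 :> R.
  by rewrite -!rmorphM -rmorphB intr_eq0; case: det => ->.
have e : - c%:~R * ((a%:~R * r + b%:~R) / (c%:~R * r + d%:~R)) + a%:~R =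
   (a%:~R * d%:~R - b%:~R * c%:~R) / (c%:~R * r + d%:~R) :> R by field.
exists d, (- b), (- c), a; split.
- by case: det => E; [left|right]; rewrite -E; ring.
- by rewrite rmorphN e mulf_neq0 // invr_eq0.
- rewrite !rmorphN e; field; rewrite n0 /=.
  by move: detR; rewrite [b%:~R * _]mulrC.
Qed.

Lemma PGL2Z_trans s r t : PGL2Z_equiv r s -> PGL2Z_equiv s t -> PGL2Z_equiv r t.
Proof.
move=> [a [b [c [d [det n0 ->]]]]] [a' [b' [c' [d' [det' n0' ->]]]]].
have e : (c' * a + d' * c)%:~R * r + (c' * b + d' * d)%:~R =
   (c'%:~R * ((a%:~R * r + b%:~R) / (c%:~R * r + d%:~R)) + d'%:~R) * (c%:~R * r + d%:~R)
     :> R.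
  by rewrite !rmorphD !rmorphM; field.
exists (a' * a + b' * c), (a' * b + b' * d), (c' * a + d' * c), (c' * b + d' * d); split.
- have -> : (a' * a + b' * c) * (c' * b + d' * d) - (a' * b + b' * d) * (c' * a + d' * c)
    =
     (a * d - b * c) * (a' * d' - b' * c') by ring.
  by case: det => ->; case: det' => ->; rewrite ?mulN1r ?mul1r ?opprK; auto.
- by rewrite e mulf_neq0.
- rewrite e !rmorphD !rmorphM; field; rewrite n0 /=.
  have e2 : c'%:~R * (a%:~R * r + b%:~R) + d'%:~R * (c%:~R * r + d%:~R) =
   (c'%:~R * ((a%:~R * r + b%:~R) / (c%:~R * r + d%:~R)) + d'%:~R) * (c%:~R * r + d%:~R)
     :> R by field.
  by rewrite e2 mulf_neq0.
Qed.

Lemma PGL2Z_addz r (z : int) : PGL2Z_equiv r (r + z%:~R).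
Proof.
by exists 1, z, 0, 1; split; [left;
  ring|rewrite mul0r add0r oner_eq0|rewrite mul0r mul1r add0r divr1].
Qed.

Lemma is_rat_PGL2Z r s : PGL2Z_equiv r s -> is_rat r -> is_rat s.
Proof.
move=> [a [b [c [d [_ _ ->]]]]] hr.
have h (u v : int) : is_rat (u%:~R * r + v%:~R).
  by apply: is_ratD; [apply: is_ratM => //|]; exact: is_rat_int.
by apply: is_ratM => //; exact: is_ratV.
Qed.

Lemma natr_floor_eq (k l : nat) t s : 0 < t < 1 -> 0 < s < 1 ->
  t + k%:R = s + l%:R -> k = l /\ t = s.
Proof.
move=> /andP[t0 t1] /andP[s0 s1] E.
have kl : k = l.
  have h1 : (k < l.+1)%N by rewrite -(ltr_nat R) -natr1; lra.
  have h2 : (l < k.+1)%N by rewrite -(ltr_nat R) -natr1; lra.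
  lia.
by split => //; move: E; rewrite kl => /addIr.
Qed.

End Rationality.

(** * Uniqueness of codings and the codings of rational numbers *)

Section Coding.
Variables (R : realType) (N : nat).
Hypothesis N2 : (2 <= N)%N.
Implicit Types (x y u v w : Omega N) (i j : 'I_N) (t s r : R).

Notation slow := (@slow_map R N).
Notation Dec := (@Dec R N).

Let m1 : 1 <= (N.-1)%:R :> R.
Proof. by rewrite ler1n; lia. Qed.

Lemma is_rat_slow i t : is_rat t -> is_rat (slow i t).
Proof.
move=> ht; rewrite /slow_map; case: ifP => _.
  apply: is_ratM => //; apply/is_ratV/is_ratD; last exact: is_rat1.
  by apply: is_ratM => //; exact: is_rat_nat.
apply: is_ratM; first exact: is_rat1.
by apply/is_ratV/is_ratD => //; exact: is_rat_nat.
Qed.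

Lemma irrational_Dec_shift x n : ~ is_rat (Dec x) -> ~ is_rat (Dec (shift_seq n x)).
Proof.
elim: n => [|n IH] // /IH h h'; apply: h; rewrite (Dec_stepn R N2).
exact: is_rat_slow.
Qed.

Lemma irrational_itv t : ~ is_rat t -> unit_itv t -> 0 < t < 1.
Proof.
move=> ht /andP[t0 t1]; rewrite !lt_def t0 t1.
by rewrite (irrational_neq ht (is_rat0 R)) eq_sym (irrational_neq ht (is_rat1 R)).
Qed.

(** Over the open interval the images are disjoint: the reciprocal of the value exceeds [N] for
    [h_1] and otherwise lies strictly between [k] and [k + 1], which is at most [N]. *)
Lemma slow_map_inj i j t s : 0 < t < 1 -> 0 < s < 1 -> slow i t = slow j s -> i = j /\
  t = s.
Proof.
move=> ht hs E.
have {E} : (slow i t)^-1 = (slow j s)^-1 by rewrite E.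
have V i' (r : R) : 0 < r < 1 -> i' = 0%N :> nat -> slow i' r = r / ((N.-1)%:R * r + 1) ->
   (slow i' r)^-1 = r^-1 + (N.-1)%:R.
  move=> /andP[r0 r1] _ ->;
    have p : 0 < (N.-1)%:R * r + 1 by rewrite ltr_wpDl // mulr_ge0 // ltW.
  by field; rewrite !gt_eqF.
have V1 (r : R) : 0 < r < 1 -> 1 < r^-1 by move=> /andP[r0 r1]; rewrite invf_gt1.
have NE : (N.-1)%:R + 1 = N%:R :> R by rewrite natr1 prednK //; lia.
have kb k : (k < N)%N -> k%:R + 1 <= N%:R :> R by move=> kN; rewrite natr1 ler_nat.
have [[i0 hi]|[k [k0 kN ik hi]]] := letter_cases R N2 i;
  have [[j0 hj]|[l [l0 lN jl hj]]] := letter_cases R N2 j.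
- rewrite V // V // => /addIr /invr_inj ->; split => //.
  by apply: val_inj; rewrite /= i0 j0.
- rewrite V // hj div1r invrK => E; have := V1 _ ht; have := kb _ lN.
  by move: hs => /andP[]; lra.
- rewrite [in RHS]V // hi div1r invrK => E; have := V1 _ hs; have := kb _ kN.
  by move: ht => /andP[]; lra.
- rewrite hi hj !div1r !invrK => /(natr_floor_eq ht hs) [kl ts]; split => //.
  by apply: val_inj; rewrite /= ik jl kl.
Qed.

Lemma Dec_inj x y : ~ is_rat (Dec x) -> Dec x = Dec y -> x = y.
Proof.
move=> hx E; have hy : ~ is_rat (Dec y) by rewrite -E.
have itv z n : ~ is_rat (Dec z) -> 0 < Dec (shift_seq n z) < 1.
  by move=> hz; apply: irrational_itv; [exact: irrational_Dec_shift|exact: Dec_itv].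
have D n : Dec (shift_seq n x) = Dec (shift_seq n y).
  elim: n => [|n IH] //; move: IH; rewrite (Dec_stepn R N2 x n) (Dec_stepn R N2 y n).
  by move=> /(slow_map_inj (itv _ _ hx) (itv _ _ hy)) [].
apply: funext => n; have := D n; rewrite (Dec_stepn R N2 x n) (Dec_stepn R N2 y n).
by move=> /(slow_map_inj (itv _ _ hx) (itv _ _ hy)) [].
Qed.

Lemma PGL2Z_shift x n : PGL2Z_equiv (Dec (shift_seq n x)) (Dec x).
Proof.
rewrite (Dec_word R N2 x n).
have /andP[t0 _] := Dec_itv R N2 (shift_seq n x).
have [a [b [c [d [[d0 _ _ _ _] det h]]]]] := word_map_mobius R N2 (mkseq x n).
exists a%:Z, b%:Z, c%:Z, d%:Z; split => //.
- by rewrite gt_eqF // ltr_wpDl ?mulr_ge0 // ltr0n.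
- exact: h.
Qed.

Lemma tail_equiv_shift x y :
  tail_equiv x y <-> exists m n, shift_seq m x = shift_seq n y.
Proof.
rewrite tail_equivP; split=> -[m [n h]]; exists m, n.
  by apply: funext => i; exact: h.
by move=> i; have /(congr1 (fun z : Omega N => z i)) := h.
Qed.

Lemma tail_refl x : tail_equiv x x.
Proof. by apply/tail_equiv_shift; exists 0%N, 0%N. Qed.
Lemma tail_sym x y : tail_equiv x y -> tail_equiv y x.
Proof. by move=> /tail_equiv_shift [m [n h]]; apply/tail_equiv_shift; exists n, m. Qed.
Lemma tail_trans y x z : tail_equiv x y -> tail_equiv y z -> tail_equiv x z.
Proof.
move=> /tail_equiv_shift [m [n h]] /tail_equiv_shift [p [q h']].
apply/tail_equiv_shift; exists (m + p)%N, (q + n)%N.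
by rewrite -!shift_seqD h -h' !shift_seqD addnC.
Qed.
Lemma tail_shift x n : tail_equiv x (shift_seq n x).
Proof. by apply/tail_equiv_shift; exists n, 0%N. Qed.

Lemma PGL2Z_of_tail x y : tail_equiv x y -> PGL2Z_equiv (Dec x) (Dec y).
Proof.
move=> /tail_equiv_shift [m [n h]].
apply: PGL2Z_trans (PGL2Z_sym (PGL2Z_shift x m)) _.
by rewrite h; exact: PGL2Z_shift.
Qed.

Lemma Dec_eq0 x : Dec x = 0 -> forall n, x n = 0%N :> nat.
Proof.
move=> x0 n.
suff [] : x n = 0%N :> nat /\ Dec (shift_seq n.+1 x) = 0 by [].
have step z : Dec z = 0 -> z 0%N = 0%N :> nat /\ Dec (shift_seq 1 z) = 0.
  have /andP[t0 t1] := Dec_itv R N2 (shift_seq 1 z).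
  rewrite (Dec_step R N2 z);
    have [[i0 hi]|[k [k0 kN ik hi]]] := letter_cases R N2 (z 0%N).
    have p : 0 < (N.-1)%:R * Dec (shift_seq 1 z) + 1 by rewrite ltr_wpDl // mulr_ge0.
    by rewrite hi => /eqP; rewrite mulf_eq0 invr_eq0 (gt_eqF p) orbF => /eqP.
  have k1 : 1 <= k%:R :> R by rewrite ler1n.
  have p : 0 < Dec (shift_seq 1 z) + k%:R by lra.
  by rewrite hi => /eqP; rewrite mulf_eq0 invr_eq0 oner_eq0 /= (gt_eqF p).
elim: n => [|n [_ IH]]; first exact: step.
by have [] := step _ IH; rewrite shift_seqD addn1 /shift_seq addn0.
Qed.

(** Euclid's algorithm. If the value is [p / q], the next tail is [p / (q - (N - 1) p)] after [h_1]
    and [(q - k p) / p] after another letter. The denominator drops unless [p = 0] or [p = q]; in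
    these cases the value, respectively the next tail, is 0, whose only coding repeats the letter of
    [h_1]. *)
Lemma Dec_rational x : is_rat (Dec x) ->
  exists n, forall i : nat, x (n + i)%N = 0%N :> nat.
Proof.
have main (q : nat) : forall (p : nat) x, (0 < q)%N -> Dec x * q%:R = p%:R ->
    exists n, forall i : nat, x (n + i)%N = 0%N :> nat.
  elim: q {-2}q (leqnn q) => [|q0 IH] q qq0 p {}x qp E; first by lia.
  have suffshift : (exists n, forall i : nat, shift_seq 1 x (n + i)%N = 0%N :> nat) ->
      exists n, forall i : nat, x (n + i)%N = 0%N :> nat.
    by move=> [n h]; exists n.+1 => i; rewrite -[RHS](h i) /shift_seq addSn add1n.
  have q0R : 0 < q%:R :> R by rewrite ltr0n.
  have [p0|pp] := posnP p.
    exists 0%N => i; apply: Dec_eq0; apply: (mulIf (lt0r_neq0 q0R)).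
    by rewrite E p0 mul0r.
  have pR : 0 < p%:R :> R by rewrite ltr0n.
  apply: suffshift.
  have /andP[t0 t1] := Dec_itv R N2 (shift_seq 1 x).
  move: E; rewrite (Dec_step R N2 x); set t := Dec _ in t0 t1 *.
  have [[i0 hi]|[k [k0 kN ik hi]]] := letter_cases R N2 (x 0%N); rewrite hi.
    have mt : 0 < (N.-1)%:R * t + 1 by have := m1; nra.
    move=> E; have {}E : t * q%:R = p%:R * ((N.-1)%:R * t + 1) by rewrite -E; field;
      rewrite gt_eqF.
    have lt : (N.-1 * p < q)%N.
      rewrite -(ltr_nat R) natrM ltNge; apply/negP => h.
      have : t * q%:R <= t * ((N.-1)%:R * p%:R) by rewrite ler_wpM2l.
      by rewrite E; nra.
    have N1 : (1 <= N.-1)%N by lia.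
    apply: (IH (q - N.-1 * p)%N _ p); [nia|lia|].
    by rewrite -/t natrB ?(ltnW lt) // natrM mulrBr E; ring.
  have k1 : 1 <= k%:R :> R by rewrite ler1n.
  have tk : 0 < t + k%:R by lra.
  move=> E; have {}E : q%:R = p%:R * (t + k%:R) by rewrite -E; field; rewrite gt_eqF.
  have kpq : (k * p <= q)%N by rewrite -(ler_nat R) natrM E; nra.
  have tp : t * p%:R = (q - k * p)%N%:R by rewrite natrB // natrM E; ring.
  have [pq|pq] := ltnP p q; first by apply: (IH p _ (q - k * p)%N) => //; lia.
  exists 0%N => i; apply: Dec_eq0; apply: (mulIf (lt0r_neq0 pR)).
  rewrite -/t tp mul0r; apply/eqP; rewrite pnatr_eq0; apply/eqP; nia.
move=> [r xr]; have /andP[x0 _] := Dec_itv R N2 x.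
have r0 : 0 <= r by move: x0; rewrite xr ler0q.
apply: (main `|denq r|%N `|numq r|%N); first by rewrite absz_gt0 denq_neq0.
have -> : `|denq r|%N%:R = (denq r)%:~R :> R.
  by rewrite pmulrn gez0_abs // denq_ge0.
have -> : `|numq r|%N%:R = (numq r)%:~R :> R.
  by rewrite pmulrn gez0_abs // numq_ge0.
by rewrite xr /ratr mulfVK // intr_eq0 denq_neq0.
Qed.

Lemma rational_tail_equiv x y : is_rat (Dec x) -> is_rat (Dec y) -> tail_equiv x y.
Proof.
move=> /Dec_rational [m hm] /Dec_rational [n hn]; apply/tail_equivP; exists m, n => i.
by apply: ord_inj; rewrite hm hn.
Qed.

End Coding.

(** * Serret's theorem *)

Section Serret.
Variables (R : realType) (N : nat).
Hypothesis N2 : (2 <= N)%N.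
Implicit Types (x y u v w : Omega N) (t s r : R).

Notation slow := (@slow_map R N).
Notation Dec := (@Dec R N).

(** Coding modulo the integers: it reaches all real numbers, and integer translations leave it
    unchanged. *)
Definition coded r u := exists z : int, Dec u = r - z%:~R.

Lemma coded_exists r : exists u, coded r u.
Proof.
have h : unit_itv (r - (Num.floor r)%:~R).
  have := floor_le r; have := floorD1_gt r; rewrite intrD => h1 h2.
  by apply/andP; split; lra.
by have [u hu] := Dec_surj N2 h; exists u, (Num.floor r).
Qed.

Lemma coded_addz r u (z : int) : coded r u -> coded (r + z%:~R) u.
Proof. by move=> [w E]; exists (w + z); rewrite E intrD; ring. Qed.

Lemma coded_irrational r u : ~ is_rat r -> coded r u -> ~ is_rat (Dec u).
Proof. by move=> hr [z ->]; apply: irrationalDr => //; apply/is_ratN/is_rat_int. Qed.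

Lemma coded_itv r u : ~ is_rat r -> coded r u -> 0 < Dec u < 1.
Proof.
by move=> hr hu; apply: irrational_itv (coded_irrational hr hu) _; exact: Dec_itv.
Qed.

Lemma coded_fun r u v : ~ is_rat r -> coded r u -> coded r v -> u = v.
Proof.
move=> hr hu hv; apply: (Dec_inj N2 (coded_irrational hr hu)).
have /andP[u0 u1] := coded_itv hr hu; have /andP[v0 v1] := coded_itv hr hv.
move: hu hv => [z zE] [w wE].
suff wz : w = z by rewrite zE wE wz.
have h1 : (w - z)%:~R < 1%:~R :> R by rewrite rmorphB /=; lra.
have h2 : (- 1)%:~R < (w - z)%:~R :> R by rewrite rmorphB /=; lra.
by move: h1 h2; rewrite !ltr_int; lia.
Qed.

(** The integer part of [r] may be spread over several letters of [v], hence the induction on it. A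
    first letter [h_1] means [r - (N - 1) = 1 / t] for the next tail value [t]; any other letter
    makes [t] the fractional part of [r], and the tail of [v] is then [u] itself. *)
Lemma coded_inv_gt1 r u v : ~ is_rat r -> 1 < r -> coded r u -> coded r^-1 v ->
  tail_equiv u v.
Proof.
move=> hr r1 hu hv.
have Vr (s : R) : 1 < s -> 0 < s^-1 < 1.
  by move=> s1; rewrite invr_gt0 invf_lt1 ?(lt_trans ltr01) // s1.
have DecV (s : R) w : ~ is_rat s -> 1 < s -> coded s^-1 w -> Dec w = s^-1.
  move=> hs s1 hw; have /andP[w0 w1] := coded_itv (irrationalV hs) hw.
  have /andP[i0 i1] := Vr s s1; move: hw => [z zE].
  have h1 : z%:~R < 1%:~R :> R by lra.
  have h2 : (- 1)%:~R < z%:~R :> R by lra.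
  have z0 : z = 0 by move: h1 h2; rewrite !ltr_int; lia.
  by rewrite zE z0 subr0.
have [n rn] : exists n : nat, r = n%:R + Dec u.
  have /andP[u0 u1] := coded_itv hr hu; case: (hu) => z zE.
  have z0 : 0 <= z.
    have : (-1)%:~R < z%:~R :> R by lra.
    by rewrite ltr_int; lia.
  by exists `|z|%N; rewrite zE pmulrn gez0_abs //; ring.
elim: n {-2}n (leqnn n) r hr r1 v hu hv rn => [|n0 IH] n nn r hr r1 v hu hv rn.
  have /andP[u0 u1] := coded_itv hr hu.
  by move: nn r1; rewrite leqn0 rn => /eqP ->; lra.
have DV := DecV r v hr r1 hv.
have /andP[u0 u1] := coded_itv hr hu.
have v_irr : ~ is_rat (Dec v) by rewrite DV; exact: irrationalV.
have sv_irr := irrational_Dec_shift N2 (n := 1) v_irr.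
have /andP[t0 t1] := irrational_itv sv_irr (Dec_itv R N2 _).
have rE : r = (Dec v)^-1 by rewrite DV invrK.
apply: (tail_trans (y := shift_seq 1 v)); last exact/tail_sym/tail_shift.
set t := Dec (shift_seq 1 v) in t0 t1 sv_irr *.
have [[i0 hi]|[k [k0 kN ik hi]]] := letter_cases R N2 (v 0%N).
  have m0 : 0 < (N.-1)%:R * t + 1 by rewrite ltr_wpDl // mulr_ge0 // ltW.
  have rt : r = t^-1 + (N.-1)%:R.
    by rewrite rE (Dec_step R N2) hi -/t; field; rewrite !gt_eqF.
  have t1' : 1 < t^-1 by rewrite invf_gt1.
  have mn : (N.-1 < n)%N.
    have h : (N.-1)%:R + 1 < n.+1%:R :> R by rewrite -natr1; lra.
    by move: h; rewrite natr1 ltr_nat.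
  apply: (IH (n - N.-1)%N _ t^-1) => //.
  - lia.
  - exact: irrationalV.
  - have -> : t^-1 = r + (- (N.-1)%:Z)%:~R by rewrite rt mulrNz -pmulrn addrK.
    exact: coded_addz.
  - by rewrite invrK; exists 0; rewrite subr0.
  - by rewrite natrB ?(ltnW mn) // addrAC -rn rt addrK.
have rt : t + k%:R = Dec u + n%:R.
  by rewrite [RHS]addrC -rn rE (Dec_step R N2) hi -/t div1r invrK.
have ht : 0 < t < 1 by rewrite t0.
have hu' : 0 < Dec u < 1 by rewrite u0.
have [_ tu] := natr_floor_eq ht hu' rt.
rewrite (Dec_inj N2 sv_irr tu); exact: tail_refl.
Qed.

Lemma coded_inv_pos r u v : ~ is_rat r -> 0 < r -> coded r u -> coded r^-1 v ->
  tail_equiv u v.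
Proof.
move=> hr r0 hu hv; have [r1|r1] := ltP 1 r; first exact: coded_inv_gt1 hr r1 hu hv.
apply: tail_sym; apply: (coded_inv_gt1 (r := r^-1)); rewrite ?invrK //.
  exact: irrationalV.
by rewrite invf_gt1 // lt_neqAle r1 (irrational_neq hr (is_rat1 R)).
Qed.

(* For 1/2 < f < 1 and g = 1/f - 1 one has 1/f = 1 + g and 1/(1 - f) = 1 + 1/g. *)
Lemma coded_opp r u v : ~ is_rat r -> coded r u -> coded (- r) v -> tail_equiv u v.
Proof.
suff main (s : R) x y : ~ is_rat s -> coded s x -> coded (- s) y -> 1 / 2 < Dec x ->
  tail_equiv x y.
  move=> hr hu hv.
  have [h|h] := ltP (1 / 2) (Dec u); first exact: main hr hu hv h.
  apply/tail_sym/(main (- r)) => //; [exact: irrationalN|by rewrite opprK|].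
  have /andP[u0 u1] := coded_itv hr hu.
  have /andP[v0 v1] := coded_itv (irrationalN hr) hv.
  have u_irr := coded_irrational hr hu.
  have h' : Dec u < 1 / 2.
    rewrite lt_neqAle h andbT; apply: irrational_neq u_irr _.
    by apply: is_ratM; [exact: is_rat1|apply/is_ratV; exact: (is_rat_nat R 2)].
  move: hu hv => [z zE] [w wE].
  have h1 : (- z - w)%:~R < 2%:~R :> R by rewrite rmorphB rmorphN /=; lra.
  have h2 : 0%:~R < (- z - w)%:~R :> R by rewrite rmorphB rmorphN /=; lra.
  have zw : w = - z - 1 by move: h1 h2; rewrite !ltr_int; lia.
  by rewrite wE zw rmorphB rmorphN /=; lra.
move=> hs hx hy x12.
have /andP[x0 x1] := coded_itv hs hx.
have /andP[y0 y1] := coded_itv (irrationalN hs) hy.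
have x_irr := coded_irrational hs hx.
have yE : Dec y = 1 - Dec x.
  move: hx hy => [z zE] [w wE].
  have h1 : (- z - w)%:~R < 2%:~R :> R by rewrite rmorphB rmorphN /=; lra.
  have h2 : 0%:~R < (- z - w)%:~R :> R by rewrite rmorphB rmorphN /=; lra.
  have zw : w = - z - 1 by move: h1 h2; rewrite !ltr_int; lia.
  by rewrite wE zE zw rmorphB rmorphN /=; lra.
set f := Dec x in x0 x1 x12 x_irr yE *.
pose g := f^-1 - 1.
have g_irr : ~ is_rat g.
  by apply: irrationalDr; [exact: irrationalV|apply/is_ratN/is_rat1].
have g0 : 0 < g by rewrite subr_gt0 invf_gt1.
have [w hw] := coded_exists g; have [w' hw'] := coded_exists g^-1.
have c1 : coded f^-1 w.
  by have := coded_addz 1 hw; rewrite /g subrK.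
have c2 : coded (1 - f)^-1 w'.
  have -> : (1 - f)^-1 = g^-1 + 1%:~R by rewrite /g; field; rewrite !gt_eqF //; lra.
  exact: coded_addz.
have fx : coded f x by exists 0; rewrite subr0.
have fy : coded (1 - f) y by exists 0; rewrite subr0.
have f1_irr : ~ is_rat (1 - f) by rewrite -yE;
  exact: coded_irrational (irrationalN hs) hy.
apply: (tail_trans (coded_inv_pos x_irr x0 fx c1)).
apply: (tail_trans (coded_inv_pos g_irr g0 hw hw')).
apply/tail_sym/(coded_inv_pos f1_irr _ fy c2); lra.
Qed.

Lemma coded_inv r u v : ~ is_rat r -> coded r u -> coded r^-1 v -> tail_equiv u v.
Proof.
move=> hr hu hv; have [r0|r0] := ltP 0 r; first exact: coded_inv_pos hr r0 hu hv.
have rn0 : 0 < - r by rewrite oppr_gt0 lt_neqAle r0 (irrational_neq0 hr).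
have [u' hu'] := coded_exists (- r); have [v' hv'] := coded_exists (- r)^-1.
apply: (tail_trans (coded_opp hr hu hu')).
apply: (tail_trans (coded_inv_pos (irrationalN hr) rn0 hu' hv')).
apply: tail_sym; apply: (coded_opp (irrationalV hr) hv).
by rewrite -invrN.
Qed.

(* Euclid's algorithm on (a, c) writes the matrix as a product of translations,
   inversions and sign changes. *)
Lemma coded_mobius (n : nat) (a b c d : int) r u v : (`|c| <= n)%N ->
  a * d - b * c = 1 \/ a * d - b * c = -1 -> ~ is_rat r -> coded r u ->
  coded ((a%:~R * r + b%:~R) / (c%:~R * r + d%:~R)) v -> tail_equiv u v.
Proof.
elim: n a b c d v => [|n IH] a b c d v cn det hr hu hv.
  have c0 : c = 0 by lia.
  move: det hv; rewrite c0 mulr0 subr0 mul0r add0r => det.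
  have [[aE|aE] [dE|dE]] : (a = 1 \/ a = -1) /\ (d = 1 \/ d = -1).
    have : (`|a| * `|d|)%N = 1%N by rewrite -abszM; case: det => ->.
    by move/eqP; rewrite muln_eq1 => /andP[/eqP a1 /eqP d1]; lia.
  - rewrite aE dE divr1 mul1r => /(coded_addz (- b)); rewrite mulrNz addrK => hv.
    by rewrite (coded_fun hr hu hv); exact: tail_refl.
  - rewrite aE dE mul1r mulrN1z invrN1 mulrN1 opprD => /(coded_addz b).
    by rewrite subrK; exact: coded_opp.
  - rewrite aE dE divr1 mulrN1z mulN1r => /(coded_addz (- b)); rewrite mulrNz addrK.
    exact: coded_opp.
  - rewrite aE dE mulrN1z mulN1r invrN1 mulrN1 opprD opprK => /(coded_addz b).
    by rewrite subrK => hv; rewrite (coded_fun hr hu hv); exact: tail_refl.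
have [c0|c0] := eqVneq c 0; first by apply: (IH a b c d) => //; lia.
have lin_irr (p q : int) : p != 0 -> ~ is_rat (p%:~R * r + q%:~R).
  move=> p0 h; apply: hr.
  have -> : r = (p%:~R * r + q%:~R - q%:~R) / p%:~R
    by rewrite addrK mulrC mulKf // intr_eq0.
  by apply: is_ratM; [apply: is_ratB => //|apply: is_ratV]; exact: is_rat_int.
have den := irrational_neq0 (lin_irr c d c0).
pose q := (a %/ c)%Z; pose a' := (a %% c)%Z; pose b' := b - q * d.
have aE : a = q * c + a' by exact: divz_eq.
have a'0 : 0 <= a' by apply: modz_ge0.
have a'c : (`|a'| < `|c|)%N by have := ltz_mod a c0; rewrite -/a'; lia.
have det' : c * b' - d * a' = 1 \/ c * b' - d * a' = -1.
  have E : c * b' - d * a' = - (a * d - b * c) by rewrite /b' aE; ring.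
  by rewrite E; case: det => ->; [right|left].
pose s := (a'%:~R * r + b'%:~R) / (c%:~R * r + d%:~R).
have sE : (a%:~R * r + b%:~R) / (c%:~R * r + d%:~R) = s + q%:~R.
  by rewrite /s /b' aE !rmorphB !rmorphD !rmorphM /=; field.
have s_irr : ~ is_rat s.
  move=> hs; apply: hr; apply: is_rat_PGL2Z (PGL2Z_sym _) hs.
  exists a', b', c, d; split => //.
  by have -> : a' * d - b' * c = - (c * b' - d * a') by [ring]; case: det' => ->;
    [right|left].
have hv' : coded s v.
  by have := coded_addz (- q) hv; rewrite sE mulrNz addrK.
have [w hw] := coded_exists s^-1.
apply: tail_trans (tail_sym (coded_inv s_irr hv' hw)).
apply: (IH c d a' b') => //; first lia.
by have := hw; rewrite /s invf_div.
Qed.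

Theorem PGL2Z_tail_equiv x y : tail_equiv x y <-> PGL2Z_equiv (Dec x) (Dec y).
Proof.
split; first exact: PGL2Z_of_tail.
(* Codings are unique only for irrational numbers, so the rational class is settled by its common
   tail. *)
move=> h; have [hx|hx] := pselect (is_rat (Dec x)).
  by apply: (@rational_tail_equiv R N N2) => //; exact: is_rat_PGL2Z h hx.
have [a [b [c [d [det _ yE]]]]] := h.
apply: (coded_mobius (leqnn _) det hx); first by exists 0; rewrite subr0.
by exists 0; rewrite subr0.
Qed.

Lemma PGL2Z_Dec_surj r : exists x, PGL2Z_equiv (Dec x) r.
Proof.
have [x [z xE]] := coded_exists r; exists x.
by have := PGL2Z_addz (Dec x) z; rewrite {2}xE subrK.
Qed.

End Serret.

(** * Lagrange's theorem *)

Section Quadratic.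
Variable R : realType.
Implicit Types r s t : R.

Definition form_root (A B C : int) r := A%:~R * r ^+ 2 + B%:~R * r + C%:~R = 0.

(** The leading coefficient may vanish: rational numbers are roots of linear forms, and the
    substitution in forms needs no case distinction. *)
Definition quadratic r := exists A B C : int,
  ~ [/\ A = 0, B = 0 & C = 0] /\ form_root A B C r.

Lemma form_root0 (A B C : int) r : ~ [/\ A = 0, B = 0 & C = 0] ->
  form_root A B C r -> ~ is_rat r -> A != 0.
Proof.
move=> nz; rewrite /form_root => E hr; apply/eqP => A0; move: E;
  rewrite A0 mul0r add0r => E.
have [B0|B0] := eqVneq B 0.
  apply: nz; split=> //; move: E; rewrite B0 mul0r add0r => /eqP.
  by rewrite intr_eq0 => /eqP.
apply: hr; have -> : r = - C%:~R / B%:~R.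
  apply: (mulfI (_ : B%:~R != 0)); first by rewrite intr_eq0.
  by rewrite mulrCA divff ?intr_eq0 // mulr1; apply/eqP; rewrite -subr_eq0 opprK E.
by apply: is_ratM; [apply: is_ratN|apply: is_ratV]; exact: is_rat_int.
Qed.

Lemma quadratic_or_rationalE r : quadratic_or_rational r <-> quadratic r.
Proof.
split=> [[[q ->]|[a [b [c [a0 E]]]]]|[A [B [C [nz E]]]]].
- exists 0, (denq q), (- numq q); split; first by move=> [_ /eqP];
    rewrite (negPf (denq_neq0 q)).
  rewrite /form_root mul0r add0r rmorphN /ratr /= mulrC divfK ?subrr //.
  by rewrite intr_eq0 denq_neq0.
- by exists a, b, c; split => // -[/eqP]; rewrite (negPf a0).
- have [hr|hr] := pselect (is_rat r); first by left.
  by right; exists A, B, C; split => //; exact: form_root0 nz E hr.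
Qed.

Lemma quadratic_PGL2Z r s : PGL2Z_equiv r s -> quadratic r -> quadratic s.
Proof.
move=> /PGL2Z_sym [a [b [c [d [det n0 rE]]]]] [A [B [C [nz E]]]].
pose A' := A * a ^+ 2 + B * a * c + C * c ^+ 2.
pose B' := 2 * A * a * b + B * (a * d + b * c) + 2 * C * c * d.
pose C' := A * b ^+ 2 + B * b * d + C * d ^+ 2.
have det2 : (a * d - b * c) ^+ 2 = 1 by case: det => ->; rewrite ?expr1n // sqrrN expr1n.
exists A', B', C'; split.
  (* Substituting the adjugate matrix recovers the old form up to the squared determinant, which is
     1, so the new form vanishes only with the old one. *)
  move=> [a0 b0 c0]; apply: nz; split.
  - rewrite -[LHS]mul1r -det2; have -> : (a * d - b * c) ^+ 2 * A =
      A' * d ^+ 2 - B' * c * d + C' * c ^+ 2 by rewrite /A' /B' /C'; ring.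
    by rewrite a0 b0 c0; ring.
  - rewrite -[LHS]mul1r -det2; have -> : (a * d - b * c) ^+ 2 * B =
      - 2 * A' * b * d + B' * (a * d + b * c) - 2 * C' * a * c by rewrite /A' /B' /C';
          ring.
    by rewrite a0 b0 c0; ring.
  - rewrite -[LHS]mul1r -det2; have -> : (a * d - b * c) ^+ 2 * C =
      A' * b ^+ 2 - B' * a * b + C' * a ^+ 2 by rewrite /A' /B' /C'; ring.
    by rewrite a0 b0 c0; ring.
rewrite /form_root.
have -> : A'%:~R * s ^+ 2 + B'%:~R * s + C'%:~R = (c%:~R * s + d%:~R) ^+ 2 *
    (A%:~R * r ^+ 2 + B%:~R * r + C%:~R).
  rewrite rE /A' /B' /C' !rmorphD !rmorphM ?rmorphXn /= !rmorphD !rmorphM /=; field.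
  exact: n0.
by rewrite E mulr0.
Qed.

End Quadratic.

Section Lagrange.
Variables (R : realType) (N : nat).
Hypothesis N2 : (2 <= N)%N.
Implicit Types (x y u v w : Omega N) (i j : 'I_N) (t s r : R).

Notation slow := (@slow_map R N).
Notation Dec := (@Dec R N).

(** The periodic tail is a fixed point of a word map, and the fixed point equation has the positive
    leading coefficient [c] because the word is nonempty. *)
Lemma periodic_quadratic x m n : (m < n)%N ->
  (forall i : nat, x (m + i)%N = x (n + i)%N) ->
  quadratic (Dec x).
Proof.
move=> mn h; apply: (quadratic_PGL2Z (PGL2Z_shift R N2 x m)).
set y := shift_seq m x.
have E : shift_seq (n - m) y = y.
  by rewrite /y shift_seqD subnKC ?(ltnW mn) //; apply: funext => i; rewrite /shift_seq h.
have /andP[t0 _] := Dec_itv R N2 y.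
have := Dec_word R N2 y (n - m); rewrite E.
have [a [b [c [d [[d0 _ _ _ c0] _ ->]]]]] // := word_map_mobius R N2 (mkseq y (n - m)).
rewrite size_mkseq subn_gt0 in c0; have {}c0 := c0 mn.
set t := Dec y in t0 *; have p : 0 < c%:R * t + d%:R
  by rewrite ltr_wpDl ?mulr_ge0 // ltr0n.
move=> /(congr1 ( *%R^~ (c%:R * t + d%:R))); rewrite divfK ?gt_eqF // => tE.
exists c%:Z, (d%:Z - a%:Z), (- b%:Z); split.
  by move=> [/eqP]; rewrite eqz_nat; lia.
rewrite /form_root rmorphB rmorphN /= -!pmulrn; lra.
Qed.

(** Vieta's relations describe a root together with its conjugate and involve no square root of the
    discriminant. *)
Definition root_pair (A B C : int) t s :=
  [/\ A != 0, A%:~R * (t + s) = - B%:~R & A%:~R * (t * s) = C%:~R].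

(** The inverse of [slow i], taken on the real line because the conjugate root may leave the unit
    interval. *)
Definition unslow i s := if i == 0%N :> nat then s / (1 - (N.-1)%:R * s) else s^-1 - (N -
  i)%N%:R.

Lemma unslowK i s : ~ is_rat s -> slow i (unslow i s) = s.
Proof.
move=> hs; rewrite /slow_map /unslow.
have [i0|i0] := boolP (i == 0%N :> nat); last by rewrite subrK div1r invrK.
have n0 : 1 - (N.-1)%:R * s != 0.
  have N0 : (N.-1)%:R != 0 :> R by rewrite pnatr_eq0; lia.
  apply/eqP => E; apply: hs; have -> : s = (N.-1)%:R^-1.
    by apply: (mulfI N0); rewrite divff //; lra.
  by apply/is_ratV/is_rat_nat.
field; rewrite n0 /=.
have -> : (N.-1)%:R * s + (1 - (N.-1)%:R * s) = 1 :> R by ring.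
exact: oner_neq0.
Qed.

Lemma irrational_unslow i s : ~ is_rat s -> ~ is_rat (unslow i s).
Proof. by move=> hs /(is_rat_slow i); rewrite unslowK. Qed.

(** Negative numbers are again outside the unit interval, so an orbit under these inverses that
    leaves the interval stays negative from the next step on. *)
Lemma unslow_lt0 i s : ~ unit_itv s -> unslow i s < 0.
Proof.
move=> ns; have m1 : 1 <= (N.-1)%:R :> R by rewrite ler1n; lia.
have k1 : 1 <= (N - i)%N%:R :> R by rewrite ler1n subn_gt0.
have [s0|s0] := ltP s 0.
  rewrite /unslow; case: ifP => _.
    by rewrite pmulr_llt0 // invr_gt0; nra.
  have : s^-1 < 0 by rewrite invr_lt0.
  lra.
have s1 : 1 < s by rewrite ltNge; apply/negP => s1; apply: ns; rewrite /unit_itv s0.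
rewrite /unslow; case: ifP => _.
  by rewrite nmulr_llt0 // ?invr_lt0; nra.
have : s^-1 < 1 by rewrite invf_lt1 // (lt_trans ltr01).
lra.
Qed.

(** An integral substitution of determinant 1 or -1 preserves the discriminant. Irrationality keeps
    the denominators and the new leading coefficient nonzero. *)
Lemma root_pair_step i (A B C : int) t s : ~ is_rat t -> ~ is_rat s ->
  root_pair A B C (slow i t) (slow i s) ->
  exists A' B' C', root_pair A' B' C' t s /\ B' ^+ 2 - 4 * A' * C' = B ^+ 2 - 4 * A * C.
Proof.
move=> ht hs [A0 h1 h2].
have AR : A%:~R != 0 :> R by rewrite intr_eq0.
have [[i0 hi]|[k [k0 kN ik hi]]] := letter_cases R N2 i; rewrite !hi in h1 h2.
  pose m := (N.-1)%:Z.
  have mR : (N.-1)%:R = m%:~R :> R by rewrite /m -pmulrn.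
  have m0 : m != 0 by rewrite /m; lia.
  have nz (r : R) : ~ is_rat r -> m%:~R * r + 1 != 0.
    move=> hr; apply/eqP => E; apply: hr; have -> : r = - 1 / m%:~R.
      apply: (mulfI (_ : m%:~R != 0)); first by rewrite intr_eq0.
      by rewrite mulrCA divff ?intr_eq0 //; lra.
    by apply: is_ratM; [exact/is_ratN/is_rat1|exact/is_ratV/is_rat_int].
  have nt := nz _ ht; have ns := nz _ hs; rewrite mR in h1 h2.
  exists (A + B * m + C * m ^+ 2), (B + 2 * C * m), C.
  have BR : B%:~R = - (A%:~R * (t / (m%:~R * t + 1) + s / (m%:~R * s + 1))) :> R
    by rewrite h1 opprK.
  have A'E : (A + B * m + C * m ^+ 2)%:~R = A%:~R / ((m%:~R * t + 1) * (m%:~R * s + 1))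
    :> R.
    rewrite !rmorphD !rmorphM ?rmorphXn /= BR -h2; field.
    by rewrite nt ns.
  split; last by ring.
  split.
  - by rewrite -(intr_eq0 R) A'E mulf_neq0 // invr_eq0 mulf_neq0.
  - rewrite A'E rmorphD !rmorphM /= BR -h2; field; by rewrite nt ns.
  - rewrite A'E -h2; field; by rewrite nt ns.
have kR : k%:R = k%:Z%:~R :> R by rewrite -pmulrn.
have nz (r : R) : ~ is_rat r -> k%:Z%:~R + r != 0.
  by move=> hr; rewrite addrC; apply/irrational_neq0/irrationalDr => //;
    exact: is_rat_int.
have nt := nz _ ht; have ns := nz _ hs; rewrite kR in h1 h2.
rewrite ![_ + k%:Z%:~R]addrC in h1 h2.
have BR : B%:~R = - (A%:~R * (1 / (k%:Z%:~R + t) + 1 / (k%:Z%:~R + s))) :> R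
  by rewrite h1 opprK.
exists C, (B + 2 * k%:Z * C), (A + k%:Z * B + k%:Z ^+ 2 * C).
split; last by ring.
split.
- rewrite -(intr_eq0 R) -h2 mulf_neq0 // mulf_neq0 // mul1r invr_eq0 //.
- rewrite rmorphD !rmorphM /= BR -h2; field; by rewrite nt ns.
- rewrite !rmorphD !rmorphM ?rmorphXn /= BR -h2; field; by rewrite nt ns.
Qed.

Lemma root_pair_pos (A B C : int) t s t' s' : root_pair A B C t s ->
  root_pair A B C t' s' ->
  0 < t -> s < 0 -> 0 < t' -> s' < 0 -> t = t'.
Proof.
move=> [A0 h1 h2] [_ h1' h2'] t0 s0 t0' s0'.
have AR : A%:~R != 0 :> R by rewrite intr_eq0.
have e1 : t + s = t' + s' by apply: (mulfI AR); rewrite h1 h1'.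
have e2 : t * s = t' * s' by apply: (mulfI AR); rewrite h2 h2'.
have : (t - t') * (t - s') = 0.
  have -> : s' = t + s - t' by rewrite e1; ring.
  have -> : (t - t') * (t - (t + s - t')) = t * t' - t' * t' - (t * s - t' * s) by ring.
  rewrite e2; have -> : s' = t + s - t' by rewrite e1; ring.
  ring.
move/eqP; rewrite mulf_eq0 => /orP[|]; rewrite subr_eq0 => /eqP //.
by move=> E; move: t0; rewrite E; lra.
Qed.

(** Roots of opposite signs give [A * C < 0], so the discriminant is the sum of [B^2] and [4 |A C|],
    with no cancellation. *)
Lemma root_pair_bound (A B C : int) t s : root_pair A B C t s -> 0 < t -> s < 0 ->
  (`|A| <= `|(B ^+ 2 - 4 * A * C)%R|)%N /\ (`|B| <= `|(B ^+ 2 - 4 * A * C)%R|)%N /\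
  (`|C| <= `|(B ^+ 2 - 4 * A * C)%R|)%N.
Proof.
move=> [A0 _ h2] t0 s0.
have AR : A%:~R != 0 :> R by rewrite intr_eq0.
have AC : A * C < 0.
  rewrite -(ltrz0 R) rmorphM /= -h2 mulrA -expr2.
  have : 0 < A%:~R ^+ 2 :> R by rewrite exprn_even_gt0.
  have : t * s < 0 by nra.
  nra.
set D := B ^+ 2 - 4 * A * C.
have DE : D = B ^+ 2 + 4 * `|A * C| by rewrite ltr0_norm //; rewrite /D; ring.
have DN : `|D|%N = (`|B| ^ 2 + 4 * (`|A| * `|C|))%N.
  apply/eqP; rewrite -eqz_nat gez0_abs; last by rewrite DE; nia.
  by rewrite DE PoszD PoszM -!abszX -!abszM; apply/eqP; congr (_ + 4 * _); lia.
have C0 : C != 0 by apply/eqP => C0; move: AC; rewrite C0 mulr0 ltxx.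
have An : (0 < `|A|)%N by rewrite absz_gt0.
have Cn : (0 < `|C|)%N by rewrite absz_gt0.
by rewrite DN; split; [|split]; nia.
Qed.

(* The conjugate of Dec x cannot follow the itinerary x, so its successive images
   leave [0, 1] and are negative from then on. The forms A X^2 + B X + C of the
   successive tails then satisfy A C < 0; as their discriminant is constant, they
   are finitely many. *)
Lemma quadratic_periodic x : quadratic (Dec x) ->
  exists m n, (m < n)%N /\ forall i : nat, x (m + i)%N = x (n + i)%N.
Proof.
have [hx|hx] := pselect (is_rat (Dec x)).
  have [n hn] := Dec_rational N2 hx => _; exists n, n.+1; split => // i.
  by apply: ord_inj; rewrite hn addSnnS hn.
move=> [A [B [C [nz E]]]]; have A0 := form_root0 nz E hx.
have AR : A%:~R != 0 :> R by rewrite intr_eq0.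
pose T n := Dec (shift_seq n x).
have T_irr n : ~ is_rat (T n) by exact: irrational_Dec_shift.
have TS n : T n = slow (x n) (T n.+1) by exact: Dec_stepn.
pose Sq := fix Sq n := if n is n'.+1 then unslow (x n') (Sq n') else - B%:~R / A%:~R -
  Dec x.
have S_irr n : ~ is_rat (Sq n).
  elim: n => [|n IH] /=; last exact: irrational_unslow.
  rewrite addrC; apply: irrationalDr; first exact: irrationalN.
  by apply: is_ratM; [exact/is_ratN/is_rat_int|exact/is_ratV/is_rat_int].
have SS n : Sq n = slow (x n) (Sq n.+1) by rewrite /= unslowK.
pose D := B ^+ 2 - 4 * A * C.
have /choice [F hF] n : exists p : int * int * int,
    root_pair p.1.1 p.1.2 p.2 (T n) (Sq n) /\ p.1.2 ^+ 2 - 4 * p.1.1 * p.2 = D.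
  elim: n => [|n [[[A' B'] C'] /= [h hD]]].
    exists (A, B, C); split => //=; split => //; rewrite /T /=.
      by field.
    move: E; rewrite /form_root => E.
    have -> : A%:~R * (Dec (shift_seq 0 x) * (- B%:~R / A%:~R - Dec x)) =
       - (A%:~R * Dec x ^+ 2 + B%:~R * Dec x) by rewrite shift_seq0; field.
    by apply/eqP; rewrite eq_sym -subr_eq0 opprK addrC E.
  rewrite TS SS in h; have [||A1 [B1 [C1 [h1 h2]]]] := root_pair_step _ _ h.
  - exact: T_irr.
  - exact: S_irr.
  - by exists (A1, B1, C1); split => //=; rewrite h2.
have T0 n : 0 < T n by have /andP[] := irrational_itv (T_irr n) (Dec_itv R N2 _).
have [n1 hn1] : exists n1, ~ unit_itv (Sq n1).
  apply: contrapT => h.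
  have hS n : unit_itv (Sq n) by apply: contrapT => h'; apply: h; exists n.
  (* Equality with the conjugate would make [Dec x] equal to the rational number [- B / (2 A)]. *)
  have ST : Sq 0%N = Dec x by exact: Dec_unique hS SS.
  apply: hx; have -> : Dec x = (- B%:~R / A%:~R) / 2%:R by move: ST => /=; lra.
  apply: is_ratM; last exact/is_ratV/is_rat_nat.
  by apply: is_ratM; [exact/is_ratN/is_rat_int|exact/is_ratV/is_rat_int].
have Sneg n : Sq (n1.+1 + n)%N < 0.
  elim: n => [|n IH]; first by rewrite addn0; exact: unslow_lt0.
  rewrite addnS; suff h : ~ unit_itv (Sq (n1.+1 + n)%N) by exact: unslow_lt0 h.
  by move=> /andP[]; rewrite leNgt IH.
(* The coefficients lie between [- |D|] and [|D|]; adding [|D|] turns them into indices below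
   [2 |D| + 1]. *)
pose K := (`|D|%N + `|D|%N).+1.
pose G (n : nat) : 'I_K * 'I_K * 'I_K :=
  let p := F (n1.+1 + n)%N in
  (inord `|(p.1.1 + `|D|)%R|%N, inord `|(p.1.2 + `|D|)%R|%N, inord `|(p.2 + `|D|)%R|%N).
have bound n : let p := F (n1.+1 + n)%N in
    (`|p.1.1| <= `|D|)%N /\ (`|p.1.2| <= `|D|)%N /\ (`|p.2| <= `|D|)%N.
  have [h hD] := hF (n1.+1 + n)%N.
  by have := root_pair_bound h (T0 _) (Sneg _); rewrite hD.
have [m [n [mn GE]]] : exists m n, (m < n)%N /\ G m = G n.
  apply: (@finite_pigeonhole _ setT) => //; exact: finite_finset.
have inj (z z' : int) : (`|z| <= `|D|)%N -> (`|z'| <= `|D|)%N ->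
    inord `|(z + `|D|)%R|%N = inord `|(z' + `|D|)%R|%N :> 'I_K -> z = z'.
  by move=> hz hz' /(congr1 (@nat_of_ord _)); rewrite !inordK /K; lia.
have FE : F (n1.+1 + m)%N = F (n1.+1 + n)%N.
  move: GE (bound m) (bound n); rewrite /G.
  case: (F (n1.+1 + m)%N) (F (n1.+1 + n)%N) => [[a b] c] [[a' b'] c'] /=.
  move=> [] /inj h1 /inj h2 /inj h3 [b1 [b2 b3]] [b1' [b2' b3']].
  by rewrite (h1 b1 b1') (h2 b2 b2') (h3 b3 b3').
have [hm _] := hF (n1.+1 + m)%N; have [hn _] := hF (n1.+1 + n)%N; rewrite FE in hm.
have TE := root_pair_pos hm hn (T0 _) (Sneg _) (T0 _) (Sneg _).
have sE := Dec_inj N2 (T_irr _) TE.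
exists (n1.+1 + m)%N, (n1.+1 + n)%N; split; first by rewrite ltn_add2l.
by move=> i; have := congr1 (fun z : Omega N => z i) sE.
Qed.

Theorem quadratic_periodicP x : quadratic_or_rational (Dec x) <->
  exists m n, (m < n)%N /\ forall i : nat, x (m + i)%N = x (n + i)%N.
Proof.
rewrite quadratic_or_rationalE; split; first exact: quadratic_periodic.
by move=> [m [n [mn h]]]; exact: periodic_quadratic mn h.
Qed.

End Lagrange.

Theorem theorem1 (R : realType) (N : nat) (hN : (2 <= N)%N)
    (ON : cstarType R) (S : 'I_N -> ON) (hON : is_cuntz_algebra S)
    (piS : representation ON) (e : Omega N -> rep_space piS)
    (hpiS : is_shift_representation S e) :
  exists F : rep_class ON -> set R,
    [/\ bijection_between (irr_permutative_class S) (@is_PGL2Z_class R) F,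
        (forall x : Omega N,
          irr_permutative_class S (restriction_class (tail_subspace e x)) /\
          F (restriction_class (tail_subspace e x)) = PGL2Z_class (Dec R x)),
        (forall C, irr_permutative_class S C ->
          exists x : Omega N, C = restriction_class (tail_subspace e x))
      & forall pi : representation ON, irreducible pi -> permutative S pi ->
          (F (unitary_class pi) `<=` [set r | quadratic_or_rational r]
           <-> finite_set (atoms S pi))].
Proof.
pose cls x := restriction_class (tail_subspace e x).
(* Collecting all [x] that represent [C] avoids choosing one; that they give a single class follows
   from [tail_subspace_class_inj]. *)
pose F (C : rep_class ON) := [set r | exists x, C = cls x /\ PGL2Z_equiv (Dec R x) r].
have FE x : F (cls x) = PGL2Z_class (Dec R x).
  apply/seteqP; split=> [r [y [xy yr]]|r xr]; last by exists x.
  apply: PGL2Z_trans yr; apply/(PGL2Z_tail_equiv R hN).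
  exact: (tail_subspace_class_inj hON hpiS xy).
have clsP C : irr_permutative_class S C -> exists x, C = cls x.
  move=> [pi [irr perm ->]].
  by have [x [xE _]] := irr_permutative_tail_subspace hON hpiS irr perm; exists x.
have class_eq (r s : R) : PGL2Z_equiv r s -> PGL2Z_class r = PGL2Z_class s.
  move=> rs; apply/seteqP; split=> t; apply: PGL2Z_trans => //.
  exact: PGL2Z_sym.
exists F; split.
- split.
  + by move=> C /clsP [x ->]; exists (Dec R x).
  + move=> C C' /clsP [x ->] /clsP [y ->]; rewrite !FE => xy.
    congr restriction_class; apply: tail_subspace_eq.
    apply/(PGL2Z_tail_equiv R hN).
    have : PGL2Z_class (Dec R y) (Dec R y) by exact: PGL2Z_refl.
    by rewrite -xy.
  + move=> _ [r ->]; have [x xr] := PGL2Z_Dec_surj hN r.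
    exists (cls x); first exact: (tail_subspace_class hON hpiS).
    by rewrite FE; exact: class_eq.
- by move=> x; split; [exact: (tail_subspace_class hON hpiS)|exact: FE].
- exact: clsP.
- move=> pi irr perm.
  have [x [-> ->]] := irr_permutative_tail_subspace hON hpiS irr perm.
  (* Rational and quadratic numbers form a union of PGL_2(Z)-classes, so the inclusion is decided by
     the one element [Dec R x]. *)
  rewrite -/(cls x) FE -(quadratic_periodicP R hN); split=> [h|hx r xr].
    by apply: h; exact: PGL2Z_refl.
  apply/quadratic_or_rationalE; apply: quadratic_PGL2Z xr _.
  exact/quadratic_or_rationalE.
Qed.
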